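(* Let $n\ge1$, $\alpha\in(0,2]$, $\beta>0$, and let $S_{\alpha,\beta}(\omega)$, $\omega\in\mathbb{R}^n\setminus\{0\}$, be the spectral density of the centered stationary Gaussian field on $\mathbb{R}^n$ with covariance $C_{\alpha,\beta}(\tau)=(1+\Vert\tau\Vert^{\alpha})^{-\beta}$. If $\alpha\in(0,2)$ and $\beta>0$, then as $\Vert\omega\Vert\to\infty$ one has the asymptotic series $$S_{\alpha,\beta}(\omega)\sim\frac{1}{\pi^{\frac{n+2}{2}}}\frac{1}{\Gamma(\beta)}\sum_{j=1}^{\infty}\frac{(-1)^{j-1}2^{\alpha j}}{j!}\Gamma(\beta+j)\,\Gamma\!\left(\frac{\alpha j+n}{2}\right)\Gamma\!\left(\frac{\alpha j+2}{2}\right)\sin\frac{\pi\alpha j}{2}\;\Vert\omega\Vert^{-\alpha j-n}.$$ If $\alpha=2$ and $\beta>0$, then as $\Vert\omega\Vert\to\infty$ one has the asymptotic series $$S_{2,\beta}(\omega)\sim\frac{\Vert\omega\Vert^{\beta-\frac{n+1}{2}}}{2^{\frac{n-1}{2}+\beta}\pi^{\frac{n-1}{2}}\Gamma(\beta)}\,e^{-\Vert\omega\Vert}\sum_{j=0}^{\infty}\frac{1}{(2\Vert\omega\Vert)^j}\frac{\Gamma\left(j-\beta+\frac{n+1}{2}\right)}{j!\,\Gamma\left(\frac{n+1}{2}-j-\beta\right)}.$$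
   Context: $\Vert\cdot\Vert$ is the Euclidean norm. The spectral density of a stationary field with covariance $C(t)$ is the Fourier transform $S(\omega)=\frac{1}{(2\pi)^n}\int_{\mathbb{R}^n}e^{-i\omega\cdot t}C(t)\,d^nt$ if this integral converges, and otherwise the Fourier transform (same normalization) of $C$ as a generalized function on Schwartz space; alternatively, it is the function $S$ satisfying $C(t)=\int_{\mathbb{R}^n}e^{i\omega\cdot t}S(\omega)\,d^n\omega$. The asymptotic series are understood in the Poincaré sense: in the first case, for every $m\ge1$, the difference between $S_{\alpha,\beta}(\omega)$ and the sum of the terms $j=1,\dots,m$ is $O(\Vert\omega\Vert^{-\alpha(m+1)-n})$; in the second case, for every $m\ge0$, after division by the prefactor, the difference with the sum of the terms $j=0,\dots,m$ is $O(\Vert\omega\Vert^{-(m+1)})$. In the second series, a ratio of Gamma functions whose arguments are both poles is understood by continuity in $\beta$, i.e. $\Gamma(\nu+j+\frac12)/\Gamma(\nu-j+\frac12)=\prod_{k=-j}^{j-1}(\nu+\frac12+k)$ with $\nu=\frac n2-\beta$. *)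

(* Defs.v *)
From HB Require Import structures.
From mathcomp Require Import all_boot all_order all_algebra.
From mathcomp Require Import all_classical all_reals all_analysis.

Set Implicit Arguments.
Unset Strict Implicit.
Unset Printing Implicit Defensive.
Import Order.TTheory GRing.Theory Num.Theory.
Import numFieldNormedType.Exports.
Local Open Scope classical_set_scope.
Local Open Scope ring_scope.

Section tuple_measure.
Context {d : measure_display} {T : measurableType d} {R : realType}.

Definition cons_pair n (p : T * n.-tuple T) : n.+1.-tuple T :=
  [the n.+1.-tuple T of p.1 :: p.2].

Lemma measurable_cons_pair n : measurable_fun [set: _] (@cons_pair n).
Proof. by apply: measurable_cons. Qed.

Section cons_measure.
Context n (m1 : {sigma_finite_measure set T -> \bar R})
  (mu : {sigma_finite_measure set (n.-tuple T) -> \bar R}).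

Definition cons_measure : set (n.+1.-tuple T) -> \bar R :=
  pushforward (m1 \x mu)%E (@cons_pair n).

Let cons_measure0 : cons_measure set0 = 0%E.
Proof. by rewrite /cons_measure /pushforward preimage_set0 measure0. Qed.

Let cons_measure_ge0 A : (0 <= cons_measure A)%E.
Proof. by rewrite /cons_measure /pushforward measure_ge0. Qed.

Let cons_measure_sigma_additive : semi_sigma_additive cons_measure.
Proof.
move=> F mF tF mUF; rewrite /cons_measure /pushforward preimage_bigcup.
apply: measure_semi_sigma_additive.
- by move=> k; rewrite -[X in measurable X]setTI; exact: measurable_cons_pair.
- apply/trivIsetP => /= i j _ _ ij; rewrite -preimage_setI.
  by move/trivIsetP : tF => /(_ _ _ _ _ ij) ->//; rewrite preimage_set0.
- rewrite -preimage_bigcup -[X in measurable X]setTI.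
  exact: measurable_cons_pair.
Qed.

HB.instance Definition _ := isMeasure.Build _ _ _ cons_measure
  cons_measure0 cons_measure_ge0 cons_measure_sigma_additive.

Let cons_measure_sigma_finite : sigma_finite [set: _] cons_measure.
Proof.
have /sigma_finiteP[F [TF ndF Foo]] := sigma_finiteT m1.
have /sigma_finiteP[G [TG ndG Goo]] := sigma_finiteT mu.
pose g (t : n.+1.-tuple T) : T * n.-tuple T := (thead t, [tuple of behead t]).
have mg : measurable_fun [set: _] g.
  apply/measurable_fun_pairP; split; first exact: measurable_tnth.
  exact: measurable_behead.
have cK : cancel (@cons_pair n) g.
  by move=> [x t]; rewrite /g; congr pair; apply: val_inj.
exists (fun k => g @^-1` (F k `*` G k)).
  apply/seteqP; split => // t _.
  have [i _ Fi] : (\bigcup_i F i) (g t).1 by rewrite -TF.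
  have [j _ Gj] : (\bigcup_i G i) (g t).2 by rewrite -TG.
  exists (maxn i j) => //; split.
    by apply: subsetPset Fi; exact/ndF/leq_maxl.
  by apply: subsetPset Gj; exact/ndG/leq_maxr.
move=> k; have [mF Fk] := Foo k; have [mG Gk] := Goo k.
have mFG : measurable (F k `*` G k) by exact: measurableX.
split; first by rewrite -[X in measurable X]setTI; exact: mg.
rewrite /cons_measure /pushforward (_ : _ @^-1` _ = F k `*` G k).
  by rewrite product_measure1E// lte_mul_pinfty// ge0_fin_numE.
by rewrite -comp_preimage (_ : g \o _ = id) ?preimage_id//; apply/funext/cK.
Qed.

HB.instance Definition _ := Measure_isSigmaFinite.Build _ _ _ cons_measure
  cons_measure_sigma_finite.

End cons_measure.

Fixpoint tuple_measure (m1 : {sigma_finite_measure set T -> \bar R}) n :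
    {sigma_finite_measure set (n.-tuple T) -> \bar R} :=
  match n with
  | 0 => dirac [tuple of [::]]
  | m.+1 => cons_measure m1 (tuple_measure m1 m)
  end.

End tuple_measure.

Section lebesgue_Rn.
Context {R : realType}.

Definition lebesgue_tuple n :
    {sigma_finite_measure set (n.-tuple (measurableTypeR R)) -> \bar R} :=
  tuple_measure (@lebesgue_measure R) n.

(* [n.-tuple] carries the product sigma-algebra and ['rV_n] the topology:
   points of R^n are row vectors, and integrals are transported along
   [row_of_tuple]. *)
Definition row_of_tuple n (t : n.-tuple (measurableTypeR R)) : 'rV[R]_n :=
  \row_(i < n) tnth t i.

Definition Rn_integrable n (f : 'rV[R]_n -> R) : Prop :=
  (lebesgue_tuple n).-integrable [set: _] (EFin \o f \o @row_of_tuple n).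

Definition Rn_integral n (f : 'rV[R]_n -> R) : R :=
  Rintegral (lebesgue_tuple n) [set: _] (f \o @row_of_tuple n).

End lebesgue_Rn.

Section euclidean.
Context {R : realType}.

Definition dot n (x y : 'rV[R]_n) : R := \sum_(i < n) x 0 i * y 0 i.

(* The library norm on ['rV_n] is the sup norm. *)
Definition enorm n (x : 'rV[R]_n) : R := Num.sqrt (dot x x).

Definition continuous_off0 n (S : 'rV[R]_n -> R) : Prop :=
  forall w : 'rV[R]_n, w != 0 -> {for w, continuous S}.

Fixpoint partials n (s : seq 'I_n) (f : 'rV[R]_n -> R) : 'rV[R]_n -> R :=
  match s with
  | [::] => f
  | i :: s' => fun x => 'D_(delta_mx 0 i) (partials s' f) x
  end.

Definition schwartz n (f : 'rV[R]_n -> R) : Prop :=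
  (forall (s : seq 'I_n) (x : 'rV[R]_n), differentiable (partials s f) x) /\
  (forall (s : seq 'I_n) (k : nat), exists K : R,
     forall x : 'rV[R]_n, enorm x ^+ k * `|partials s f x| <= K).

End euclidean.

Section spectral_density.
Context {R : realType}.

(* int e^{i w.t} f(t) dt = cos_transform f w + i sin_transform f w *)
Definition cos_transform n (f : 'rV[R]_n -> R) (w : 'rV[R]_n) : R :=
  Rn_integral (fun t => cos (dot w t) * f t).
Definition sin_transform n (f : 'rV[R]_n -> R) (w : 'rV[R]_n) : R :=
  Rn_integral (fun t => sin (dot w t) * f t).

(* S(w) = (2 pi)^-n int e^{-i w.t} C(t) dt, real and imaginary parts *)
Definition fourier_integral n (C S : 'rV[R]_n -> R) : Prop :=
  forall w : 'rV[R]_n, w != 0 ->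
    S w = ((2 * pi) ^+ n)^-1 * cos_transform C w /\
    0 = ((2 * pi) ^+ n)^-1 * - sin_transform C w.

(* <S, phi> = <C, (2 pi)^-n int e^{-i w.t} phi(w) dw>; real phi suffice by
   linearity. *)
Definition generalized_fourier n (C S : 'rV[R]_n -> R) : Prop :=
  forall phi : 'rV[R]_n -> R, schwartz phi ->
    [/\ Rn_integrable (fun w => S w * phi w),
        Rn_integral (fun w => S w * phi w) =
          ((2 * pi) ^+ n)^-1 * Rn_integral (fun t => C t * cos_transform phi t)
      & 0 = ((2 * pi) ^+ n)^-1 *
              - Rn_integral (fun t => C t * sin_transform phi t)].

(* C(t) = int e^{i w.t} S(w) dw *)
Definition inverse_fourier n (C S : 'rV[R]_n -> R) : Prop :=
  Rn_integrable S /\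
  forall t : 'rV[R]_n, C t = cos_transform S t /\ 0 = sin_transform S t.

(* The last two descriptions fix S only almost everywhere: S is then the
   version that is continuous away from the origin. *)
Definition spectral_density n (C S : 'rV[R]_n -> R) : Prop :=
  [\/ Rn_integrable C /\ fourier_integral C S,
      [/\ ~ Rn_integrable C, continuous_off0 S & generalized_fourier C S]
    | continuous_off0 S /\ inverse_fourier C S].

Definition cauchy_covariance n (alpha beta : R) (t : 'rV[R]_n) : R :=
  (1 + enorm t `^ alpha) `^ (- beta).

(* f(w) = O(||w||^r) as ||w|| -> +oo *)
Definition bigO_at_infinity n (f : 'rV[R]_n -> R) (r : R) : Prop :=
  exists K M : R, forall w : 'rV[R]_n, M <= enorm w ->
    `|f w| <= K * enorm w `^ r.

End spectral_density.

Section gamma.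
Context {R : realType}.

Definition euler_gamma (x : R) : R :=
  Rintegral lebesgue_measure `]0, +oo[ (fun t => t `^ (x - 1) * expR (- t)).

(* Gamma on the whole real line, by Gamma(x) = Gamma(x + k) / (x ... (x+k-1))
   with x + k > 0; the value at a pole is 0 (division by 0). *)
Definition Gamma (x : R) : R :=
  if 0 < x then euler_gamma x
  else let k := (Num.truncn (- x)).+1 in
       euler_gamma (x + k%:R) / \prod_(i < k) (x + i%:R).

Definition gamma_pole (x : R) : Prop := exists m : nat, x = - m%:R.

(* Gamma(nu + j + 1/2) / Gamma(nu - j + 1/2) with nu = n/2 - beta. When only
   the denominator is a pole the value is 0, as it should be. *)
Definition gamma_ratio (n : nat) (beta : R) (j : nat) : R :=
  let a := j%:R - beta + n.+1%:R / 2 in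
  let b := n.+1%:R / 2 - j%:R - beta in
  let nu := n%:R / 2 - beta in
  if `[< gamma_pole a /\ gamma_pole b >]
  then \prod_(i < j.*2) (nu + 1 / 2 + (i%:R - j%:R))
  else Gamma a / Gamma b.

End gamma.

(* Main.v *)
Require Import Defs.
From mathcomp Require Import all_boot all_order all_algebra.
From mathcomp Require Import all_classical all_reals all_analysis.
From mathcomp Require Import measurable_realfun.
From mathcomp Require Import ring lra.
Set Implicit Arguments.
Unset Strict Implicit.
Unset Printing Implicit Defensive.
Import Order.TTheory GRing.Theory Num.Theory.
Import numFieldNormedType.Exports.
Local Open Scope classical_set_scope.
Local Open Scope ring_scope.

(**
The covariance is a mixture of Gaussians, C(t) = int_0^oo e^(-u |t|^2) g(u) du
with g integrable. Smoothing S by a Gaussian of width eps and letting eps tend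
to 0 shows that, in each of the three senses in which S may be given, it is the
same mixture of heat kernels:
S(w) = int_0^oo g(u) (4 pi u)^(-n/2) e^(-|w|^2 / (4 u)) du for w <> 0.

For alpha < 2 put gamma = alpha / 2 and let h be the imaginary part of
- (1 + z^gamma)^(-beta) on the upper side of the negative axis, z = -r + i 0.
Rotating rays from the positive to the negative axis gives the Stieltjes
representation (1 + x^gamma)^(-beta) = (1 / pi) int_0^oo h(r) / (r + x) dr,
so g is the Laplace transform of h / pi. The Taylor expansion of h in powers of
r^gamma, with a remainder bounded by its first omitted power for all r > 0, is
integrated term by term, first against e^(-r u) and then against the heat
kernel.

For alpha = 2, g is a Gamma density and S is a multiple of
I_nu(z) = int_0^oo u^(-nu-1) e^(-u - z^2 / (4 u)) du, z = |w|, nu = n/2 - beta.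
By u -> z^2 / (4 u) one may assume nu >= 0. Then
e^(-z T) / T = pi^(-1/2) int_0^oo u^(-1/2) e^(-u T^2 - z^2 / (4 u)) du with
T = 1 + s / z turns I_nu into a multiple of
e^(-z) int_0^oo s^(nu-1/2) (1 + s / (2 z))^(nu-1/2) e^(-s) ds, and the binomial
expansion of the second factor gives the series.
*)

(** * Integration *)

(** For [alpha * beta <= n] the covariance is not integrable, so the value of S at a point has to
    come out of a regularization. A Gaussian one fits every description of S: in frequency it is
    convolution with the heat kernel, a Schwartz function of mass 1, and on a mixture of Gaussians
    it only shifts u to u + eps. Mere integrability of g suffices because the heat kernel at a fixed
    w <> 0 is bounded in u.

    Cauchy's theorem is replaced by real calculus: an integral along the ray at angle th is
    differentiated in th, and the Cauchy-Riemann equations reduce the derivative to boundary terms.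
    The pole at z = x is cancelled by subtracting a multiple of z^(-1/2), whose Stieltjes transform
    is elementary, so no residue occurs. Since gamma < 1, 1 + z^gamma has no zero on the cut nor a
    little beyond it, which makes the angle pi an interior point.

    For alpha = 2, nu >= 0 makes s^(nu-1/2) integrable at 0; the coefficients of the series are even
    in nu, hence unaffected by the reflection. *)

Section fubini_sets.
Context d1 d2 (T1 : measurableType d1) (T2 : measurableType d2) (R : realType).
Variables (m1 : {sigma_finite_measure set T1 -> \bar R})
  (m2 : {sigma_finite_measure set T2 -> \bar R}).
Variables (D1 : set T1) (D2 : set T2).
Hypotheses (mD1 : measurable D1) (mD2 : measurable D2).
Variable f : T1 -> T2 -> R.
Hypothesis intD : (m1 \x m2)%E.-integrable (D1 `*` D2) (fun z => (f z.1 z.2)%:E).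

Let F : T1 * T2 -> \bar R := (fun z => (f z.1 z.2)%:E) \_ (D1 `*` D2).

Let mD12 : measurable (D1 `*` D2). Proof. exact: measurableX. Qed.

Let FE x y : F (x, y) = if (x \in D1) && (y \in D2) then (f x y)%:E else 0%E.
Proof. by rewrite /F /patch in_setX. Qed.

Let intF : (m1 \x m2)%E.-integrable setT F.
Proof. by have := intD; rewrite integrable_mkcond. Qed.

Let mF : measurable_fun [set: T1 * T2] F.
Proof. exact: measurable_int intF. Qed.

Let F1E x : (\int[m2]_y F (x, y) =
   ((fun x => \int[m2]_(y in D2) (f x y)%:E) \_ D1) x)%E.
Proof.
rewrite /patch; case: ifPn => xD1.
  rewrite [RHS]integral_mkcond; apply: eq_integral => y _.
  by rewrite FE /patch xD1/=.
by rewrite -[point]/(0%E : \bar R); apply: integral0_eq => y _; rewrite FE (negbTE xD1).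
Qed.

Let F2E y : (\int[m1]_x F (x, y) =
   ((fun y => \int[m1]_(x in D1) (f x y)%:E) \_ D2) y)%E.
Proof.
rewrite /patch; case: ifPn => yD2.
  rewrite [RHS]integral_mkcond; apply: eq_integral => x _.
  by rewrite FE /patch yD2 andbT.
by rewrite -[point]/(0%E : \bar R); apply: integral0_eq => x _; rewrite FE (negbTE yD2) andbF.
Qed.

Let i1 : m1.-integrable setT (fun x => \int[m2]_y F (x, y))%E.
Proof. exact: (integrable_fubini_F intF). Qed.

Let i1D : m1.-integrable D1 (fun x => \int[m2]_(y in D2) (f x y)%:E)%E.
Proof.
rewrite integrable_mkcond//.
by apply: eq_integrable i1 => // x _; rewrite F1E.
Qed.

Let aefin1 : {ae m1, forall x, D1 x ->
  (\int[m2]_(y in D2) (f x y)%:E = (\int[m2]_(y in D2) f x y)%:E)%E}.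
Proof.
have := integrable_ae mD1 i1D.
apply: filterS => x + D1x => /(_ D1x) xfin.
by rewrite /Rintegral fineK.
Qed.

(** The extended-valued inner integral can be infinite on a null set, where [fine] gives 0;
    integrability is therefore inherited through an almost everywhere comparison. *)
Lemma integrable_Rintegral1 :
  m1.-integrable D1 (EFin \o (fun x => \int[m2]_(y in D2) f x y)).
Proof.
have mR : measurable_fun D1 (EFin \o (fun x => \int[m2]_(y in D2) f x y)).
  apply/measurable_EFinP.
  have -> : (fun x => \int[m2]_(y in D2) f x y) = fine \o
    (fun x => \int[m2]_(y in D2) (f x y)%:E)%E by [].
  by apply: measurableT_comp => //; exact: measurable_int i1D.
apply/integrableP; split => //.
have /integrableP[mi] := i1D; apply: le_lt_trans.
apply: ae_ge0_le_integral => //.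
- exact: measurableT_comp.
- exact: measurableT_comp.
- by move: aefin1; apply: filterS => x + D1x => ->.
Qed.

(** Fubini holds for the zero extension [F] and extended-valued inner integrals; on either side
    these agree almost everywhere with the real-valued ones. *)
Lemma Rintegral_Fubini :
  \int[m1]_(x in D1) \int[m2]_(y in D2) f x y =
  \int[m2]_(y in D2) \int[m1]_(x in D1) f x y.
Proof.
have i2D : m2.-integrable D2 (fun y => \int[m1]_(x in D1) (f x y)%:E)%E.
  rewrite integrable_mkcond//.
  have i2 : m2.-integrable setT (fun y => \int[m1]_x F (x, y))%E.
    pose G (z : T2 * T1) := F (z.2, z.1).
    have mG : measurable_fun [set: T2 * T1] G.
      by apply: measurableT_comp => //; exact: measurable_swap.
    have iG : (m2 \x m1)%E.-integrable setT G.
      by apply/(integrable21ltyP _ _ mG)/(integrable12ltyP _ _ mF).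
    exact: (integrable_fubini_F iG).
  by apply: eq_integrable i2 => // y _; rewrite F2E.
have aefin2 : {ae m2, forall y, D2 y ->
  (\int[m1]_(x in D1) (f x y)%:E = (\int[m1]_(x in D1) f x y)%:E)%E}.
  have := integrable_ae mD2 i2D.
  by apply: filterS => y + D2y => /(_ D2y) yfin; rewrite /Rintegral fineK.
have := Fubini intF.
under eq_integral do rewrite F1E.
under [in RHS]eq_integral do rewrite F2E.
rewrite -!integral_mkcond => FF; rewrite /Rintegral.
have -> : (\int[m1]_(x in D1) (\int[m2]_(y in D2) f x y)%:E =
           \int[m1]_(x in D1) \int[m2]_(y in D2) (f x y)%:E)%E.
  apply: ae_eq_integral => //.
  - by have /measurable_int := integrable_Rintegral1.
  - exact: measurable_int i1D.
  - by move: aefin1; apply: filterS => x + D1x => ->.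
have -> : (\int[m2]_(x in D2) (\int[m1]_(y in D1) f y x)%:E =
           \int[m2]_(x in D2) \int[m1]_(y in D1) (f y x)%:E)%E.
  apply: ae_eq_integral => //.
  - have -> : (fun x => (\int[m1]_(y in D1) f y x)%:E) = (EFin \o fine) \o
      (fun x => \int[m1]_(y in D1) (f y x)%:E)%E by [].
    apply/measurable_EFinP; apply: measurableT_comp => //.
    exact: measurable_int i2D.
  - exact: measurable_int i2D.
  - by move: aefin2; apply: filterS => x + D1x => ->.
by rewrite FF.
Qed.

End fubini_sets.

Section fubini_integrable.
Context d1 d2 (T1 : measurableType d1) (T2 : measurableType d2) (R : realType).
Variables (m1 : {sigma_finite_measure set T1 -> \bar R})
  (m2 : {sigma_finite_measure set T2 -> \bar R}).
Variables (D1 : set T1) (D2 : set T2).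
Hypotheses (mD1 : measurable D1) (mD2 : measurable D2).

Let mD12 : measurable (D1 `*` D2). Proof. exact: measurableX. Qed.

Lemma measurable_fun_fst (g : T1 -> R) : measurable_fun D1 g ->
  measurable_fun (D1 `*` D2) (fun z => g z.1).
Proof.
move=> mg; apply: (measurable_comp mD1 _ mg) => //.
- by move=> _ [z [z1 _] <-].
- exact: measurable_funS (@measurable_fst _ _ T1 T2).
Qed.

Lemma measurable_fun_snd (g : T2 -> R) : measurable_fun D2 g ->
  measurable_fun (D1 `*` D2) (fun z => g z.2).
Proof.
move=> mg; apply: (measurable_comp mD2 _ mg) => //.
- by move=> _ [z [_ z2] <-].
- exact: measurable_funS (@measurable_snd _ _ T1 T2).
Qed.

(** Tonelli's criterion, applied to the zero extension of [f]. *)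
Lemma integrable_prod_iterated (f : T1 -> T2 -> R) :
  measurable_fun (D1 `*` D2) (fun z => f z.1 z.2) ->
  (\int[m1]_(x in D1) \int[m2]_(y in D2) `|f x y|%:E < +oo)%E ->
  (m1 \x m2)%E.-integrable (D1 `*` D2) (fun z => (f z.1 z.2)%:E).
Proof.
move=> mf foo.
pose F : T1 * T2 -> \bar R := (fun z => (f z.1 z.2)%:E) \_ (D1 `*` D2).
have mF : measurable_fun [set: T1 * T2] F.
  by apply/(measurable_restrictT _ _).1 => //; exact/measurable_EFinP.
have FE x y : F (x, y) = if (x \in D1) && (y \in D2) then (f x y)%:E else 0%E.
  by rewrite /F /patch in_setX.
rewrite integrable_mkcond//; apply/(integrable12ltyP _ _ mF).
apply: le_lt_trans foo.
rewrite [leRHS]integral_mkcond le_eqVlt; apply/orP; left; apply/eqP.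
apply: eq_integral => x _.
rewrite /patch; case: ifPn => xD1.
  rewrite [RHS]integral_mkcond; apply: eq_integral => y _.
  by rewrite FE /patch xD1/=; case: ifPn => //= _; rewrite normr0.
rewrite -[point]/(0%E : \bar R); apply: integral0_eq => y _.
by rewrite FE (negbTE xD1)/= normr0.
Qed.

Lemma integrable_prod_mul (f1 : T1 -> R) (f2 : T2 -> R) :
  m1.-integrable D1 (EFin \o f1) -> m2.-integrable D2 (EFin \o f2) ->
  (m1 \x m2)%E.-integrable (D1 `*` D2) (fun z => (f1 z.1 * f2 z.2)%:E).
Proof.
move=> i1 i2.
have mf1 : measurable_fun D1 f1 by apply/measurable_EFinP; exact: (measurable_int m1).
have mf2 : measurable_fun D2 f2 by apply/measurable_EFinP; exact: (measurable_int m2).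
have n1 := integrable_norm i1; have n2 := integrable_norm i2.
apply: (@integrable_prod_iterated (fun x y => f1 x * f2 y)).
  by apply: measurable_funM; [exact: measurable_fun_fst|exact: measurable_fun_snd].
have -> : (\int[m1]_(x in D1) \int[m2]_(y in D2) `|f1 x * f2 y|%:E =
           \int[m1]_(x in D1) (`|f1 x|%:E * (\int[m2]_(y in D2) `|f2 y|)%:E))%E.
  apply: eq_integral => x _.
  under eq_integral => y _ do rewrite normrM EFinM.
  rewrite (integralZl mD2 n2); congr (_ * _)%E.
  rewrite /Rintegral fineK//; exact: integrable_fin_num n2.
rewrite (integralZr mD1 n1).
have := integrable_fin_num mD1 n1 => /fineK <-.
by rewrite -EFinM ltry.
Qed.

Lemma integrable_prod_dom (f : T1 -> T2 -> R) (f1 : T1 -> R) (f2 : T2 -> R) :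
  measurable_fun (D1 `*` D2) (fun z => f z.1 z.2) ->
  m1.-integrable D1 (EFin \o f1) -> m2.-integrable D2 (EFin \o f2) ->
  (forall x y, D1 x -> D2 y -> `|f x y| <= f1 x * f2 y) ->
  (m1 \x m2)%E.-integrable (D1 `*` D2) (fun z => (f z.1 z.2)%:E).
Proof.
move=> mf i1 i2 ff; have := integrable_prod_mul i1 i2.
apply: le_integrable => //; first exact/measurable_EFinP.
move=> [x y] [/= D1x D2y]; rewrite lee_fin (le_trans (ff x y D1x D2y))//.
exact: ler_norm.
Qed.

End fubini_integrable.

(** * Derivatives of functions of one variable *)

Section derive_lambda.
Context {R : realType}.
Implicit Types (f g : R -> R) (x a b : R).

(** Decouples the derivative that the rules compute from the one that is wanted, leaving an
    algebraic identity. *)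
Lemma der_eq f x a b : is_derive x 1 f a -> a = b -> is_derive x 1 f b.
Proof. by move=> + <-. Qed.

Lemma der_cont f x a : is_derive x 1 f a -> {for x, continuous f}.
Proof.
by move=> [df _]; exact/differentiable_continuous/derivable1_diffP.
Qed.

Lemma der_cst c x : is_derive x 1 (fun=> c : R) 0.
Proof. exact: is_derive_cst. Qed.

Lemma der_id x : is_derive x 1 (fun y : R => y) 1.
Proof. exact: is_derive_id. Qed.

Lemma der_add f g x a b : is_derive x 1 f a -> is_derive x 1 g b ->
  is_derive x 1 (fun y => f y + g y) (a + b).
Proof. exact: is_deriveD. Qed.

Lemma der_opp f x a : is_derive x 1 f a -> is_derive x 1 (fun y => - f y) (- a).
Proof. exact: is_deriveN. Qed.

Lemma der_mul f g x a b : is_derive x 1 f a -> is_derive x 1 g b ->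
  is_derive x 1 (fun y => f y * g y) (f x * b + g x * a).
Proof. exact: is_deriveM. Qed.

Lemma der_inv f x a : f x != 0 -> is_derive x 1 f a ->
  is_derive x 1 (fun y => (f y)^-1) (- a / f x ^+ 2).
Proof.
move=> fx df; have := @is_deriveV _ f x a 1 fx df; move/der_eq; apply.
by rewrite /GRing.scale/= mulrC mulrN mulNr.
Qed.

Lemma der_exprn f n x a : is_derive x 1 f a ->
  is_derive x 1 (fun y => f y ^+ n) (n%:R * f x ^+ n.-1 * a).
Proof.
move=> df; case: n => [|n].
  by rewrite !mul0r; under eq_fun do rewrite expr0; exact: der_cst.
have := @is_deriveX _ _ f n.+1 x 1 a df; rewrite exprfctE => /der_eq; apply.
by rewrite /GRing.scale/= -mulr_natl.
Qed.

Lemma der_comp f g x a b : is_derive (g x) 1 f a -> is_derive x 1 g b ->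
  is_derive x 1 (fun y => f (g y)) (a * b).
Proof.
by move=> df dg; have := @is_derive1_comp _ f g x a b df dg; move/der_eq; apply.
Qed.

Lemma der_expR f x a : is_derive x 1 f a ->
  is_derive x 1 (fun y => expR (f y)) (expR (f x) * a).
Proof. by apply: der_comp; exact: is_derive_expR. Qed.

Lemma der_sin f x a : is_derive x 1 f a ->
  is_derive x 1 (fun y => sin (f y)) (cos (f x) * a).
Proof. by apply: der_comp; exact: is_derive_sin. Qed.

Lemma der_cos f x a : is_derive x 1 f a ->
  is_derive x 1 (fun y => cos (f y)) (- sin (f x) * a).
Proof. by apply: der_comp; exact: is_derive_cos. Qed.

Lemma der_atan f x a : is_derive x 1 f a ->
  is_derive x 1 (fun y => atan (f y)) ((1 + f x ^+ 2)^-1 * a).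
Proof. by apply: der_comp; exact: is_derive1_atan. Qed.

Lemma der_tan f x a : cos (f x) != 0 -> is_derive x 1 f a ->
  is_derive x 1 (fun y => tan (f y)) ((cos (f x))^-2 * a).
Proof. by move=> c0; apply: der_comp; exact: is_derive_tan. Qed.

Lemma der_powR p f x a : 0 < f x -> is_derive x 1 f a ->
  is_derive x 1 (fun y => f y `^ p) (p * f x `^ (p - 1) * a).
Proof.
move=> fx; apply: (@der_comp (fun z => z `^ p) f).
exact: is_derive1_powR.
Qed.

Lemma der_sqrt f x a : 0 < f x -> is_derive x 1 f a ->
  is_derive x 1 (fun y => Num.sqrt (f y)) ((2 * Num.sqrt (f x))^-1 * a).
Proof. by move=> fx; apply: der_comp; exact: is_derive1_sqrt. Qed.

End derive_lambda.

(* The library's [is_derive] rules are type class instances stated for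
   [f + g], [f * g], ...; this matches lambda terms syntactically. *)
Ltac der1 := cbv beta; lazymatch goal with
  | |- is_derive _ _ (fun y => y) _ => exact: der_id
  | |- is_derive _ _ (fun=> ?c) _ => exact: der_cst
  | |- is_derive _ _ (fun y => (@?f y + @?g y)%R) _ =>
      notypeclasses refine (@der_add _ f g _ _ _ _ _)
  | |- is_derive _ _ (fun y => (- @?f y)%R) _ =>
      notypeclasses refine (@der_opp _ f _ _ _)
  | |- is_derive _ _ (fun y => (@?f y * @?g y)%R) _ =>
      notypeclasses refine (@der_mul _ f g _ _ _ _ _)
  | |- is_derive _ _ (fun y => (@?f y)^-1%R) _ =>
      notypeclasses refine (@der_inv _ f _ _ _ _)
  | |- is_derive _ _ (fun y => (@?f y ^+ ?n)%R) _ =>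
      notypeclasses refine (@der_exprn _ f n _ _ _)
  | |- is_derive _ _ (fun y => expR (@?f y)) _ =>
      notypeclasses refine (@der_expR _ f _ _ _)
  | |- is_derive _ _ (fun y => sin (@?f y)) _ =>
      notypeclasses refine (@der_sin _ f _ _ _)
  | |- is_derive _ _ (fun y => cos (@?f y)) _ =>
      notypeclasses refine (@der_cos _ f _ _ _)
  | |- is_derive _ _ (fun y => atan (@?f y)) _ =>
      notypeclasses refine (@der_atan _ f _ _ _)
  | |- is_derive _ _ (fun y => tan (@?f y)) _ =>
      notypeclasses refine (@der_tan _ f _ _ _ _)
  | |- is_derive _ _ (fun y => Num.sqrt (@?f y)) _ =>
      notypeclasses refine (@der_sqrt _ f _ _ _ _)
  | |- is_derive _ _ (fun y => @?f y `^ ?p) _ =>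
      notypeclasses refine (@der_powR _ p f _ _ _ _)
  end.
Ltac der := repeat der1.
Ltac dereq := notypeclasses refine (@der_eq _ _ _ _ _ _ _); [der|cbv beta].
(** Continuity follows from the mere existence of a derivative, whose value is left to
    unification. *)
Ltac dercont := notypeclasses refine (@der_cont _ _ _ _ _); der.

(** * Exhaustion of the half-line by compact intervals *)

Section posints.
Context {R : realType}.
Notation mu := (@lebesgue_measure R).
Notation pos := (`]0%R, +oo[%classic : set R).
Implicit Types (f g F : R -> R).

Lemma pos_lt0 (x : R) : pos x <-> 0 < x.
Proof. by rewrite /= in_itv/= andbT. Qed.

Lemma measurable_pos_cont f : (forall x, 0 < x -> {for x, continuous f}) ->
  measurable_fun pos f.
Proof.
move=> cf; apply: open_continuous_measurable_fun; first exact: interval_open.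
by move=> x; rewrite inE => /pos_lt0/cf.
Qed.

(** The offset 2 makes the interval nondegenerate already for [k = 0]. *)
Definition kitv k : set R := `[k.+2%:R^-1, k.+2%:R].

Lemma kitv_lt k : k.+2%:R^-1 < k.+2%:R :> R.
Proof.
by rewrite (@lt_trans _ _ 1)// ?invf_lt1 ?ltr1n ?ltr0n.
Qed.

Lemma kitvP k x : kitv k x -> 0 < x.
Proof.
by rewrite /kitv/= in_itv/= => /andP[+ _]; apply: lt_le_trans; rewrite invr_gt0.
Qed.

Lemma kitv_pos k : kitv k `<=` pos.
Proof. by move=> x /kitvP ?; apply/pos_lt0. Qed.

Lemma nondecreasing_kitv : nondecreasing_seq kitv.
Proof.
move=> m n mn; rewrite subsetEset; apply: subset_itv; rewrite bnd_simp.
  by rewrite lef_pV2 ?posrE ?ltr0n// ler_nat.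
by rewrite ler_nat.
Qed.

Lemma kitv_near (x : R) : 0 < x -> \forall k \near \oo, kitv k x.
Proof.
move=> x0; near=> k; rewrite /kitv/= in_itv/=; apply/andP; split.
  rewrite invf_ple ?posrE//; apply: le_trans (_ : (k%:R : R) <= _).
    by near: k; exact: nbhs_infty_ger.
  by rewrite ler_nat -addn2 leq_addr.
apply: le_trans (_ : (k%:R : R) <= _); last by rewrite ler_nat -addn2 leq_addr.
by near: k; exact: nbhs_infty_ger.
Unshelve. all: end_near. Qed.

Lemma bigcup_kitv : \bigcup_k kitv k = pos.
Proof.
apply/seteqP; split=> [x [k _] /kitv_pos//|x /pos_lt0/kitv_near[k _ /(_ k)kx]].
by exists k => //; apply: kx => /=.
Qed.

Lemma measurable_kitv k : measurable (kitv k).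
Proof. exact: measurable_itv. Qed.

Lemma ge0_cvg_kitv f : measurable_fun pos f -> (forall x, 0 < x -> 0 <= f x) ->
  (\int[mu]_(x in kitv k) (f x)%:E @[k --> \oo] -->
   \int[mu]_(x in pos) (f x)%:E)%E.
Proof.
move=> mf f0; rewrite -bigcup_kitv.
apply: ge0_nondecreasing_set_cvg_integral.
- exact: nondecreasing_kitv.
- exact: measurable_kitv.
- move=> i; apply/measurable_EFinP; apply: measurable_funS mf => //.
  exact: kitv_pos.
- by move=> i x /kitvP/f0; rewrite lee_fin.
Qed.

End posints.

(** * Dominated convergence and comparison for real-valued integrals *)

Section dominated.
Context d (T : measurableType d) (R : realType).
Variable m : {measure set T -> \bar R}.

Lemma Rdominated_cvg (D : set T) (f_ : nat -> T -> R) (f g : T -> R) :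
  measurable D -> (forall n, measurable_fun D (f_ n)) ->
  (forall x, D x -> f_ n x @[n --> \oo] --> f x) ->
  m.-integrable D (EFin \o g) ->
  (forall n x, D x -> `|f_ n x| <= g x) ->
  m.-integrable D (EFin \o f) /\
  \int[m]_(x in D) f_ n x @[n --> \oo] --> \int[m]_(x in D) f x.
Proof.
move=> mD mf_ f_f ig f_g.
have f_fe x : D x -> (EFin \o f_ ^~ x) n @[n --> \oo] --> (EFin \o f) x.
  by move=> Dx; apply: cvg_EFin; [exact: nearW|exact: f_f].
have [||||i _ c] := @dominated_convergence _ _ _ m D mD
  (fun n => EFin \o f_ n) (EFin \o f) (EFin \o g) _ _ _ ig _.
- by move=> n; exact/measurable_EFinP.
- apply: emeasurable_fun_cvg => [n|x Dx]; last exact: f_fe.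
  exact/measurable_EFinP.
- exact/aeW.
- by apply/aeW => x n Dx; rewrite lee_fin; exact: f_g.
split=> //.
apply: fine_cvg => /=; rewrite fineK//.
by rewrite -[X in X \is a fin_num]/(\int[m]_(x in D) (EFin \o f) x)%E integrable_fin_num.
Qed.

Lemma cvg_Rintegral_sets (D : set T) (E : nat -> set T) (f : T -> R) :
  measurable D -> (forall n, measurable (E n)) -> (forall n, E n `<=` D) ->
  (forall x, D x -> \forall n \near \oo, E n x) ->
  m.-integrable D (EFin \o f) ->
  \int[m]_(x in E n) f x @[n --> \oo] --> \int[m]_(x in D) f x.
Proof.
move=> mD mE ED nE fi.
have mf : measurable_fun D f by apply/measurable_EFinP/(measurable_int m).
have -> : (fun n => \int[m]_(x in E n) f x) =
          (fun n => \int[m]_(x in D) (f \_ (E n)) x).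
  by apply/funext => n; rewrite -Rintegral_mkcondr setIidr.
have [||||//] := @Rdominated_cvg D (fun n => f \_ (E n)) f (fun x => `|f x|) mD.
- move=> n; apply/(measurable_restrict _ _ _).1 => //.
  by apply: measurable_funS mf => //; exact: subIsetr.
- move=> x Dx; apply: cvg_near_cst; near=> n.
  rewrite patchE mem_set//; near: n; exact: nE.
- exact: integrable_norm.
- by move=> n x Dx; rewrite patchE; case: ifPn => // _; rewrite normr0.
Unshelve. all: end_near. Qed.

Lemma integrable_scale (D : set T) k (f : T -> R) : measurable D ->
  m.-integrable D (EFin \o f) -> m.-integrable D (EFin \o (fun x => k * f x)).
Proof. by move=> mD fi; exact: (integrableZl mD k fi). Qed.

Lemma integrable_add (D : set T) (f g : T -> R) : measurable D ->
  m.-integrable D (EFin \o f) -> m.-integrable D (EFin \o g) ->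
  m.-integrable D (EFin \o (fun x => f x + g x)).
Proof. by move=> mD fi gi; exact: (integrableD mD fi gi). Qed.

Lemma integrable_sub (D : set T) (f g : T -> R) : measurable D ->
  m.-integrable D (EFin \o f) -> m.-integrable D (EFin \o g) ->
  m.-integrable D (EFin \o (fun x => f x - g x)).
Proof. by move=> mD fi gi; exact: (integrableB mD fi gi). Qed.

Lemma integrable_eqf (D : set T) (f g : T -> R) : measurable D ->
  (forall x, D x -> f x = g x) ->
  m.-integrable D (EFin \o f) -> m.-integrable D (EFin \o g).
Proof.
move=> mD fg; apply: eq_integrable => // x; rewrite inE => Dx /=.
by rewrite fg.
Qed.

Lemma integrable_le (D : set T) (f g : T -> R) : measurable D ->
  measurable_fun D f -> (forall x, D x -> `|f x| <= g x) ->
  m.-integrable D (EFin \o g) -> m.-integrable D (EFin \o f).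
Proof.
move=> mD mf fg; apply: le_integrable => //; first exact/measurable_EFinP.
move=> x Dx /=; rewrite lee_fin (le_trans (fg x Dx))//.
exact: ler_norm.
Qed.

Lemma integrable_meas (D : set T) (f : T -> R) :
  m.-integrable D (EFin \o f) -> measurable_fun D f.
Proof. by move=> fi; apply/measurable_EFinP; exact: (measurable_int m). Qed.

Lemma le_normr_Rintegral_dom (D : set T) (f g : T -> R) : measurable D ->
  measurable_fun D f -> (forall x, D x -> `|f x| <= g x) ->
  m.-integrable D (EFin \o g) ->
  `|\int[m]_(x in D) f x| <= \int[m]_(x in D) g x.
Proof.
move=> mD mf fg gi; have fi := integrable_le mD mf fg gi.
apply: (le_trans (le_normr_Rintegral mD fi)).
by apply: le_Rintegral => //; exact: integrable_norm.
Qed.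

Lemma Rintegral_sum (D : set T) (f : nat -> T -> R) (s : seq nat) :
  measurable D -> (forall i, m.-integrable D (EFin \o f i)) ->
  m.-integrable D (EFin \o (fun x => \sum_(i <- s) f i x)) /\
  \int[m]_(x in D) (\sum_(i <- s) f i x) = \sum_(i <- s) \int[m]_(x in D) f i x.
Proof.
move=> mD fi; elim: s => [|i s [IH1 IH2]].
  split.
    apply: integrable_eqf (integrable0 _ _) => // x _.
    by rewrite big_nil.
  rewrite big_nil -(Rintegral_set0 m (fun=> 0)).
  rewrite (@eq_Rintegral _ _ _ _ _ (cst 0)) ?Rintegral_cst ?mul0r ?Rintegral_set0//.
  by move=> x _; rewrite big_nil.
split.
  apply: (integrable_eqf mD _ (integrable_add mD (fi i) IH1)) => x _.
  by rewrite big_cons.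
rewrite big_cons -IH2 -RintegralD//; apply: eq_Rintegral => x _.
by rewrite big_cons.
Qed.

End dominated.

Lemma powR_mulD {R : realType} (x a b : R) : 0 < x ->
  x `^ a * x `^ b = x `^ (a + b).
Proof. by move=> x0; rewrite powRD// (gt_eqF x0) implybT. Qed.

(** * Improper integrals on the half-line *)

Section ftc_pos.
Context {R : realType}.
Notation mu := (@lebesgue_measure R).
Notation pos := (`]0%R, +oo[%classic : set R).
Implicit Types (f g F G : R -> R) (x t : R).

Lemma der_LRcont F f (a b : R) : (forall x, a <= x <= b -> is_derive x 1 F (f x)) ->
  a < b -> derivable_oo_LRcontinuous F a b.
Proof.
move=> dF ab; split.
- move=> x; rewrite in_itv/= => /andP[ax xb]; apply: ex_derive.
  by apply: dF; rewrite !ltW.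
- apply: cvg_at_right_filter; apply: der_cont (dF _ _).
  by rewrite lexx ltW.
- apply: cvg_at_left_filter; apply: der_cont (dF _ _).
  by rewrite lexx ltW.
Qed.

Lemma cont_within f (A : set R) : (forall x, A x -> {for x, continuous f}) ->
  {within A, continuous f}.
Proof.
by move=> cf; apply: continuous_in_subspaceT => x; rewrite inE => /cf.
Qed.

Lemma FTC_cc F f (a b : R) : a < b ->
  (forall x, a <= x <= b -> is_derive x 1 F (f x)) ->
  (forall x, a <= x <= b -> {for x, continuous f}) ->
  (\int[mu]_(x in `[a, b]) (f x)%:E = (F b - F a)%:E)%E.
Proof.
move=> ab dF cf; rewrite (@continuous_FTC2 _ f F)//.
- by apply: cont_within => x; rewrite /= in_itv/=; exact: cf.
- exact: der_LRcont dF ab.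
- move=> x; rewrite in_itv/= => /andP[ax xb].
  rewrite derive1E; have [|_ //] := dF x.
  by rewrite !ltW.
Qed.

Lemma FTC_kitv F f k : (forall x, 0 < x -> is_derive x 1 F (f x)) ->
  (forall x, 0 < x -> {for x, continuous f}) ->
  (\int[mu]_(x in kitv k) (f x)%:E = (F k.+2%:R - F k.+2%:R^-1)%:E)%E.
Proof.
move=> dF cf; rewrite /kitv; apply: FTC_cc; first exact: kitv_lt.
- by move=> x kx; apply: dF; apply: (@kitvP _ k); rewrite /kitv/= in_itv/= kx.
- by move=> x kx; apply: cf; apply: (@kitvP _ k); rewrite /kitv/= in_itv/= kx.
Qed.

Lemma FTC_pos F f (l0 l1 : R) : (forall x, 0 < x -> is_derive x 1 F (f x)) ->
  (forall x, 0 < x -> {for x, continuous f}) ->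
  mu.-integrable pos (EFin \o f) ->
  F k.+2%:R^-1 @[k --> \oo] --> l0 -> F k.+2%:R @[k --> \oo] --> l1 ->
  \int[mu]_(x in pos) f x = l1 - l0.
Proof.
move=> dF cf fi Fl0 Fl1.
have := @cvg_Rintegral_sets _ _ _ mu pos kitv f (measurable_itv _)
  measurable_kitv (@kitv_pos R) _ fi.
move=> /(_ _)/cvg_unique; apply => //.
  by move=> x /pos_lt0/kitv_near.
have -> : (fun n => \int[mu]_(x in kitv n) f x) =
          (fun k => F k.+2%:R - F k.+2%:R^-1).
  by apply/funext => k; rewrite /Rintegral (FTC_kitv _ dF cf).
exact: cvgB.
Qed.

(** The integrals over the compact intervals are differences of two values of [F], hence at most 2
    M; monotone convergence does the rest. *)
Lemma integrable_pos_bnd F f (M : R) :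
  (forall x, 0 < x -> is_derive x 1 F (f x)) ->
  (forall x, 0 < x -> {for x, continuous f}) ->
  (forall x, 0 < x -> 0 <= f x) -> (forall x, 0 < x -> `|F x| <= M) ->
  mu.-integrable pos (EFin \o f).
Proof.
move=> dF cf f0 FM.
have mf := measurable_pos_cont cf.
apply/integrableP; split; first exact/measurable_EFinP.
apply: (@le_lt_trans _ _ (M + M)%:E); last exact: ltry.
rewrite (_ : (\int[mu]_(x in pos) _)%E = (\int[mu]_(x in pos) (f x)%:E)%E); last first.
  by apply: eq_integral => x; rewrite inE => /pos_lt0 x0/=; rewrite ger0_norm// f0.
have c := ge0_cvg_kitv mf f0.
rewrite -(cvg_lim _ c)//; apply: lime_le; first by apply/cvg_ex; eexists; exact: c.
near=> k; rewrite (FTC_kitv _ dF cf) lee_fin (le_trans (ler_norm _))//.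
by rewrite (le_trans (ler_normB _ _))// lerD// FM// ?invr_gt0.
Unshelve. all: end_near. Qed.

(** A model weight for comparison: of order t^(p-1) at 0 and t^(-p-1) at infinity, with the bounded
    antiderivative - 1 / (p (1 + t^p)). *)
Lemma integrable_pos_pw (p : R) : 0 < p ->
  mu.-integrable pos (EFin \o (fun t : R => t `^ (p - 1) / (1 + t `^ p) ^+ 2)).
Proof.
move=> p0; have p1 (x : R) : 0 < 1 + x `^ p by rewrite ltr_wpDr// powR_ge0.
have c (x : R) : 0 < x -> {for x, continuous (fun t : R => t `^ (p - 1) / (1 + t `^ p) ^+ 2)}.
  by move=> x0; dercont => //; rewrite expf_neq0// gt_eqF.
apply: (@integrable_pos_bnd (fun t : R => - p^-1 * (1 + t `^ p)^-1)
  (fun t : R => t `^ (p - 1) / (1 + t `^ p) ^+ 2) p^-1).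
- move=> x x0; dereq; rewrite ?gt_eqF//.
  by rewrite /=; field; rewrite !gt_eqF.
- exact: c.
- by move=> x x0; rewrite divr_ge0 ?powR_ge0// exprn_ge0// ltW.
- move=> x x0; rewrite normrM normrN !gtr0_norm ?invr_gt0//.
  apply: ler_piMr; first by rewrite invr_ge0 ltW.
  by rewrite invf_le1// lerDl powR_ge0.
Qed.

Lemma integrable_pos_dom (p q K : R) f : 0 < p -> 0 < q ->
  measurable_fun pos f ->
  (forall t, 0 < t -> t <= 1 -> `|f t| <= K * t `^ (p - 1)) ->
  (forall t, 1 <= t -> `|f t| <= K * t `^ (- q - 1)) ->
  mu.-integrable pos (EFin \o f).
Proof.
move=> p0 q0 mf f1 f2; pose r := Num.min p q.
have r0 : 0 < r by rewrite lt_min p0.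
have K0 : 0 <= K by have := f2 1 (lexx _); rewrite powR1 mulr1; apply: le_trans.
have wi := integrable_pos_pw r0.
(* The factor 4 pays for the denominator: (1 + t^r)^2 is at most 4 for t <= 1 and at most 4 t^(2r)
   for t >= 1. *)
have : mu.-integrable pos (EFin \o (fun t : R => (4 * K) * (t `^ (r - 1) / (1 + t `^ r) ^+ 2))).
  exact: (integrableZl _ (4 * K) wi).
apply: le_integrable => //; first exact/measurable_EFinP.
move=> t /pos_lt0 t0 /=; rewrite lee_fin.
have tr0 : 0 < t `^ r by exact: powR_gt0.
have s0 : 0 < (1 + t `^ r) ^+ 2 by rewrite exprn_gt0// addr_gt0.
rewrite [leRHS]ger0_norm; last first.
  by rewrite !mulr_ge0// ?powR_ge0// invr_ge0 ltW.
have [t1|t1] := leP t 1.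
  apply: (le_trans (f1 t t0 t1)).
  have h1 : t `^ (p - 1) <= t `^ (r - 1).
    by apply: ger_powR; rewrite ?t0// lerD2r ge_min lexx.
  have h2 : t `^ r <= 1.
    by rewrite -(powRr0 t); apply: ger_powR; rewrite ?t0// ltW.
  apply: (le_trans (ler_wpM2l K0 h1)).
  rewrite [leRHS]mulrA ler_pdivlMr//.
  rewrite (_ : 4 * K * _ = K * t `^ (r - 1) * 4); last by ring.
  rewrite ler_wpM2l ?mulr_ge0 ?powR_ge0//.
  by rewrite (_ : 4 = (1 + 1) ^+ 2); [rewrite lerXn2r ?nnegrE ?addr_ge0 ?powR_ge0 ?lerD2l|ring].
apply: (le_trans (f2 t (ltW t1))).
have h1 : t `^ (- q - 1) <= t `^ (- r - 1).
  by apply: ler_powR; rewrite ?(ltW t1)// lerD2r lerN2 ge_min lexx orbT.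
have h2 : 1 <= t `^ r.
  by rewrite -(powRr0 t); apply: ler_powR; rewrite ?(ltW t1)// ltW.
apply: (le_trans (ler_wpM2l K0 h1)).
rewrite [leRHS]mulrA ler_pdivlMr//.
have -> : t `^ (r - 1) = t `^ (- r - 1) * (t `^ r) ^+ 2.
  by rewrite expr2 !powR_mulD ?(lt_trans ltr01)//; congr (_ `^ _); ring.
rewrite (_ : 4 * K * _ = K * t `^ (- r - 1) * (2 * t `^ r) ^+ 2); last by ring.
rewrite ler_wpM2l ?mulr_ge0 ?powR_ge0//.
by rewrite lerXn2r ?nnegrE ?addr_ge0 ?mulr_ge0 ?powR_ge0//; lra.
Qed.

Lemma powR_expRN_bnd (s : R) : 0 <= s ->
  exists2 K, 0 < K & forall t, 0 < t -> t `^ s * expR (- t) <= K.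
Proof.
move=> s0; pose n := (Num.truncn s).+1.
have sn : s <= n%:R by rewrite ltW// truncnS_gt.
(* The 1 serves t <= 1, where both factors are at most 1; n! serves t > 1, by t^n / n! <= e^t. *)
exists (1 + n`!%:R); first by rewrite ltr_pwDl.
move=> t t0; have [t1|t1] := leP t 1.
  rewrite (@le_trans _ _ 1)//; last by rewrite lerDl.
  rewrite mulr_ile1 ?powR_ge0 ?expR_ge0//; last by rewrite expR_le1 oppr_le0 ltW.
  by rewrite -(powRr0 t); apply: ger_powR; rewrite ?t0// ltW.
rewrite (@le_trans _ _ n`!%:R)//; last by rewrite lerDr.
rewrite expRN ler_pdivrMr ?expR_gt0//.
apply: (@le_trans _ _ (t ^+ n)).
  by rewrite -(powR_mulrn _ (ltW t0)); apply: ler_powR => //; exact: ltW.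
have := @expR_ge1Dxn _ t (Num.truncn s) (ltW t0).
rewrite -/n => h.
rewrite -ler_pdivrMl ?ltr0n ?fact_gt0// mulrC; apply: le_trans h.
by rewrite lerDr.
Qed.

Lemma powR_expRN_bndM (s c : R) : 0 <= s -> 0 < c ->
  exists2 K, 0 < K & forall t, 0 < t -> t `^ s * expR (- (c * t)) <= K.
Proof.
move=> s0 c0; have [K K0 HK] := powR_expRN_bnd s0.
exists (K * c `^ (- s)); first by rewrite mulr_gt0// powR_gt0.
move=> t t0; have := HK (c * t) (mulr_gt0 c0 t0).
rewrite (powRM _ (ltW c0) (ltW t0)) => h.
by rewrite powRN ler_pdivlMr ?powR_gt0// mulrC mulrA.
Qed.

End ftc_pos.

(** * Change of variables on the half-line *)

Section subst_pos.
Context {R : realType}.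
Notation mu := (@lebesgue_measure R).
Notation pos := (`]0%R, +oo[%classic : set R).
Implicit Types (f g F G : R -> R) (x t : R).

Let cvg_cst_eq (f : R -> R) x : {for x, continuous f} ->
  cvg (f y @[y --> x^'+]).
Proof. by move=> cf; apply/cvg_ex; exists (f x); exact: cvg_at_right_filter. Qed.

Let cvg_cst_eq' (f : R -> R) x : {for x, continuous f} ->
  cvg (f y @[y --> x^'-]).
Proof. by move=> cf; apply/cvg_ex; exists (f x); exact: cvg_at_left_filter. Qed.

Lemma near_derive1E F f x : (forall x, 0 < x -> is_derive x 1 F (f x)) ->
  0 < x -> \forall y \near x, derive1 F y = f y.
Proof.
move=> dF x0; near=> y.
have y0 : 0 < y by near: y; exact: lt_nbhsr.
by rewrite derive1E; have [_] := dF y y0.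
Unshelve. all: end_near. Qed.

Lemma cont_derive1 F f x : (forall x, 0 < x -> is_derive x 1 F (f x)) ->
  {for x, continuous f} -> 0 < x -> {for x, continuous (derive1 F)}.
Proof.
move=> dF cf x0; rewrite /prop_for /continuous_at derive1E; have [_ ->] := dF x x0.
apply: cvg_trans cf; apply: near_eq_cvg.
by have := near_derive1E dF x0; apply: filterS => y ->.
Qed.

Lemma pos_homo_lt F f : (forall x, 0 < x -> is_derive x 1 F (f x)) ->
  (forall x, 0 < x -> 0 < f x) ->
  forall x y, 0 < x -> 0 < y -> (x < y) -> F x < F y.
Proof.
move=> dF f0 x y x0 y0 xy.
have [||c] := @MVT _ F f x y xy.
- by move=> z; rewrite in_itv/= => /andP[xz _]; apply: dF; exact: lt_trans xz.
- apply: cont_within => z; rewrite /= in_itv/= => /andP[xz _].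
  by apply: der_cont (dF _ _); exact: lt_le_trans xz.
- rewrite in_itv/= => /andP[xc _] e; rewrite -subr_gt0 e mulr_gt0 ?subr_gt0//.
  by apply: f0; exact: lt_trans xc.
Qed.

(** The rule on compact intervals is applied on [kitv k], whose images exhaust [J] by the
    intermediate value theorem. Nonnegativity allows the passage to the limit on both sides without
    integrability. Leaving [J] free covers both the half-line and the whole line as images. *)
Lemma ge0_subst_incr F f G (J : set R) :
  (forall x, 0 < x -> is_derive x 1 F (f x)) ->
  (forall x, 0 < x -> {for x, continuous f}) ->
  (forall x, 0 < x -> 0 < f x) ->
  measurable J -> (forall x, 0 < x -> J (F x)) ->
  (forall y, J y -> exists2 x, 0 < x & F x = y) ->
  (forall y, J y -> {for y, continuous G}) -> (forall y, J y -> 0 <= G y) ->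
  (\int[mu]_(y in J) (G y)%:E = \int[mu]_(x in pos) (G (F x) * f x)%:E)%E.
Proof.
move=> dF cf f0 mJ FJ JF cG G0.
have homoF := pos_homo_lt dF f0.
have cF x : 0 < x -> {for x, continuous F} by move=> /dF/der_cont.
have leF x y : 0 < x -> 0 < y -> (F x <= F y) = (x <= y).
  move=> x0 y0; apply/idP/idP => [Fxy|].
    rewrite leNgt; apply/negP => yx.
    by have := homoF _ _ y0 x0 yx; rewrite ltNge Fxy.
  by rewrite le_eqVlt => /predU1P[->//|/(homoF _ _ x0 y0)/ltW].
pose a k : R := k.+2%:R^-1; pose b k : R := k.+2%:R.
have a0 k : 0 < a k by rewrite invr_gt0.
pose E k := (`[F (a k), F (b k)]%classic : set R).
have EJ : \bigcup_k E k = J.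
  apply/seteqP; split => [y [k _]|y /JF[x x0 <-]].
    rewrite /E/= in_itv/= => /andP[ay yb].
    have [||c] := @IVT _ F (a k) (b k) y (ltW (kitv_lt k)).
    - apply: cont_within => z; rewrite /= in_itv/= => /andP[az _].
      by apply: cF; exact: lt_le_trans az.
    - have ab : F (a k) <= F (b k) by rewrite leF//; exact/ltW/kitv_lt.
      by rewrite min_l// max_r// ay.
    - rewrite in_itv/= => /andP[ac _] <-; apply: FJ; exact: lt_le_trans ac.
  have [k _ /(_ k)kx] := kitv_near x0.
  exists k => //; have := kx (leqnn _); rewrite /kitv/E/= !in_itv/= => /andP[ax xb].
  by rewrite !leF// /a /b ax.
have : (\int[mu]_(y in E k) (G y)%:E @[k --> \oo] --> \int[mu]_(y in J) (G y)%:E)%E.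
  rewrite -EJ; apply: ge0_nondecreasing_set_cvg_integral.
  - move=> m n mn; rewrite subsetEset; apply: subset_itv; rewrite bnd_simp.
      by rewrite leF// /a lef_pV2 ?posrE ?ltr0n// ler_nat.
    by rewrite leF// /b ler_nat.
  - by move=> k; exact: measurable_itv.
  - move=> k; apply/measurable_EFinP.
    have cGk : {within E k, continuous G}.
      by apply: cont_within => y Ey; apply: cG; rewrite -EJ; exists k.
    by apply: subspace_continuous_measurable_fun => //; exact: measurable_itv.
  - by move=> k y Ey; rewrite lee_fin; apply: G0; rewrite -EJ; exists k.
have : (\int[mu]_(y in E k) (G y)%:E @[k --> \oo] -->
    \int[mu]_(x in pos) (G (F x) * f x)%:E)%E.
  have -> : (fun k => \int[mu]_(y in E k) (G y)%:E)%E =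
            (fun k => \int[mu]_(x in kitv k) (G (F x) * f x)%:E)%E.
    apply/funext => k; rewrite /E integration_by_substitution_increasing.
    - apply: eq_integral => x; rewrite inE => kx.
      rewrite /= fctE/= derive1E; have [_ ->//] := dF x (kitvP kx).
    - exact/ltW/kitv_lt.
    - move=> x y; rewrite !in_itv/= => /andP[ax _] /andP[ay _]; apply: homoF.
        exact: lt_le_trans ax.
      exact: lt_le_trans ay.
    - move=> x; rewrite in_itv/= => /andP[ax _].
      have x0 : 0 < x by exact: lt_trans ax.
      by apply: (@cont_derive1 F f) => //; exact: cf.
    - by apply: cvg_cst_eq; apply: (@cont_derive1 F f) => //; exact: cf.
    - by apply: cvg_cst_eq'; apply: (@cont_derive1 F f) => //; exact: cf.
    - apply: (@der_LRcont _ F f); last exact: kitv_lt.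
      by move=> x /andP[ax _]; apply: dF; exact: lt_le_trans ax.
    - apply: cont_within => y Ey; apply: cG; rewrite -EJ; by exists k.
  apply: ge0_cvg_kitv.
    apply: measurable_pos_cont => x x0.
    apply: continuousM; last exact: cf.
    by apply: continuous_comp; [exact: cF|exact/cG/FJ].
  by move=> x x0; apply: mulr_ge0; [exact/G0/FJ|exact/ltW/f0].
move=> h1 h2; exact: cvg_unique h2 h1.
Qed.

Lemma Rsubst_incr F f G (J : set R) :
  (forall x, 0 < x -> is_derive x 1 F (f x)) ->
  (forall x, 0 < x -> {for x, continuous f}) ->
  (forall x, 0 < x -> 0 < f x) ->
  measurable J -> (forall x, 0 < x -> J (F x)) ->
  (forall y, J y -> exists2 x, 0 < x & F x = y) ->
  (forall y, J y -> {for y, continuous G}) -> (forall y, J y -> 0 <= G y) ->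
  \int[mu]_(y in J) G y = \int[mu]_(x in pos) (G (F x) * f x).
Proof. by move=> *; congr fine; exact: ge0_subst_incr. Qed.

(** Inversion maps each [kitv k] onto itself, so the two sides agree already on these intervals. *)
Lemma ge0_subst_inv G : (forall y, 0 < y -> {for y, continuous G}) ->
  (forall y, 0 < y -> 0 <= G y) ->
  (\int[mu]_(y in pos) (G y)%:E = \int[mu]_(x in pos) (G x^-1 * x ^- 2)%:E)%E.
Proof.
move=> cG G0.
pose E k := (kitv k : set R).
have h1 := @ge0_cvg_kitv _ G (measurable_pos_cont cG) G0.
have cG' x : 0 < x -> {for x, continuous (fun x => G x^-1 * x ^- 2)}.
  move=> x0; apply: continuousM.
    apply: continuous_comp; last by apply: cG; rewrite invr_gt0.
    by apply: (@der_cont _ (fun y : R => y^-1)); der; rewrite gt_eqF.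
  by dercont; rewrite expf_neq0// gt_eqF.
have h2 := @ge0_cvg_kitv _ _ (measurable_pos_cont cG').
have {}h2 := h2 _.
have dV x : 0 < x -> is_derive x 1 (fun y : R => y^-1) (- x ^- 2).
  by move=> x0; dereq; [rewrite gt_eqF|rewrite mulNr mul1r].
have cV x : 0 < x -> {for x, continuous (fun x : R => - x ^- 2)}.
  by move=> x0; dercont; rewrite expf_neq0// gt_eqF.
apply: cvg_unique h1 _ => //.
have -> : (fun k => \int[mu]_(y in kitv k) (G y)%:E)%E =
            (fun k => \int[mu]_(x in kitv k) (G x^-1 * x ^- 2)%:E)%E.
  apply/funext => k; rewrite /kitv.
  have := @integration_by_substitution_decreasing _ (fun y : R => y^-1) G k.+2%:R^-1 k.+2%:R (ltW (kitv_lt k)).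
  rewrite invrK => ->.
  - apply: eq_integral => x; rewrite inE => kx.
    rewrite -[LHS]/((G x^-1 * - derive1 (fun y : R => y^-1) x)%:E) derive1E; have [_ ->//] := dV x (@kitvP _ k _ kx).
    by rewrite opprK.
  - move=> x y; rewrite !in_itv/= => /andP[ax _] /andP[ay _] xy.
    rewrite ltf_pV2 ?posrE//; [exact: lt_le_trans ax|exact: lt_le_trans ay].
  - move=> x; rewrite in_itv/= => /andP[ax _].
    have x0 : 0 < x by exact: lt_trans ax.
    by apply: (cont_derive1 dV) => //; exact: cV.
  - by apply: cvg_cst_eq; apply: (cont_derive1 dV) => //; exact: cV.
  - by apply: cvg_cst_eq'; apply: (cont_derive1 dV) => //; exact: cV.
  - apply: (der_LRcont _ (kitv_lt k)).
    by move=> x /andP[ax _]; apply: dV; exact: lt_le_trans ax.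
  - apply: cont_within => y; rewrite /= in_itv/= => /andP[ay _]; apply: cG.
    exact: lt_le_trans ay.
by apply: h2 => x x0; rewrite mulr_ge0 ?G0 ?invr_gt0// invr_ge0 exprn_ge0// ltW.
Qed.

End subst_pos.

(** * The Gamma function *)

Section gamma_facts.
Context {R : realType}.
Notation mu := (@lebesgue_measure R).
Notation pos := (`]0%R, +oo[%classic : set R).
Implicit Types (f g F G : R -> R) (x t s c : R).

Lemma cvg_k2inv : (k.+2%:R^-1 : R) @[k --> \oo] --> (0 : R).
Proof.
have := @cvg_harmonic R; rewrite -cvg_shiftS; apply: cvg_trans.
by apply: near_eq_cvg; near=> k.
Unshelve. all: end_near. Qed.

Lemma cvg_k2inv_powR (p : R) : 0 < p -> (k.+2%:R^-1 : R) `^ p @[k --> \oo] --> (0 : R).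
Proof.
move=> p0; have /cvg_at_rightP := powR_cvg0 p0; apply.
by split; [move=> n; rewrite invr_gt0|exact: cvg_k2inv].
Qed.

Lemma cvg_dom0 (u v : nat -> R) : (forall k, `|u k| <= v k) ->
  v k @[k --> \oo] --> 0 -> u k @[k --> \oo] --> 0.
Proof.
move=> uv v0; apply: norm_cvg0.
apply: (@squeeze_cvgr _ _ _ _ (cst 0) _ _ _ _ _ v0); last exact: cvg_cst.
by apply: nearW => k; rewrite /= uv normr_ge0.
Qed.

Lemma cont_gamma_fun s c x : 0 < x ->
  {for x, continuous (fun t : R => t `^ s * expR (- (c * t)))}.
Proof. by move=> x0; dercont. Qed.

Lemma integrable_gammaM s c : 0 < s -> 0 < c ->
  mu.-integrable pos (EFin \o (fun t : R => t `^ (s - 1) * expR (- (c * t)))).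
Proof.
move=> s0 c0; have s20 : 0 <= 2 * s by rewrite mulr_ge0// ltW.
(* Bounding t^(2s) e^(-ct) leaves the integrable tail t^(-s-1). *)
have [K K0 HK] := powR_expRN_bndM s20 c0.
apply: (@integrable_pos_dom _ s s (1 + K)) => //.
- by apply: measurable_pos_cont => x x0; exact: cont_gamma_fun.
- move=> t t0 t1; rewrite normrM !ger0_norm ?powR_ge0 ?expR_ge0// mulrC.
  rewrite ler_wpM2r ?powR_ge0// (@le_trans _ _ 1)//; last by rewrite lerDl ltW.
  by rewrite expR_le1 oppr_le0 mulr_ge0// ltW.
- move=> t t1; have t0 : 0 < t by exact: lt_le_trans t1.
  rewrite normrM !ger0_norm ?powR_ge0 ?expR_ge0//.
  have -> : t `^ (s - 1) = t `^ (2 * s) * t `^ (- s - 1).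
    by rewrite powR_mulD//; congr (_ `^ _); ring.
  rewrite mulrAC ler_wpM2r ?powR_ge0// (le_trans (HK t t0))//.
  by rewrite lerDr.
Qed.

Lemma integrable_gamma s : 0 < s ->
  mu.-integrable pos (EFin \o (fun t : R => t `^ (s - 1) * expR (- t))).
Proof.
move=> s0; have := integrable_gammaM s0 ltr01.
by apply: eq_integrable => // t _ /=; rewrite mul1r.
Qed.

Lemma Rintegral_gammaM s c : 0 < s -> 0 < c ->
  \int[mu]_(t in pos) (t `^ (s - 1) * expR (- (c * t))) = c `^ (- s) * euler_gamma s.
Proof.
move=> s0 c0; rewrite /euler_gamma.
transitivity (c `^ (- s) * \int[mu]_(t in pos)
    ((c * t) `^ (s - 1) * expR (- (c * t)) * c)).
  rewrite -RintegralZl//; last first.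
    apply: (integrable_eqf _ _ (integrable_scale (c `^ s) _ (integrable_gammaM s0 c0))) => // t /pos_lt0 t0.
    have -> : c `^ s = c `^ (s - 1) * c.
      by rewrite -{3}(powRr1 (ltW c0)) powR_mulD// subrK.
    by rewrite powRM ?ltW//; ring.
  apply: eq_Rintegral => t; rewrite inE => /pos_lt0 t0.
  rewrite powRM ?ltW//.
  transitivity (c `^ (- s) * c `^ (s - 1) * c `^ 1 * t `^ (s - 1) * expR (- (c * t))); last first.
    by rewrite powRr1 ?ltW//; ring.
  by rewrite !powR_mulD// (_ : - s + _ + _ = 0) ?powRr0 ?mul1r//; ring.
congr (_ * _); apply/esym; apply: (@Rsubst_incr _ (fun t => c * t) (fun=> c)
  (fun t => t `^ (s - 1) * expR (- t)) pos).
- by move=> x x0; dereq; rewrite mulr0 addr0 mulr1.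
- by move=> x x0; exact: cvg_cst.
- by [].
- exact: measurable_itv.
- by move=> x x0; apply/pos_lt0; rewrite mulr_gt0.
- move=> y /pos_lt0 y0; exists (y / c); first by rewrite divr_gt0.
  by rewrite mulrCA divff ?mulr1// gt_eqF.
- move=> y /pos_lt0 y0; have := @cont_gamma_fun (s - 1) 1 y y0.
  by under [X in {for _, continuous X}]eq_fun do rewrite mul1r.
- by move=> y /pos_lt0 y0; rewrite mulr_ge0 ?powR_ge0 ?expR_ge0.
Qed.

Lemma integrable_gammaV s c : 0 < s -> 0 < c ->
  mu.-integrable pos (EFin \o (fun u : R => u `^ (- s - 1) * expR (- (c / u)))).
Proof.
move=> s0 c0; have s10 : 0 <= s + 1 by rewrite addr_ge0// ltW.
have [K K0 HK] := powR_expRN_bndM s10 c0.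
apply: (@integrable_pos_dom _ 1 s (1 + K)) => //.
- by apply: measurable_pos_cont => x x0; dercont => //; rewrite gt_eqF.
- move=> t t0 t1; rewrite normrM !ger0_norm ?powR_ge0 ?expR_ge0//.
  rewrite subrr powRr0 mulr1 (@le_trans _ _ K)//; last by rewrite lerDr.
  have := HK t^-1; rewrite invr_gt0 => /(_ t0); congr (_ * _ <= _).
  rewrite -powR_inv1 ?ltW// -powRrM; congr (_ `^ _); ring.
- move=> t t1; have t0 : 0 < t by exact: lt_le_trans t1.
  rewrite normrM !ger0_norm ?powR_ge0 ?expR_ge0// mulrC ler_wpM2r ?powR_ge0//.
  rewrite (@le_trans _ _ 1)//; last by rewrite lerDl ltW.
  by rewrite expR_le1 oppr_le0 divr_ge0// ltW.
Qed.

Lemma Rintegral_gammaV s c : 0 < s -> 0 < c ->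
  \int[mu]_(u in pos) (u `^ (- s - 1) * expR (- (c / u))) = c `^ (- s) * euler_gamma s.
Proof.
move=> s0 c0; rewrite -(Rintegral_gammaM s0 c0); apply/esym.
transitivity (\int[mu]_(t in pos) ((t^-1) `^ (s - 1) * expR (- (c * t^-1)) * t ^- 2)).
  congr fine; apply: (@ge0_subst_inv _ (fun t => t `^ (s - 1) * expR (- (c * t)))).
    exact: cont_gamma_fun.
  by move=> y y0; rewrite mulr_ge0 ?powR_ge0 ?expR_ge0.
apply: eq_Rintegral => t; rewrite inE => /pos_lt0 t0.
rewrite mulrAC; congr (_ * _).
rewrite -exprVn -powR_mulrn ?invr_ge0 ?ltW// -powR_inv1 ?ltW// -!powRrM.
by rewrite powR_mulD//; congr (_ `^ _); ring.
Qed.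

Lemma euler_gamma_gt0 s : 0 < s -> 0 < euler_gamma s.
Proof.
move=> s0; rewrite /euler_gamma.
(* A lower bound of the integrand on [1/2, 2]: the power is monotone, so its minimum is at an
   endpoint, and e^(-t) >= e^(-2). *)
pose c : R := Num.min (2^-1 `^ (s - 1)) (2 `^ (s - 1)) * expR (- 2).
have c0 : 0 < c by rewrite mulr_gt0 ?expR_gt0// lt_min !powR_gt0.
have ig := integrable_gamma s0.
have mk : measurable (@kitv R 0) by exact: measurable_kitv.
apply: (@lt_le_trans _ _ (\int[mu]_(t in kitv 0) c)).
  rewrite Rintegral_cst// mulr_gt0//.
  have h : fine (mu (kitv 0)) = 2 - 2^-1.
    rewrite -[RHS]/(fine (2 - 2^-1)%:E); congr fine.
    apply: etrans; first exact: lebesgue_measure_itv.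
    by rewrite /= lte_fin (@kitv_lt R 0).
  apply: (@lt_le_trans _ _ (2 - 2^-1)); first by rewrite subr_gt0 (@kitv_lt R 0).
  by rewrite -h; exact: lexx.
apply: (@le_trans _ _ (\int[mu]_(t in kitv 0) (t `^ (s - 1) * expR (- t)))).
  apply: le_Rintegral => //.
  - apply: measurable_bounded_integrable => //.
    + apply: (@le_lt_trans _ _ (2 - 2^-1)%:E); last exact: ltry.
      rewrite le_eqVlt; apply/orP; left; apply/eqP.
      apply: etrans; first exact: lebesgue_measure_itv.
      by rewrite /= lte_fin (@kitv_lt R 0).
    + exact: bounded_cst.
  - by apply: integrableS ig => //; exact: kitv_pos.
  - move=> t kt; have t0 := kitvP kt; move: kt; rewrite /kitv/= in_itv/= => /andP[t1 t2].
    apply: ler_pM; rewrite ?expR_ge0 ?ler_expR ?lerN2//.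
    rewrite ge_min; have [s1|s1] := leP 0 (s - 1).
      by apply/orP; left; apply: ge0_ler_powR => //; rewrite nnegrE ?invr_ge0// (ltW t0).
    apply/orP; right; rewrite -[s - 1]opprK [leLHS]powRN [leRHS]powRN.
    rewrite lef_pV2 ?posrE ?powR_gt0//; apply: ge0_ler_powR => //.
    - by rewrite oppr_ge0 ltW.
    - by rewrite nnegrE ltW.
    - by rewrite nnegrE.
rewrite [leRHS](_ : _ = \int[mu]_(t in kitv 0 `|` (pos `\` kitv 0)) (t `^ (s - 1) * expR (- t))); last first.
  by rewrite setDUK//; exact: kitv_pos.
rewrite Rintegral_setU//.
- rewrite lerDl Rintegral_ge0// => t [/pos_lt0 t0 _].
  by rewrite mulr_ge0 ?powR_ge0 ?expR_ge0.
- exact: measurableD.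
- by rewrite setDUK//; exact: kitv_pos.
- by apply/disj_setPS => t [? []].
Qed.

(** Integration by parts: t^s e^(-t) vanishes at both ends, so its derivative integrates to 0. *)
Lemma euler_gammaS s : 0 < s -> euler_gamma (s + 1) = s * euler_gamma s.
Proof.
move=> s0; pose F t := t `^ s * expR (- t).
have i1 := integrable_gamma s0.
have s10 : 0 < s + 1 by rewrite addr_gt0.
have i2 := integrable_gamma s10.
have i1' : mu.-integrable pos (EFin \o (fun t => s * (t `^ (s - 1) * expR (- t)))).
  exact: integrable_scale.
have : \int[mu]_(t in pos) (s * (t `^ (s - 1) * expR (- t)) -
    t `^ (s + 1 - 1) * expR (- t)) = 0 - 0.
  apply: (@FTC_pos _ F).
  - by move=> x x0; rewrite /F; dereq => //; rewrite addrK; ring.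
  - by move=> x x0; dercont.
  - exact: integrable_sub.
  - apply: cvg_dom0 (cvg_k2inv_powR s0) => k.
    rewrite /F ger0_norm ?mulr_ge0 ?powR_ge0 ?expR_ge0// ler_piMr ?powR_ge0//.
  - have [K K0 HK] := powR_expRN_bnd (ltW s10).
    have c0 : (K * k.+2%:R^-1 : R) @[k --> \oo] --> (0 : R).
      by rewrite -(mulr0 K); apply: cvgM; [exact: cvg_cst|exact: cvg_k2inv].
    apply: cvg_dom0 c0 => k.
    rewrite /F ger0_norm ?mulr_ge0 ?powR_ge0 ?expR_ge0// ler_pdivlMr//.
    have := HK k.+2%:R; rewrite ltr0n => /(_ isT).
    by rewrite -powR_mulD// powRr1// mulrAC.
rewrite subr0 RintegralB// RintegralZl// => /eqP.
by rewrite subr_eq0 => /eqP; exact: esym.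
Qed.

Lemma prod_split_shift s m k : \prod_(i < m + k) (s + i%:R) =
  (\prod_(i < m) (s + i%:R)) * \prod_(i < k) (s + m%:R + i%:R) :> R.
Proof.
rewrite big_split_ord/=; congr (_ * _); apply: eq_bigr => i _.
by rewrite natrD addrA.
Qed.

Lemma euler_gamma_prod s k : 0 < s ->
  euler_gamma (s + k%:R) = (\prod_(i < k) (s + i%:R)) * euler_gamma s.
Proof.
move=> s0; elim: k => [|k IH]; first by rewrite addr0 big_ord0 mul1r.
rewrite -natr1 addrA euler_gammaS; last by rewrite ltr_pwDl.
by rewrite IH big_ord_recr/= mulrA; congr (_ * _); rewrite mulrC.
Qed.

Lemma GammaE s : 0 < s -> Gamma s = euler_gamma s.
Proof. by rewrite /Gamma => ->. Qed.

(** [Gamma] is defined through one particular shift. Off the poles every shift to a positive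
    argument gives the same value, since the additional factors cancel by the functional equation;
    two values can then be compared at a common positive argument. *)
Lemma Gamma_shift s k : ~ gamma_pole s -> 0 < s + k%:R ->
  Gamma s = euler_gamma (s + k%:R) / \prod_(i < k) (s + i%:R) /\
  \prod_(i < k) (s + i%:R) != 0.
Proof.
move=> sp sk0.
have nz m : \prod_(i < m) (s + i%:R) != 0.
  apply/prodf_neq0 => i _; apply/eqP => e; apply: sp; exists i.
  by apply/eqP; rewrite -subr_eq0 opprK e.
split=> //.
have key m l : (m <= l)%N -> 0 < s + m%:R ->
    euler_gamma (s + l%:R) / \prod_(i < l) (s + i%:R) =
    euler_gamma (s + m%:R) / \prod_(i < m) (s + i%:R).
  move=> /subnKC <- sm; move: (l - m)%N => d.
  have := nz (m + d)%N; rewrite prod_split_shift natrD addrA (euler_gamma_prod d sm).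
  rewrite mulf_eq0 negb_or => /andP[].
  set p1 := \prod_(i < m) _; set p2 := \prod_(i < d) _ => n1 n2.
  by field; rewrite n1 n2.
rewrite /Gamma; case: ifPn => [s0|s0].
  have := @key 0%N k (leq0n _); rewrite addr0 => /(_ s0) ->.
  by rewrite big_ord0 divr1.
set m := (Num.truncn (- s)).+1.
have sm : 0 < s + m%:R by rewrite -ltrBlDl sub0r /m truncnS_gt.
have [mk|/ltnW km] := leqP m k; first by rewrite (key m k).
by rewrite (key k m).
Qed.

(** The arguments differ by 2 j, so a pole of the numerator is one of the denominator too. What
    remains is a pole of the denominator alone, where both sides are 0, and no pole at all, where
    [Gamma_shift] applies twice. *)
Lemma gamma_ratioE (n : nat) (beta : R) j :
  gamma_ratio n beta j =
  \prod_(i < j.*2) (n%:R / 2 - beta + 1 / 2 + (i%:R - j%:R)).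
Proof.
rewrite /gamma_ratio; case: asboolP => //= ab.
set b := n.+1%:R / 2 - j%:R - beta.
have aE : j%:R - beta + n.+1%:R / 2 = b + j.*2%:R.
  by rewrite /b -muln2 natrM; ring.
have prE : \prod_(i < j.*2) (n%:R / 2 - beta + 1 / 2 + (i%:R - j%:R)) =
    \prod_(i < j.*2) (b + i%:R).
  by apply: eq_bigr => i _; rewrite /b -natr1; field.
rewrite prE; move: ab; rewrite aE => ab.
have [[m bm]|bp] := pselect (gamma_pole b).
  (* The vanishing factor b + m is among the 2 j factors, for otherwise the numerator would be at a
     pole as well. *)
  have jm : (m < j.*2)%N.
    rewrite ltnNge; apply/negP => mj; apply: ab; split; last by exists m.
    by exists (m - j.*2)%N; rewrite natrB// bm; ring.
  have -> : Gamma b = 0.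
    rewrite /Gamma ifF; last by rewrite bm oppr_gt0 ltrn0.
    rewrite bm opprK natrK (bigD1 (Ordinal (ltnSn m)))//= addNr mul0r invr0 mulr0 //.
  by rewrite invr0 mulr0 (bigD1 (Ordinal jm))//= bm addNr mul0r.
have ap : ~ gamma_pole (b + j.*2%:R).
  by move=> [m e]; apply: bp; exists (m + j.*2)%N; rewrite natrD opprD -e addrK.
(* Shifting the denominator by K and the numerator by K - 2 j leads to the same positive argument,
   whose [euler_gamma] cancels. *)
pose K := (j.*2 + (Num.truncn (- b)).+1)%N.
have bK : 0 < b + K%:R.
  rewrite /K natrD addrCA addrC ltr_wpDr// -ltrBlDl sub0r truncnS_gt//.
have [-> nzb] := Gamma_shift bp bK.
have aK : 0 < b + j.*2%:R + (Num.truncn (- b)).+1%:R.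
  by rewrite -addrA -natrD.
have [-> nza] := Gamma_shift ap aK.
rewrite -addrA -natrD -/K.
have eg0 := euler_gamma_gt0 bK.
move: nzb; rewrite /K prod_split_shift.
rewrite mulf_eq0 negb_or => /andP[n1 n2]; field.
by rewrite n1 n2 gt_eqF.
Qed.

End gamma_facts.

(** * Gaussian integrals and the heat kernel *)

Section gauss1.
Context {R : realType}.
Notation mu := (@lebesgue_measure R).
Implicit Types (x t a b c : R).

Lemma gauss1_integral c a : 0 < c ->
  mu.-integrable setT (EFin \o (fun x => expR (- (c * (x - a) ^+ 2)))) /\
  \int[mu]_x expR (- (c * (x - a) ^+ 2)) = Num.sqrt (pi / c).
Proof.
(* The standard deviation of the normal law whose density is proportional to the integrand. *)
move=> c0; pose s : R := Num.sqrt (2 * c)^-1.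
have c20 : 0 < (2 * c)^-1 by rewrite invr_gt0 mulr_gt0.
have s0 : s != 0 by rewrite gt_eqF// sqrtr_gt0.
have s2 : s ^+ 2 = (2 * c)^-1 by rewrite sqr_sqrtr// ltW.
have pE : normal_peak s = (Num.sqrt (pi / c))^-1.
  rewrite /normal_peak s2; congr ((Num.sqrt _)^-1).
  by rewrite -mulr_natl; field; rewrite gt_eqF.
have q0 : 0 < Num.sqrt (pi / c) by rewrite sqrtr_gt0 divr_gt0// pi_gt0.
have E x : expR (- (c * (x - a) ^+ 2)) = Num.sqrt (pi / c) * normal_pdf a s x.
  rewrite normal_pdfE// -[X in _ = _ * X]/(normal_peak s * normal_fun a s x) pE mulVKf ?gt_eqF// /normal_fun; congr expR.
  by rewrite s2 -mulr_natl; field; rewrite gt_eqF.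
have ip : mu.-integrable setT (EFin \o normal_pdf a s).
  exact: integrable_normal_pdf.
split.
  apply: (integrable_eqf _ _ (integrable_scale (Num.sqrt (pi / c)) _ ip)) => //.
transitivity (\int[mu]_x (Num.sqrt (pi / c) * normal_pdf a s x)).
  by apply: eq_Rintegral => x _; exact: E.
by rewrite RintegralZl// [X in _ * X]/Rintegral integral_normal_pdf mulr1.
Qed.

(** The dominating function for differentiating Gaussian integrals in the frequency: half of the
    exponent absorbs the linear factor. *)
Lemma gauss1_moment c a : 0 < c ->
  mu.-integrable setT (EFin \o (fun x => `|x - a| * expR (- (c * (x - a) ^+ 2)))).
Proof.
move=> c0; have c20 : 0 < c / 2 by rewrite divr_gt0.
have [i _] := gauss1_integral a c20.
apply: (integrable_le _ _ _ (integrable_scale (1 + 2 / c) _ i)) => //.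
  apply: measurable_funM; first by apply: measurableT_comp => //; exact: measurable_funB.
  exact: integrable_meas (gauss1_integral a c0).1.
move=> x _; set y := x - a; rewrite normrM normr_id (ger0_norm (expR_ge0 _)).
have -> : - (c * y ^+ 2) = - (c / 2 * y ^+ 2) + - (c / 2 * y ^+ 2) by field.
rewrite expRD mulrA ler_wpM2r ?expR_ge0// expRN ler_pdivrMr ?expR_gt0//.
have h := expR_ge1Dx (c / 2 * y ^+ 2).
have y1 : `|y| <= 1 + y ^+ 2.
  have := sqr_ge0 (`|y| - 1); rewrite -[y ^+ 2]real_normK ?num_real//.
  have := normr_ge0 y; set z := `|y| => z0 zz.
  by have := sqr_ge0 z; lra.
apply: (le_trans y1).
have e1 : 1 <= expR (c / 2 * y ^+ 2).
  by rewrite -[leLHS]expR0 ler_expR mulr_ge0 ?sqr_ge0// ltW.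
rewrite mulrDl mul1r lerD// -[leLHS]mul1r.
have -> : 1 * y ^+ 2 = 2 / c * (c / 2 * y ^+ 2) by field; rewrite gt_eqF.
rewrite ler_wpM2l//; first by rewrite divr_ge0// ltW.
by apply: le_trans h; rewrite lerDr.
Qed.

Lemma FTC_setT (F f : R -> R) a : (forall x, is_derive x 1 F (f x)) ->
  (forall x, {for x, continuous f}) -> mu.-integrable setT (EFin \o f) ->
  F (a - k.+1%:R) @[k --> \oo] --> 0 -> F (a + k.+1%:R) @[k --> \oo] --> 0 ->
  \int[mu]_x f x = 0.
Proof.
move=> dF cf fi Fl Fr.
have := @cvg_Rintegral_sets _ _ _ mu setT (fun k => `[a - k.+1%:R, a + k.+1%:R]%classic) f
  measurableT (fun=> measurable_itv _) (fun=> @subsetT _ _) _ fi.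
move=> /(_ _)/cvg_unique; apply => //.
  move=> x _; near=> k; rewrite /= in_itv/=.
  have : `|x - a| <= k%:R by near: k; exact: nbhs_infty_ger.
  by rewrite ler_norml -natr1 => /andP[h1 h2]; apply/andP; split; lra.
have -> : (fun k => \int[mu]_(x in `[a - k.+1%:R, a + k.+1%:R]) f x) =
          (fun k => F (a + k.+1%:R) - F (a - k.+1%:R)).
  apply/funext => k; rewrite /Rintegral (@FTC_cc _ F)//.
  rewrite ltrD2l gtrN//.
by rewrite -(subr0 0); exact: cvgB.
Unshelve. all: end_near. Qed.

Lemma meas_cont_comp (p : R -> R) (g : R -> R) : continuous p -> measurable_fun setT g ->
  measurable_fun setT (fun x => p (g x)).
Proof. by move=> cp mg; apply: measurableT_comp mg; exact: continuous_measurable_fun. Qed.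

Variables (p q : R -> R).
Hypotheses (dp : forall x, is_derive x 1 p (q x))
  (dq : forall x, is_derive x 1 q (- p x)).
Hypotheses (pb : forall x, `|p x| <= 1) (qb : forall x, `|q x| <= 1).

Let der_p f x a' : is_derive x 1 f a' -> is_derive x 1 (fun y => p (f y)) (q (f x) * a').
Proof. by apply: der_comp. Qed.
Let der_q f x a' : is_derive x 1 f a' -> is_derive x 1 (fun y => q (f y)) (- p (f x) * a').
Proof. by apply: der_comp. Qed.

Let cp : continuous p. Proof. by move=> x; exact: der_cont (dp x). Qed.
Let cq : continuous q. Proof. by move=> x; exact: der_cont (dq x). Qed.

(** Sine and cosine are treated at once through p' = q, q' = - p. As a function of b the integral A
    has A' = D, differentiating under the integral, and b A = - 2 c D, integrating by parts; hence
    e^(b^2 / (4 c)) A(b) is constant and its value is read off at b = 0. *)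
Lemma gauss1_trig c a b : 0 < c ->
  \int[mu]_x (p (b * (x - a)) * expR (- (c * (x - a) ^+ 2))) =
  p 0 * (Num.sqrt (pi / c) * expR (- (b ^+ 2 / (4 * c)))).
Proof.
move=> c0; have [iE IE] := gauss1_integral a c0.
have iM := gauss1_moment a c0.
pose E x := expR (- (c * (x - a) ^+ 2)).
have mxa : measurable_fun setT (fun x : R => x - a) by exact: measurable_funB.
have mE : measurable_fun setT E by exact: integrable_meas iE.
have mf (r : R -> R) b' : continuous r -> measurable_fun setT (fun x => r (b' * (x - a))).
  by move=> cr; apply: meas_cont_comp => //; exact: measurable_funM.
pose f b' x := p (b' * (x - a)) * E x.
have if_ b' : mu.-integrable setT (EFin \o f b').
  apply: (integrable_le _ _ _ iE) => //; first exact: measurable_funM (mf _ _ cp) mE.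
  by move=> x _; rewrite normrM (ger0_norm (expR_ge0 _)) ler_piMl ?expR_ge0.
pose A b' := \int[mu]_x f b' x.
pose D b' := \int[mu]_x ((x - a) * q (b' * (x - a)) * E x).
have df b' x : is_derive b' 1 (f ^~ x) ((x - a) * q (b' * (x - a)) * E x).
  rewrite /f; notypeclasses refine (@der_eq _ _ _ _ _ _ _).
    notypeclasses refine (@der_mul _ _ _ _ _ _ _ _); last exact: der_cst.
    by notypeclasses refine (@der_p _ _ _ _); der.
  by cbv beta; ring.
have iD b' : mu.-integrable setT (EFin \o (fun x => (x - a) * q (b' * (x - a)) * E x)).
  apply: (integrable_le _ _ _ iM) => //.
    by apply: measurable_funM mE; apply: measurable_funM => //; exact: mf.
  move=> x _; rewrite !normrM (ger0_norm (expR_ge0 _)) ler_wpM2r ?expR_ge0//.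
  by rewrite ler_piMr.
have dA b' : is_derive b' 1 A (D b').
  have Ib : [set` `]b' - 1, b' + 1[] b' by rewrite /= in_itv/=; lra.
  have d1E x y : partial1of2 f x y = (y - a) * q (x * (y - a)) * E y.
    by rewrite partial1of2E; have [_] := df x y.
  apply: DeriveDef.
    apply: (@derivable_under_integral _ _ _ mu f setT measurableT b' (b' - 1) (b' + 1)
      Ib _ _ (fun x => `|x - a| * E x)) => //.
    - by move=> y; apply: mulr_ge0; [exact: normr_ge0|exact: expR_ge0].
    - move=> x y _ _; rewrite d1E !normrM (ger0_norm (expR_ge0 _)).
      by rewrite ler_wpM2r ?expR_ge0// ler_piMr.
  rewrite -derive1E (@differentiation_under_integral _ _ _ mu f setT measurableT b' (b' - 1) (b' + 1)
      Ib _ _ (fun x => `|x - a| * E x)) => //.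
  - by apply: eq_Rintegral => x _; rewrite d1E.
  - by move=> y; apply: mulr_ge0; [exact: normr_ge0|exact: expR_ge0].
  - move=> x y _ _; rewrite d1E !normrM (ger0_norm (expR_ge0 _)).
    by rewrite ler_wpM2r ?expR_ge0// ler_piMr.
have h : (c^-1 * k.+1%:R^-1 : R) @[k --> \oo] --> (0 : R).
  by rewrite -(mulr0 c^-1); apply: cvgM; [exact: cvg_cst|exact: cvg_harmonic].
have Eb x y k : (x - a) ^+ 2 = k.+1%:R ^+ 2 -> `|q y * E x| <= c^-1 * k.+1%:R^-1.
  move=> e; rewrite normrM (ger0_norm (expR_ge0 _)) (@le_trans _ _ (E x))//.
    by rewrite ler_piMl ?expR_ge0.
  rewrite /E e expRN -invfM lef_pV2 ?posrE ?expR_gt0 ?mulr_gt0//.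
  apply: le_trans (expR_ge1Dx _); rewrite ler_wpDl//.
  by rewrite ler_wpM2l ?(ltW c0)// expr2 ler_peMl// ler1n.
have parts b' : b' * A b' = - (2 * c) * D b'.
  have : \int[mu]_x (- b' * f b' x - (2 * c) * ((x - a) * q (b' * (x - a)) * E x)) = 0.
    apply: (@FTC_setT (fun x => q (b' * (x - a)) * E x) _ a).
    - move=> x; rewrite /E; notypeclasses refine (@der_eq _ _ _ _ _ _ _).
        notypeclasses refine (@der_mul _ _ _ _ _ _ _ _); last by der.
        by notypeclasses refine (@der_q _ _ _ _); der.
      by rewrite /f /E; cbv beta; ring.
    - move=> x; rewrite /f /E; dercont.
        by notypeclasses refine (@der_p _ _ _ _); der.
      by notypeclasses refine (@der_q _ _ _ _); der.
    - by apply: integrable_sub => //; exact: integrable_scale.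
    - apply: cvg_dom0 h => k; apply: Eb.
      by rewrite addrAC subrr sub0r sqrrN.
    - by apply: cvg_dom0 h => k; apply: Eb; rewrite addrC addKr.
  rewrite RintegralB//; [|exact: integrable_scale|exact: integrable_scale].
  rewrite !RintegralZl// -/(A b') -/(D b') => /eqP; rewrite subr_eq0 => /eqP h'.
  by rewrite mulNr -h' mulNr opprK.
have dZ b' : is_derive b' 1 (fun y => expR (y ^+ 2 / (4 * c)) * A y) 0.
  notypeclasses refine (@der_eq _ _ _ _ _ _ _).
    by notypeclasses refine (@der_mul _ _ _ _ _ _ _ (dA b')); der.
  have -> : D b' = - (b' / (2 * c)) * A b'.
    by apply: (mulfI (x := - (2 * c))); [rewrite oppr_eq0 gt_eqF// mulr_gt0|rewrite -parts; field; rewrite gt_eqF].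
  by cbv beta; field; rewrite gt_eqF.
have := is_derive_0_is_cst b 0 dZ; rewrite /= expr0n mul0r expR0 mul1r.
have -> : A 0 = p 0 * Num.sqrt (pi / c).
  rewrite -IE -RintegralZl//; apply: eq_Rintegral => x _.
  by rewrite /f mul0r.
rewrite /A /f /E => hA.
rewrite mulrA -hA mulrC mulrA -expRD.
by rewrite addrC subrr expR0 mul1r.
Qed.

End gauss1.

Section gaussn.
Context {R : realType}.
Notation mu := (@lebesgue_measure R).
Notation nu n := (@lebesgue_tuple R n).
Notation T := (measurableTypeR R).

Lemma gauss1_cos (c a b : R) : 0 < c ->
  \int[mu]_x (cos (b * (x - a)) * expR (- (c * (x - a) ^+ 2))) =
  Num.sqrt (pi / c) * expR (- (b ^+ 2 / (4 * c))).
Proof.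
move=> c0; rewrite (@gauss1_trig _ cos (fun x => - sin x)) ?cos0 ?mul1r//.
- by move=> x; rewrite cos_max.
- by move=> x; rewrite normrN sin_max.
Qed.

Lemma gauss1_sin (c a b : R) : 0 < c ->
  \int[mu]_x (sin (b * (x - a)) * expR (- (c * (x - a) ^+ 2))) = 0.
Proof.
move=> c0; rewrite (@gauss1_trig _ sin cos)// ?sin0 ?mul0r//.
- by move=> x; rewrite sin_max.
- by move=> x; rewrite cos_max.
Qed.

End gaussn.

Section prod_meas.
Context d1 d2 (T1 : measurableType d1) (T2 : measurableType d2) (R : realType).
Variables (m1 : {sigma_finite_measure set T1 -> \bar R})
  (m2 : {sigma_finite_measure set T2 -> \bar R}).

Lemma Rintegral_prod (f1 : T1 -> R) (f2 : T2 -> R) :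
  m1.-integrable setT (EFin \o f1) -> m2.-integrable setT (EFin \o f2) ->
  (m1 \x m2)%E.-integrable setT (fun z => (f1 z.1 * f2 z.2)%:E) /\
  (\int[m1 \x m2]_z (f1 z.1 * f2 z.2)%:E)%E =
   ((\int[m1]_x f1 x) * \int[m2]_t f2 t)%:E.
Proof.
move=> i1 i2.
have mf1 := integrable_meas i1; have mf2 := integrable_meas i2.
have mF : measurable_fun [set: T1 * T2] (fun z => (f1 z.1 * f2 z.2)%:E).
  apply/measurable_EFinP; apply: measurable_funM; apply: measurableT_comp => //.
have n1 := integrable_norm i1; have n2 := integrable_norm i2.
have iF : (m1 \x m2)%E.-integrable setT (fun z => (f1 z.1 * f2 z.2)%:E).
  apply/(integrable12ltyP _ _ mF) => /=.
  have -> : (\int[m1]_x \int[m2]_y `|f1 x * f2 y|%:E =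
             \int[m1]_x (`|f1 x|%:E * (\int[m2]_y `|f2 y|)%:E))%E.
    apply: eq_integral => x _.
    under eq_integral => y _ do rewrite normrM EFinM.
    rewrite (integralZl measurableT n2); congr (_ * _)%E.
    rewrite /Rintegral fineK//; exact: integrable_fin_num n2.
  rewrite (integralZr measurableT n1).
  have := integrable_fin_num measurableT n1 => /fineK <-.
  by rewrite -EFinM ltry.
split=> //.
rewrite -(integral12_prod_meas1 iF)/=.
have -> : (\int[m1]_x \int[m2]_y (f1 x * f2 y)%:E =
             \int[m1]_x ((f1 x)%:E * (\int[m2]_y f2 y)%:E))%E.
  apply: eq_integral => x _.
  under eq_integral => y _ do rewrite EFinM.
  rewrite (integralZl measurableT i2); congr (_ * _)%E.
  rewrite /Rintegral fineK//; exact: integrable_fin_num i2.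
rewrite (integralZr measurableT i1).
have := integrable_fin_num measurableT i1 => /fineK <-.
by rewrite -EFinM.
Qed.

End prod_meas.

Section gaussn.
Context {R : realType}.
Notation mu := (@lebesgue_measure R).
Notation nu n := (@lebesgue_tuple R n).
Notation T := (measurableTypeR R).

Lemma Rintegral_tuple_prod n (f1 : T -> R) (f2 : n.-tuple T -> R)
    (f : n.+1.-tuple T -> R) :
  mu.-integrable setT (EFin \o f1) -> (nu n).-integrable setT (EFin \o f2) ->
  measurable_fun setT f ->
  (forall x t, f (cons_pair (x, t)) = f1 x * f2 t) ->
  (nu n.+1).-integrable setT (EFin \o f) /\
  \int[nu n.+1]_t f t = (\int[mu]_x f1 x) * \int[nu n]_t f2 t.
Proof.
move=> i1 i2 mf fE.
have FE : (EFin \o f) \o @cons_pair _ T n = (fun z => (f1 z.1 * f2 z.2)%:E).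
  by apply/funext => -[x t] /=; rewrite fE.
have [iF IF] := Rintegral_prod i1 i2.
have mfe : measurable_fun setT (EFin \o f) by exact/measurable_EFinP.
have mc := @measurable_cons_pair _ T n.
split.
  apply: (@integrable_pushforward _ _ _ _ _ _ mc (mu \x nu n)%E setT (EFin \o f) mfe) => //.
  by rewrite preimage_setT FE.
rewrite -[RHS]/(fine _%:E) -IF -FE; congr fine.
apply: (@integral_pushforward _ _ _ _ _ _ mc (mu \x nu n)%E setT (EFin \o f) mfe) => //.
by rewrite preimage_setT FE.
Qed.

Lemma measurable_tuple_sum n (F : 'I_n -> R -> R) : (forall i, continuous (F i)) ->
  measurable_fun setT (fun t : n.-tuple T => \sum_i F i (tnth t i)).
Proof.
move=> cF; apply: measurable_sum => i.
apply: (measurableT_comp (continuous_measurable_fun (cF i))).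
exact: measurable_tnth.
Qed.

Lemma tuple_sum_cons n (F : 'I_n.+1 -> R -> R) x (u : n.-tuple T) :
  \sum_i F i (tnth (cons_pair (x, u)) i) =
  F ord0 x + \sum_i F (lift ord0 i) (tnth u i).
Proof.
rewrite big_ord_recl; congr (F _ _ + _).
by apply: eq_bigr => i _; rewrite !(tnth_nth x)/= add0n.
Qed.

(** Induction on the dimension. Sine and cosine go together because the addition formulas mix them
    when a coordinate is split off. In dimension 0 the measure is a point mass. *)
Lemma gaussn_tuple n (c : R) (a b : 'rV[R]_n) : 0 < c ->
  let E (t : n.-tuple T) := expR (- (c * \sum_i (tnth t i - a 0 i) ^+ 2)) in
  let P (t : n.-tuple T) := \sum_i b 0 i * (tnth t i - a 0 i) in
  [/\ (nu n).-integrable setT (EFin \o E),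
      \int[nu n]_t (cos (P t) * E t) =
        Num.sqrt (pi / c) ^+ n * expR (- ((\sum_i b 0 i ^+ 2) / (4 * c))) &
      \int[nu n]_t (sin (P t) * E t) = 0].
Proof.
move=> c0; elim: n a b => [|n IH] a b E P.
  have nu01 : nu 0 setT = 1%E by exact: diracT.
  have E1 t : E t = 1 by rewrite /E big_ord0 mulr0 oppr0 expR0.
  have P0 t : P t = 0 by rewrite /P big_ord0.
  split.
  - have -> : E = cst 1 by apply/funext => t; rewrite E1.
    apply/integrableP; split; first by apply/measurable_EFinP; exact: measurable_cst.
    under eq_integral => t _ do rewrite /= normr1.
    have h : (1%:E * nu 0 setT < +oo)%E by rewrite nu01 mule1 ltry.
    by rewrite integral_cst.
  - transitivity (\int[nu 0]_t (1 : R)).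
      by apply: eq_Rintegral => t _; rewrite E1 P0 cos0 mulr1.
    transitivity (1 * fine (nu 0 setT)); first exact: Rintegral_cst.
    by rewrite nu01 big_ord0 mul0r oppr0 expR0 mulr1.
  - transitivity (\int[nu 0]_t (0 : R)).
      by apply: eq_Rintegral => t _; rewrite E1 P0 sin0 mulr1.
    by rewrite Rintegral_cst// mul0r.
pose a' := \row_i a 0 (lift ord0 i); pose b' := \row_i b 0 (lift ord0 i).
pose E' (t : n.-tuple T) := expR (- (c * \sum_i (tnth t i - a' 0 i) ^+ 2)).
pose P' (t : n.-tuple T) := \sum_i b' 0 i * (tnth t i - a' 0 i).
have [] : [/\ (nu n).-integrable setT (EFin \o E'), \int[nu n]_t (cos (P' t) * E' t) = _ & \int[nu n]_t (sin (P' t) * E' t) = _] := IH a' b'.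
move=> iE' cE' sE'.
pose a0 := a 0 ord0; pose b0 := b 0 ord0.
pose E1 x := expR (- (c * (x - a0) ^+ 2)); pose P1 x := b0 * (x - a0).
have [iE1 _] := gauss1_integral a0 c0.
have cE1 : \int[mu]_x (cos (P1 x) * E1 x) = _ := gauss1_cos a0 b0 c0.
have sE1 : \int[mu]_x (sin (P1 x) * E1 x) = _ := gauss1_sin a0 b0 c0.
have cpow (d : R) : continuous (fun x : R => (x - d) ^+ 2) by move=> x; dercont.
have clin (d e : R) : continuous (fun x : R => e * (x - d)) by move=> x; dercont.
have mE : measurable_fun setT E.
  apply: measurableT_comp => //; apply: measurableT_comp => //.
  apply: measurable_funM => //.
  exact: (measurable_tuple_sum (F := fun i x => (x - a 0 i) ^+ 2)).
have mP : measurable_fun setT P.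
  exact: (measurable_tuple_sum (F := fun i x => b 0 i * (x - a 0 i))).
have mcP : measurable_fun setT (fun t => cos (P t)).
  exact: (measurableT_comp (continuous_measurable_fun (@continuous_cos R)) mP).
have msP : measurable_fun setT (fun t => sin (P t)).
  exact: (measurableT_comp (continuous_measurable_fun (@continuous_sin R)) mP).
have mP' : measurable_fun setT P'.
  exact: (measurable_tuple_sum (F := fun i x => b' 0 i * (x - a' 0 i))).
have mcP' : measurable_fun setT (fun t => cos (P' t)).
  exact: (measurableT_comp (continuous_measurable_fun (@continuous_cos R)) mP').
have msP' : measurable_fun setT (fun t => sin (P' t)).
  exact: (measurableT_comp (continuous_measurable_fun (@continuous_sin R)) mP').
have EE x u : E (cons_pair (x, u)) = E1 x * E' u.
  rewrite /E (tuple_sum_cons (fun i x => (x - a 0 i) ^+ 2)) mulrDr opprD expRD.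
  by congr (_ * expR (- (_ * _))); apply: eq_bigr => i _; rewrite mxE.
have PE x u : P (cons_pair (x, u)) = P1 x + P' u.
  rewrite /P (tuple_sum_cons (fun i x => b 0 i * (x - a 0 i))).
  by congr (_ + _); apply: eq_bigr => i _; rewrite !mxE.
have dom d (X : measurableType d) (m : {measure set X -> \bar R}) (p e : X -> R) :
    m.-integrable setT (EFin \o e) -> measurable_fun setT p ->
    (forall x, `|p x| <= 1) -> (forall x, 0 <= e x) ->
    m.-integrable setT (EFin \o (fun x => p x * e x)).
  move=> ie mp p1 e0; apply: (integrable_le _ _ _ ie) => //.
    by apply: measurable_funM => //; exact: integrable_meas ie.
  by move=> x _; rewrite normrM (ger0_norm (e0 x)) ler_piMl.
have iE : (nu n.+1).-integrable setT (EFin \o E).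
  by have [] := Rintegral_tuple_prod iE1 iE' mE EE.
have mP1 : measurable_fun setT P1 by apply: continuous_measurable_fun; exact: clin.
have icE1 : mu.-integrable setT (EFin \o (fun x => cos (P1 x) * E1 x)).
  apply: dom => // [|x|x]; [|exact: cos_max|exact: expR_ge0].
  exact: (measurableT_comp (continuous_measurable_fun (@continuous_cos R)) mP1).
have isE1 : mu.-integrable setT (EFin \o (fun x => sin (P1 x) * E1 x)).
  apply: dom => // [|x|x]; [|exact: sin_max|exact: expR_ge0].
  exact: (measurableT_comp (continuous_measurable_fun (@continuous_sin R)) mP1).
have icE' : (nu n).-integrable setT (EFin \o (fun u => cos (P' u) * E' u)).
  by apply: dom => // [x|x]; [exact: cos_max|exact: expR_ge0].
have isE' : (nu n).-integrable setT (EFin \o (fun u => sin (P' u) * E' u)).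
  by apply: dom => // [x|x]; [exact: sin_max|exact: expR_ge0].
pose t1 (t : n.+1.-tuple T) := P1 (thead t).
pose e1 (t : n.+1.-tuple T) := E1 (thead t).
pose t2 (t : n.+1.-tuple T) := P' [tuple of behead t].
pose e2 (t : n.+1.-tuple T) := E' [tuple of behead t].
have mth : measurable_fun setT (fun t : n.+1.-tuple T => thead t) by exact: measurable_tnth.
have mbh : measurable_fun setT (fun t : n.+1.-tuple T => [tuple of behead t]).
  exact: measurable_behead.
have headK x (u : n.-tuple T) : thead (cons_pair (x, u)) = x by rewrite /thead (tnth_nth x).
have beheadK x (u : n.-tuple T) : [tuple of behead (cons_pair (x, u))] = u by exact: val_inj.
have prodL (f1 : T -> R) (f2 : n.-tuple T -> R) :
   mu.-integrable setT (EFin \o f1) -> (nu n).-integrable setT (EFin \o f2) ->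
   (nu n.+1).-integrable setT (EFin \o (fun t => f1 (thead t) * f2 [tuple of behead t])) /\
   \int[nu n.+1]_t (f1 (thead t) * f2 [tuple of behead t]) = (\int[mu]_x f1 x) * \int[nu n]_t f2 t.
  move=> if1 if2; apply: Rintegral_tuple_prod => //.
    apply: measurable_funM.
      by apply: (measurableT_comp (integrable_meas if1)).
    by apply: (measurableT_comp (integrable_meas if2)).
  by move=> x u; rewrite headK beheadK.
have [icc cc] := prodL _ _ icE1 icE'.
have [iss ss] := prodL _ _ isE1 isE'.
have [ics cs] := prodL _ _ icE1 isE'.
have [isc sc] := prodL _ _ isE1 icE'.
have consK (t : n.+1.-tuple T) : t = cons_pair (thead t, [tuple of behead t]).
  by rewrite {1}[t]tuple_eta; apply: val_inj.
split=> //.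
- transitivity (\int[nu n.+1]_t ((cos (P1 (thead t)) * E1 (thead t)) *
      (cos (P' [tuple of behead t]) * E' [tuple of behead t]) -
      (sin (P1 (thead t)) * E1 (thead t)) *
      (sin (P' [tuple of behead t]) * E' [tuple of behead t]))).
    by apply: eq_Rintegral => t _; rewrite {1 2}(consK t) EE PE cosD; ring.
  rewrite RintegralB// cc ss sE1 mul0r subr0 cE' cE1.
  rewrite big_ord_recl (exprS (Num.sqrt _) n) mulrACA -expRD; congr (_ * expR _).
  rewrite -opprD -mulrDl; congr (- (_ / _)); congr (_ + _); apply: eq_bigr => i _.
  by rewrite mxE.
- transitivity (\int[nu n.+1]_t ((sin (P1 (thead t)) * E1 (thead t)) *
      (cos (P' [tuple of behead t]) * E' [tuple of behead t]) +
      (cos (P1 (thead t)) * E1 (thead t)) *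
      (sin (P' [tuple of behead t]) * E' [tuple of behead t]))).
    by apply: eq_Rintegral => t _; rewrite {1 2}(consK t) EE PE sinD; ring.
  by rewrite RintegralD// sc cs sE' sE1 mulr0 mul0r addr0.
Qed.

Lemma dot_tuple n (b a : 'rV[R]_n) (t : n.-tuple T) :
  dot b (row_of_tuple t - a) = \sum_i b 0 i * (tnth t i - a 0 i).
Proof. by apply: eq_bigr => i _; rewrite !mxE. Qed.

Lemma dotsq_tuple n (a : 'rV[R]_n) (t : n.-tuple T) :
  dot (row_of_tuple t - a) (row_of_tuple t - a) = \sum_i (tnth t i - a 0 i) ^+ 2.
Proof. by apply: eq_bigr => i _; rewrite !mxE expr2. Qed.

Lemma dotxx n (b : 'rV[R]_n) : dot b b = \sum_i b 0 i ^+ 2.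
Proof. by apply: eq_bigr => i _; rewrite expr2. Qed.

Lemma gaussn n (c : R) (a b : 'rV[R]_n) : 0 < c ->
  let E (x : 'rV[R]_n) := expR (- (c * dot (x - a) (x - a))) in
  [/\ Rn_integrable E,
      Rn_integral (fun x => cos (dot b (x - a)) * E x) =
        Num.sqrt (pi / c) ^+ n * expR (- (dot b b / (4 * c))) &
      Rn_integral (fun x => sin (dot b (x - a)) * E x) = 0].
Proof.
move=> c0 E; have [i cI sI] := gaussn_tuple a b c0.
have EE : E \o @row_of_tuple R n = (fun t => expR (- (c * \sum_i (tnth t i - a 0 i) ^+ 2))).
  by apply/funext => t; rewrite /= /E dotsq_tuple.
split.
- by rewrite /Rn_integrable -compA EE.
- rewrite dotxx -cI; apply: eq_Rintegral => t _ /=.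
  by rewrite -dot_tuple -dotsq_tuple.
- rewrite -sI; apply: eq_Rintegral => t _ /=.
  by rewrite -dot_tuple -dotsq_tuple.
Qed.

End gaussn.

(** * The heat kernel *)

Section heat_kernel.
Context {R : realType}.
Notation mu := (@lebesgue_measure R).
Notation pos := (`]0%R, +oo[%classic : set R).
Notation nu n := (@lebesgue_tuple R n).
Notation T := (measurableTypeR R).

Lemma dotxx_ge0 n (x : 'rV[R]_n) : 0 <= dot x x.
Proof. by rewrite dotxx sumr_ge0// => i _; exact: sqr_ge0. Qed.

Lemma enorm_sqr n (x : 'rV[R]_n) : enorm x ^+ 2 = dot x x.
Proof. by rewrite /enorm sqr_sqrtr// dotxx_ge0. Qed.

Lemma dotC n (x y : 'rV[R]_n) : dot x y = dot y x.
Proof. by apply: eq_bigr => i _; rewrite mulrC. Qed.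

Lemma dotBl n (x y z : 'rV[R]_n) : dot (x - y) z = dot x z - dot y z.
Proof. by rewrite /dot -sumrB; apply: eq_bigr => i _; rewrite !mxE mulrBl. Qed.

Lemma dotBr n (x y z : 'rV[R]_n) : dot x (y - z) = dot x y - dot x z.
Proof. by rewrite dotC dotBl !(dotC x). Qed.

Lemma dotxx_eq0 n (x : 'rV[R]_n) : (dot x x == 0) = (x == 0).
Proof.
apply/idP/eqP => [|->]; last first.
  by rewrite dotxx; apply/eqP/big1 => i _; rewrite mxE expr0n.
rewrite dotxx psumr_eq0; last by move=> i _; exact: sqr_ge0.
move=> /allP h; apply/rowP => i; rewrite mxE; apply/eqP.
by rewrite -sqrf_eq0; apply: h; rewrite mem_index_enum.
Qed.

Lemma dotxx_gt0 n (x : 'rV[R]_n) : x != 0 -> 0 < dot x x.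
Proof. by move=> x0; rewrite lt_def dotxx_eq0 x0 dotxx_ge0. Qed.

Lemma measurable_coord n (i : 'I_n) :
  measurable_fun setT (fun t : n.-tuple T => row_of_tuple t 0 i).
Proof.
rewrite (_ : (fun _ => _) = (fun t : n.-tuple T => tnth t i)); first exact: measurable_tnth.
by apply/funext => t; rewrite mxE.
Qed.

Lemma measurable_dot d (X : measurableType d) n (f g : X -> 'rV[R]_n) :
  (forall i, measurable_fun setT (fun x => f x 0 i)) ->
  (forall i, measurable_fun setT (fun x => g x 0 i)) ->
  measurable_fun setT (fun x => dot (f x) (g x)).
Proof. by move=> mf mg; apply: measurable_sum => i; exact: measurable_funM. Qed.

Lemma measurable_dotl n (w : 'rV[R]_n) :
  measurable_fun setT (fun t : n.-tuple T => dot w (row_of_tuple t)).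
Proof. by apply: measurable_dot => i //; exact: measurable_coord. Qed.

Lemma measurable_dotB n (a : 'rV[R]_n) :
  measurable_fun setT (fun t : n.-tuple T => dot (row_of_tuple t - a) (row_of_tuple t - a)).
Proof.
have h i : measurable_fun setT (fun t : n.-tuple T => (row_of_tuple t - a) 0 i).
  under eq_fun do rewrite !mxE.
  by apply: measurable_funB => //; exact: measurable_tnth.
by apply: measurable_dot.
Qed.

Lemma measurable_dotsq n :
  measurable_fun setT (fun t : n.-tuple T => dot (row_of_tuple t) (row_of_tuple t)).
Proof. by have := measurable_dotB (0 : 'rV[R]_n); under eq_fun do rewrite subr0. Qed.

(* Equal to [(4 pi u)^(-n/2) e^(-|x|^2 / (4 u))]; this form is [(2 pi)^-n]
   times the Fourier transform of [e^(-u |t|^2)]. *)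
Definition heat n (u : R) (x : 'rV[R]_n) : R :=
  ((2 * pi) ^+ n)^-1 * (Num.sqrt (pi / u) ^+ n * expR (- (dot x x / (4 * u)))).

Lemma twopi_gt0 n : 0 < (2 * pi : R) ^+ n.
Proof. by rewrite exprn_gt0// mulr_gt0// pi_gt0. Qed.

Lemma heat_ge0 n u (x : 'rV[R]_n) : 0 <= heat u x.
Proof.
rewrite !mulr_ge0 ?invr_ge0 ?exprn_ge0 ?expR_ge0 ?sqrtr_ge0//.
by rewrite mulr_ge0// pi_ge0.
Qed.

Lemma heat_fourier n (u : R) (w : 'rV[R]_n) : 0 < u ->
  ((2 * pi) ^+ n)^-1 *
  Rn_integral (fun t => cos (dot w t) * expR (- (u * dot t t))) = heat u w.
Proof.
move=> u0; have [_ + _] := gaussn 0 w u0.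
rewrite /heat => E; congr (_ * _); apply: etrans E; apply: eq_Rintegral => t _.
by rewrite subr0.
Qed.

Lemma integrable_gauss n (u : R) : 0 < u ->
  @Rn_integrable R n (fun t => expR (- (u * dot t t))).
Proof.
move=> u0; have [+ _ _] := gaussn 0 (0 : 'rV[R]_n) u0.
by under eq_fun do rewrite subr0.
Qed.

(** The duality behind the smoothing: a heat kernel centered at [a] has total mass 1 and transforms
    back into a modulated Gaussian. Expanding around [a] leaves only the cosine part, the sine part
    being odd. *)
Lemma heat_dual n (u : R) (b a : 'rV[R]_n) : 0 < u ->
  [/\ @Rn_integrable R n (fun x => heat u (x - a)),
   Rn_integral (fun x => cos (dot b x) * heat u (x - a)) =
     cos (dot b a) * expR (- (u * dot b b)) &
   Rn_integral (fun x => heat u (x - a)) = 1].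
Proof.
move=> u0; have c0 : 0 < (4 * u)^-1 by rewrite invr_gt0 mulr_gt0.
pose E (x : 'rV[R]_n) := expR (- ((4 * u)^-1 * dot (x - a) (x - a))).
pose A : R := ((2 * pi) ^+ n)^-1 * Num.sqrt (pi / u) ^+ n.
have hE (x : 'rV[R]_n) : heat u (x - a) = A * E x.
  by rewrite /heat /A /E -mulrA (mulrC _^-1 (dot _ _)).
have pu0 : 0 < pi / u by rewrite divr_gt0// pi_gt0.
(* The normalization: sqrt(pi / u) sqrt(4 pi u) = 2 pi in each coordinate. *)
have AE : A * Num.sqrt (pi / (4 * u)^-1) ^+ n = 1.
  rewrite /A -mulrA -exprMn -sqrtrM ?ltW// (_ : pi / u * (pi / (4 * u)^-1) = (2 * pi) ^+ 2); last first.
    by rewrite invrK; field; rewrite gt_eqF.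
  rewrite sqrtr_sqr ger0_norm; last by rewrite mulr_ge0// pi_ge0.
  by rewrite mulVf// gt_eqF// twopi_gt0.
have [iE _ _] := gaussn a b c0.
have icE (r : R -> R) v : continuous r -> (forall x, `|r x| <= 1) ->
    (nu n).-integrable setT (EFin \o (fun t => r (dot v (row_of_tuple t - a)) * E (row_of_tuple t))).
  move=> cr r1; apply: (integrable_le _ _ _ iE) => //.
    apply: measurable_funM; last exact: integrable_meas iE.
    apply: (measurableT_comp (continuous_measurable_fun cr)).
    under eq_fun do rewrite dotBr.
    by apply: measurable_funB => //; exact: measurable_dotl.
  by move=> t _ /=; rewrite normrM (ger0_norm (expR_ge0 _)) ler_piMl ?expR_ge0.
have main v : \int[nu n]_t (cos (dot v (row_of_tuple t)) * heat u (row_of_tuple t - a)) =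
     cos (dot v a) * expR (- (u * dot v v)).
  have [_ cE sE] := gaussn a v c0.
  transitivity (\int[nu n]_t (
     (cos (dot v a) * A) * (cos (dot v (row_of_tuple t - a)) * E (row_of_tuple t)) -
     (sin (dot v a) * A) * (sin (dot v (row_of_tuple t - a)) * E (row_of_tuple t)))).
    apply: eq_Rintegral => t _; rewrite hE.
    have -> : dot v (row_of_tuple t) = dot v a + dot v (row_of_tuple t - a).
      by rewrite dotBr addrC subrK.
    by rewrite cosD; ring.
  have i1 := icE cos v (@continuous_cos R) (@cos_max R).
  have i2 := icE sin v (@continuous_sin R) (@sin_max R).
  rewrite RintegralB//; [|exact: integrable_scale|exact: integrable_scale].
  rewrite !RintegralZl//.
  rewrite [X in _ * X - _](_ : _ = Num.sqrt (pi / (4 * u)^-1) ^+ n * expR (- (dot v v / (4 * (4 * u)^-1))))//.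
  rewrite [X in _ - _ * X](_ : _ = 0)// mulr0 subr0.
  rewrite -mulrA [A * _]mulrA AE mul1r; congr (_ * expR (- _)).
  by field; rewrite gt_eqF.
split.
- by apply: (integrable_eqf _ _ (integrable_scale A _ iE)) => // t _ /=; rewrite hE.
- exact: main.
- have := main 0; have d0 x : dot (0 : 'rV[R]_n) x = 0.
    by apply: big1 => i _; rewrite mxE mul0r.
  rewrite !d0 cos0 mulr0 oppr0 expR0 mulr1 => <-.
  by apply: eq_Rintegral => t _ /=; rewrite d0 cos0 mul1r.
Qed.

Lemma cont_heat n (w : 'rV[R]_n) u : 0 < u -> {for u, continuous (fun v => heat v w)}.
Proof.
move=> u0; rewrite /heat; dercont; rewrite ?gt_eqF ?divr_gt0 ?pi_gt0 ?mulr_gt0//.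
Qed.

Lemma sqrt_expn (x : R) n : 0 <= x -> Num.sqrt x ^+ n = x `^ (n%:R / 2).
Proof.
move=> x0; rewrite -powR12_sqrt// -powR_mulrn ?powR_ge0// -powRrM.
by rewrite mulrC.
Qed.

(** For w <> 0 the factor e^(-|w|^2 / (4 u)) beats u^(-n/2) as u tends to 0. This bound turns
    integrability of the mixing density into integrability of its product with the heat kernel. *)
Lemma heat_bnd n (w : 'rV[R]_n) : w != 0 -> exists2 K, 0 < K & forall u, 0 < u -> heat u w <= K.
Proof.
move=> /dotxx_gt0 w0.
have n0 : 0 <= n%:R / 2 :> R by rewrite divr_ge0.
have c0 : 0 < dot w w / 4 by rewrite divr_gt0.
have [K K0 HK] := powR_expRN_bndM n0 c0.
exists (((2 * pi) ^+ n)^-1 * (pi `^ (n%:R / 2) * K)).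
  by rewrite !mulr_gt0 ?invr_gt0 ?twopi_gt0 ?powR_gt0 ?pi_gt0.
move=> u u0; rewrite /heat ler_wpM2l ?invr_ge0 ?(ltW (twopi_gt0 _))//.
have := HK u^-1; rewrite invr_gt0 => /(_ u0) h.
rewrite sqrt_expn ?divr_ge0 ?pi_ge0 ?(ltW u0)// powRM ?pi_ge0 ?invr_ge0 ?(ltW u0)//.
rewrite -mulrA ler_wpM2l ?powR_ge0//; apply: le_trans h.
by rewrite ler_wpM2l ?powR_ge0// ler_expR lerN2 invfM mulrA.
Qed.

(** Away from the center the concentrating kernels are compared with the kernel at u = 1. The
    function S need not be integrable, but its product with that kernel is, so the tails of the
    smoothing tend to 0. *)
Lemma heat_tail n (d : R) : 0 < d ->
  exists2 c : nat -> R, c k @[k --> \oo] --> 0 &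
    (forall k, 0 <= c k) /\ forall k (x : 'rV[R]_n), d <= dot x x ->
    heat k.+1%:R^-1 x <= c k * heat 1 x.
Proof.
move=> d0; have d40 : 0 < d / 4 by rewrite divr_gt0.
have n0 : 0 <= n%:R / 2 + 1 :> R by rewrite addr_ge0// divr_ge0.
have [K K0 HK] := powR_expRN_bndM n0 d40.
(* The ratio of the two kernels is (k + 1)^(n/2) e^(-k |x|^2 / 4), largest at |x|^2 = d. *)
pose c k : R := k.+1%:R `^ (n%:R / 2) * expR (- (d / 4 * k%:R)).
exists c.
  have h : (K * expR (d / 4) * k.+1%:R^-1 : R) @[k --> \oo] --> (0 : R).
    by rewrite -(mulr0 (K * expR (d / 4))); apply: cvgM; [exact: cvg_cst|exact: cvg_harmonic].
  apply: cvg_dom0 h => k.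
  rewrite ger0_norm ?mulr_ge0 ?powR_ge0 ?expR_ge0// ler_pdivlMr//.
  have := HK k.+1%:R; rewrite ltr0n => /(_ isT).
  rewrite -powR_mulD// powRr1// => h'.
  rewrite /c -natr1 (_ : - (d / 4 * k%:R) = - (d / 4 * (k%:R + 1)) + d / 4); last by ring.
  rewrite natr1 expRD mulrA [leLHS]mulrAC ler_wpM2r ?expR_ge0//.
  by rewrite mulrAC.
split=> [k|k x dx]; first by rewrite mulr_ge0 ?powR_ge0 ?expR_ge0.
rewrite /heat [leRHS]mulrCA ler_wpM2l ?invr_ge0 ?(ltW (twopi_gt0 _))//.
rewrite invrK divr1 !sqrt_expn ?mulr_ge0 ?pi_ge0// powRM ?pi_ge0//.
rewrite /c [leRHS]mulrACA [pi `^ _ * _]mulrC ler_wpM2l ?mulr_ge0 ?powR_ge0//.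
rewrite -expRD ler_expR mulr1 -opprD lerN2.
rewrite invfM invrK -[k.+1%:R]natr1.
have -> : dot x x * (4^-1 * (k%:R + 1)) = dot x x / 4 * k%:R + dot x x / 4 by ring.
by rewrite lerD2r ler_wpM2r// ler_wpM2r.
Qed.

End heat_kernel.

(** * The heat kernel as an approximate identity *)

Section approximate_identity.
Context {R : realType}.
Notation nu n := (@lebesgue_tuple R n).
Variables (n : nat) (S : 'rV[R]_n -> R) (w0 : 'rV[R]_n).
Hypothesis cS : {for w0, continuous S}.
Hypothesis iS : forall u, 0 < u -> Rn_integrable (fun w => S w * heat u (w - w0)).

Lemma enorm_coord (x : 'rV[R]_n) i : `|x 0 i| ^+ 2 <= dot x x.
Proof.
rewrite real_normK ?num_real// dotxx (bigD1 i)//= lerDl sumr_ge0// => j _.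
exact: sqr_ge0.
Qed.

(** Continuity refers to the entrywise topology, the heat kernel to the Euclidean distance; each
    entry is bounded by the latter. *)
Lemma near_dot (e : R) : 0 < e -> exists2 d : R, 0 < d &
  forall w, dot (w - w0) (w - w0) < d -> `|S w - S w0| <= e.
Proof.
move=> e0; move/cvgrPdist_le : cS => /(_ e e0) /nbhs_ballP[r r0 rS].
exists (r ^+ 2); first by rewrite exprn_gt0.
move=> w wr; rewrite distrC; apply: rS; split=> // i j.
rewrite (ord1 i) -ball_normE /ball_/= distrC.
rewrite -(@ltr_pXn2r _ 2)// ?nnegrE ?ltW//.
by apply: le_lt_trans wr; have := enorm_coord (w - w0) j; rewrite !mxE.
Qed.

(** Since the kernel has mass 1, the error is the integral of (S - S w0) times the kernel: near w0
    it is small by continuity, elsewhere by [heat_tail] it is at most c k times a fixed finite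
    integral [M]. *)
Lemma heat_approximate_identity :
  Rn_integral (fun w => S w * heat k.+1%:R^-1 (w - w0)) @[k --> \oo] --> S w0.
Proof.
have e0 k : 0 < k.+1%:R^-1 :> R by rewrite invr_gt0.
have ih u : 0 < u -> (nu n).-integrable setT (EFin \o (fun t => heat u (row_of_tuple t - w0))).
  by move=> u0; have [+ _ _] := heat_dual 0 w0 u0.
have Ih u : 0 < u -> \int[nu n]_t heat u (row_of_tuple t - w0) = 1.
  by move=> u0; have [_ _] := heat_dual 0 w0 u0.
have iS' u : 0 < u -> (nu n).-integrable setT
    (EFin \o (fun t => S (row_of_tuple t) * heat u (row_of_tuple t - w0))).
  by move=> u0; exact: iS.
pose D u (t : n.-tuple (measurableTypeR R)) :=
  (S (row_of_tuple t) - S w0) * heat u (row_of_tuple t - w0).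
have iD u : 0 < u -> (nu n).-integrable setT (EFin \o D u).
  move=> u0; have := integrable_sub measurableT (iS' u u0)
    (integrable_scale (S w0) measurableT (ih u u0)).
  by apply: integrable_eqf => // t _; rewrite /D mulrBl.
have iDn u : 0 < u -> (nu n).-integrable setT (EFin \o (fun t => `|D u t|)).
  by move=> u0; exact: (integrable_norm (iD u u0)).
pose M := \int[nu n]_t `|D 1 t|.
apply/cvgrPdist_le => e ep.
have e20 : 0 < e / 2 by rewrite divr_gt0.
have [d d0 Hd] := near_dot e20.
have [c c0 [cge0 Hc]] := heat_tail n d0.
have cM : c k * M @[k --> \oo] --> 0.
  by rewrite -(mul0r M); apply: cvgM => //; exact: cvg_cst.
move/cvgrPdist_le : cM => /(_ _ e20) cM.
near=> k.
have -> : S w0 = \int[nu n]_t (S w0 * heat k.+1%:R^-1 (row_of_tuple t - w0)).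
  by rewrite RintegralZl// ?Ih ?mulr1//; exact: ih.
rewrite distrC /Rn_integral -RintegralB//; [|exact: iS'|exact/integrable_scale/ih].
have -> : \int[nu n]_x (((fun w => S w * heat k.+1%:R^-1 (w - w0)) \o @row_of_tuple R n) x -
  S w0 * heat k.+1%:R^-1 (row_of_tuple x - w0)) = \int[nu n]_t D k.+1%:R^-1 t.
  by apply: eq_Rintegral => t _; rewrite /D mulrBl.
pose G t := e / 2 * heat k.+1%:R^-1 (row_of_tuple t - w0) + c k * `|D 1 t|.
have iG : (nu n).-integrable setT (EFin \o G).
  apply: integrable_add => //; apply: integrable_scale => //; [exact: ih|exact: iDn].
apply: (@le_trans _ _ (\int[nu n]_t G t)).
  apply: le_normr_Rintegral_dom => //; first exact: integrable_meas (iD _ (e0 k)).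
  move=> t _; rewrite /G /D !(normrM (S (row_of_tuple t) - S w0)) !(ger0_norm (heat_ge0 _ _)).
  set w := row_of_tuple t.
  have [wd|wd] := ltP (dot (w - w0) (w - w0)) d.
    apply: (@le_trans _ _ (e / 2 * heat k.+1%:R^-1 (w - w0))).
      by apply: ler_wpM2r; [exact: heat_ge0|exact: Hd].
    rewrite lerDl; apply: mulr_ge0; first exact: cge0.
    by apply: mulr_ge0; [exact: normr_ge0|exact: heat_ge0].
  apply: (@le_trans _ _ (`|S w - S w0| * (c k * heat 1 (w - w0)))).
    by apply: ler_wpM2l => //; exact: Hc.
  rewrite mulrCA lerDr; apply: mulr_ge0; first exact: ltW.
  exact: heat_ge0.
rewrite RintegralD//; [|exact/integrable_scale/ih|exact/integrable_scale/iDn].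
rewrite (RintegralZl _ _ (ih _ (e0 k)))// (RintegralZl _ _ (iDn _ ltr01))//.
rewrite Ih// mulr1 [leRHS](splitr e) lerD// -/M.
near: k; apply: filterS cM => k h; apply: le_trans h.
rewrite sub0r normrN; exact: ler_norm.
Unshelve. all: end_near. Qed.

End approximate_identity.

(** * Gaussians are Schwartz functions *)

Section gauss_schwartz.
Context {R : realType} (n : nat).
Variables (a : 'rV[R]_n) (c : R).
Hypothesis c0 : 0 < c.

(** Polynomial functions of the coordinates, centered at [a]. The class is stable under directional
    derivatives, so every iterated partial derivative of a Gaussian is a member of it times the
    Gaussian. *)
Inductive coordpoly : ('rV[R]_n -> R) -> Prop :=
  | cp_cst e : coordpoly (fun=> e)
  | cp_coord i : coordpoly (fun x => x 0 i - a 0 i)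
  | cp_add f g : coordpoly f -> coordpoly g -> coordpoly (fun x => f x + g x)
  | cp_mul f g : coordpoly f -> coordpoly g -> coordpoly (fun x => f x * g x).

Lemma cp_sum m (F : 'I_m -> 'rV[R]_n -> R) : (forall i, coordpoly (F i)) ->
  coordpoly (fun x => \sum_i F i x).
Proof.
elim: m F => [|m IH] F cF.
  rewrite (_ : (fun x => _) = (fun=> 0)); first exact: cp_cst.
  by apply/funext => x; rewrite big_ord0.
rewrite (_ : (fun x => _) = (fun x => F ord0 x + \sum_i F (lift ord0 i) x)).
  by apply: cp_add; [exact: cF|exact: IH].
by apply/funext => x; rewrite big_ord_recl.
Qed.

Lemma coordpoly_differentiable f x : coordpoly f -> differentiable f x.
Proof.
elim=> [e|i|g h _ dg _ dh|g h _ dg _ dh].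
- exact: differentiable_cst.
- apply: differentiableB; first exact: differentiable_coord.
  exact: differentiable_cst.
- exact: differentiableD.
- exact: differentiableM.
Qed.

Lemma derive_coord (v x : 'rV[R]_n) i :
  is_derive x v (fun y : 'rV[R]_n => y 0 i - a 0 i) (v 0 i).
Proof.
apply: DeriveDef.
  by apply: diff_derivable; apply: coordpoly_differentiable; exact: cp_coord.
rewrite /derive; apply: cvg_lim => //.
apply: cvg_near_cst; near=> h.
rewrite /= !mxE opprB addrA subrK addrK scalerA mulVf ?scale1r//.
near: h; exact: nbhs_dnbhs_neq.
Unshelve. all: end_near. Qed.

Lemma coordpoly_derive f v : coordpoly f ->
  exists2 g, coordpoly g & forall x, is_derive x v f (g x).
Proof.
elim=> [e|i|g h _ [dg cdg Hg] _ [dh cdh Hh]|g h cg [dg cdg Hg] ch [dh cdh Hh]].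
- by exists (fun=> 0); [exact: cp_cst|move=> x; exact: is_derive_cst].
- by exists (fun=> v 0 i); [exact: cp_cst|move=> x; exact: derive_coord].
- exists (fun x => dg x + dh x); first exact: cp_add.
  by move=> x; exact: is_deriveD.
- exists (fun x => g x * dh x + h x * dg x).
    by apply: cp_add; exact: cp_mul.
  by move=> x; exact: is_deriveM.
Qed.

Let q (x : 'rV[R]_n) := dot (x - a) (x - a).

Lemma cp_q : coordpoly (fun x => - (c * q x)).
Proof.
have -> : (fun x : 'rV[R]_n => - (c * q x)) =
    (fun x : 'rV[R]_n => (- c) * \sum_i (x 0 i - a 0 i) * (x 0 i - a 0 i)).
  apply/funext => x; rewrite mulNr; congr (- (_ * _)); apply: eq_bigr => i _.
  by rewrite !mxE.
apply: cp_mul; first exact: cp_cst.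
by apply: cp_sum => i; apply: cp_mul; exact: cp_coord.
Qed.

Let G (x : 'rV[R]_n) := expR (- (c * q x)).

Lemma is_derive_expR_comp (f : 'rV[R]_n -> R) x v df : differentiable f x ->
  is_derive x v f df -> is_derive x v (fun y => expR (f y)) (expR (f x) * df).
Proof.
move=> dfx [_ <-].
have de : differentiable (@expR R) (f x) by exact/derivable1_diffP.
have dc : differentiable (@expR R \o f) x by exact: differentiable_comp.
apply: DeriveDef; first exact: diff_derivable.
rewrite -[LHS]/('D_v (@expR R \o f) x) deriveE// diff_comp//= (diff1E de)/=.
rewrite -(deriveE _ dfx) derive1E (_ : 'D_1 expR (f x) = expR (f x)); last first.
  by have [_] := is_derive_expR (f x).
by rewrite /GRing.scale/= mulrC.
Qed.

Lemma differentiable_G x : differentiable G x.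
Proof.
apply: (@differentiable_comp _ _ _ _ (fun x => - (c * q x)) expR).
  by apply: coordpoly_differentiable; exact: cp_q.
exact/derivable1_diffP.
Qed.

Lemma partials_gauss (A : R) (s : seq 'I_n) : exists2 p, coordpoly p &
  partials s (fun x => A * G x) = (fun x => p x * G x).
Proof.
elim: s => [|i s [p cp ps]]; first by exists (fun=> A); [exact: cp_cst|].
pose v : 'rV[R]_n := delta_mx 0 i.
have [dp cdp Hp] := coordpoly_derive v cp.
have [dq cdq Hq] := coordpoly_derive v cp_q.
exists (fun x => p x * dq x + dp x); first by apply: cp_add => //; exact: cp_mul.
rewrite /= ps; apply/funext => x.
have dG : is_derive x v G (G x * dq x).
  by apply: is_derive_expR_comp => //; apply: coordpoly_differentiable; exact: cp_q.
have [_ ->] := is_deriveM (Hp x) dG.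
by rewrite /GRing.scale/=; ring.
Qed.

Lemma q_ge0 x : 0 <= q x. Proof. exact: dotxx_ge0. Qed.

Lemma coordpoly_bnd p : coordpoly p ->
  exists K m, 0 <= K /\ forall x, `|p x| <= K * (1 + q x) ^+ m.
Proof.
have q1 x : 1 <= 1 + q x by rewrite lerDl q_ge0.
elim=> [e|i|g h _ [K [m [K0 Hg]]] _ [L [l [L0 Hh]]]|g h _ [K [m [K0 Hg]]] _ [L [l [L0 Hh]]]].
- by exists `|e|, 0%N; split=> // x; rewrite expr0 mulr1.
- exists 1, 1%N; split=> // x; rewrite mul1r expr1.
  have := enorm_coord (x - a) i; rewrite -/(q x) !mxE.
  set z := `|_| => zq; have z0 : 0 <= z by exact: normr_ge0.
  by have := sqr_ge0 (z - 1); have := sqr_ge0 z; lra.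
- exists (K + L), (m + l)%N; split=> [|x]; first exact: addr_ge0.
  rewrite (le_trans (ler_normD _ _))// mulrDl lerD//.
    rewrite (le_trans (Hg x))// ler_wpM2l// ler_weXn2l ?leq_addr//.
  by rewrite (le_trans (Hh x))// ler_wpM2l// ler_weXn2l ?leq_addl.
- exists (K * L), (m + l)%N; split=> [|x]; first exact: mulr_ge0.
  rewrite normrM exprD mulrACA ler_pM//.
Qed.

Lemma enorm_le x : enorm x <= (2 + 2 * dot a a) * (1 + q x).
Proof.
have aa := dotxx_ge0 a; have qq := q_ge0 x.
have h : dot x x <= 2 * q x + 2 * dot a a.
  rewrite /q /dot !mulr_sumr -big_split/= ler_sum// => i _; rewrite !mxE.
  have := sqr_ge0 (x 0 i - 2 * a 0 i); lra.
have := sqr_ge0 (enorm x - 1); rewrite sqrrB1 enorm_sqr.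
have : 0 <= dot a a * q x by exact: mulr_ge0.
by have := sqr_ge0 (enorm x); rewrite enorm_sqr; lra.
Qed.

Lemma gauss_schwartz (A : R) :
  schwartz (fun x : 'rV[R]_n => A * expR (- (c * dot (x - a) (x - a)))).
Proof.
split=> [s x|s k].
  have [p cp ->] := partials_gauss A s.
  apply: differentiableM; first exact: coordpoly_differentiable.
  exact: differentiable_G.
have [p cp ->] := partials_gauss A s.
have [K [m [K0 HK]]] := coordpoly_bnd cp.
(* Norm and polynomial are both measured by powers of 1 + q, of total degree k + m, which e^(-c (1 +
   q)) absorbs; e^c compensates for the added 1. *)
have [L L0 HL] := @powR_expRN_bndM _ (k + m)%:R c (ler0n _ _) c0.
have B0 : 0 <= 2 + 2 * dot a a by rewrite addr_ge0// mulr_ge0// dotxx_ge0.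
exists ((2 + 2 * dot a a) ^+ k * K * (L * expR c)) => x.
have q1 : 0 < 1 + q x by rewrite ltr_pwDl// q_ge0.
rewrite normrM (ger0_norm (expR_ge0 _)).
apply: (@le_trans _ _ (((2 + 2 * dot a a) * (1 + q x)) ^+ k * (K * (1 + q x) ^+ m * G x))).
  rewrite ler_pM ?exprn_ge0 ?sqrtr_ge0 ?mulr_ge0 ?expR_ge0//.
    by rewrite lerXn2r ?nnegrE ?sqrtr_ge0 ?enorm_le// mulr_ge0// ltW.
  by rewrite ler_wpM2r ?expR_ge0.
have := HL _ q1; rewrite (powR_mulrn _ (ltW q1)) => h.
rewrite exprMn.
have -> : G x = expR (- (c * (1 + q x))) * expR c.
  by rewrite -expRD /G; congr expR; ring.
rewrite [leLHS](_ : _ = (2 + 2 * dot a a) ^+ k * K *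
  ((1 + q x) ^+ (k + m) * expR (- (c * (1 + q x))) * expR c)); last first.
  by rewrite exprD; ring.
rewrite ler_wpM2l ?mulr_ge0 ?exprn_ge0// ler_wpM2r ?expR_ge0//.
Qed.

End gauss_schwartz.

(** * Spectral densities of mixtures of Gaussians *)

Lemma normr_cosM_le {R : realType} (x y : R) : 0 <= y -> `|cos x * y| <= y.
Proof. by move=> y0; rewrite normrM (ger0_norm y0) ler_piMl// cos_max. Qed.

Section spectral_mixture.
Context {R : realType}.
Notation mu := (@lebesgue_measure R).
Notation pos := (`]0%R, +oo[%classic : set R).
Notation nu n := (@lebesgue_tuple R n).
Notation T := (measurableTypeR R).
Variables (n : nat) (C S : 'rV[R]_n -> R) (g : R -> R) (w0 : 'rV[R]_n).
Hypothesis gi : mu.-integrable pos (EFin \o g).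
Hypothesis CE : forall t, C t = \int[mu]_(u in pos) (expR (- (u * dot t t)) * g u).
Hypothesis w00 : w0 != 0.

Let mpos : measurable (pos : set T). Proof. exact: measurable_itv. Qed.

Let ng : mu.-integrable pos (EFin \o (fun u => `|g u|)).
Proof. exact: integrable_norm. Qed.

Lemma integrable_heat_mix eps : 0 <= eps ->
  mu.-integrable pos (EFin \o (fun u => g u * heat (u + eps) w0)).
Proof.
move=> eps0; have [K K0 HK] := heat_bnd w00.
apply: (integrable_le _ _ _ (integrable_scale K _ ng)) => //.
  apply: measurable_funM; first exact: integrable_meas gi.
  apply: measurable_pos_cont => u u0.
  apply: (@continuous_comp _ _ _ (fun u => u + eps) (fun u => heat u w0)).
    by dercont.
  by apply: cont_heat; rewrite ltr_pwDl.
move=> u /pos_lt0 u0; rewrite (normrM (g u)) (ger0_norm (heat_ge0 _ _)) mulrC.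
by apply: ler_wpM2r => //; apply: HK; rewrite ltr_pwDl.
Qed.

(** The Fourier integral of C at w0, regularized by a Gaussian. As C is bounded by the integral of
    |g|, it converges absolutely whether or not C is integrable. In each sense of spectral density,
    S w0 is its limit as eps tends to 0. *)
Let Teps eps := ((2 * pi) ^+ n)^-1 *
  Rn_integral (fun t => cos (dot w0 t) * (C t * expR (- (eps * dot t t)))).

(** The regularizing Gaussian multiplies e^(-u |t|^2) into e^(-(u + eps) |t|^2), whose transform is
    a heat kernel; Fubini is justified by the regularization. *)
Lemma Teps_heat eps : 0 < eps ->
  Teps eps = \int[mu]_(u in pos) (g u * heat (u + eps) w0).
Proof.
move=> e0.
pose c1 (t : n.-tuple T) := cos (dot w0 (row_of_tuple t)) * expR (- (eps * dot (row_of_tuple t) (row_of_tuple t))).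
pose e2 (t : n.-tuple T) u := expR (- (u * dot (row_of_tuple t) (row_of_tuple t))).
pose F t u := c1 t * (e2 t u * g u).
have mcos : measurable_fun setT (fun t : n.-tuple T => cos (dot w0 (row_of_tuple t))).
  exact: (measurableT_comp (continuous_measurable_fun (@continuous_cos R)) (measurable_dotl w0)).
have ie : (nu n).-integrable setT (EFin \o (fun t => expR (- (eps * dot (row_of_tuple t) (row_of_tuple t))))).
  exact: integrable_gauss.
have mc1 : measurable_fun setT c1.
  by apply: measurable_funM => //; exact: integrable_meas ie.
have e2_le1 t u : 0 < u -> e2 t u <= 1.
  by move=> u0; rewrite /e2 expR_le1 oppr_le0 mulr_ge0 ?dotxx_ge0// ltW.
have ie2 t : mu.-integrable pos (EFin \o (fun u => e2 t u * g u)).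
  apply: (integrable_le _ _ _ ng) => //.
    apply: measurable_funM; last exact: integrable_meas gi.
    by apply: measurable_pos_cont => u u0; rewrite /e2; dercont.
  move=> u /pos_lt0 u0; rewrite normrM ger0_norm ?expR_ge0//.
  by rewrite ler_piMl// e2_le1.
have iF : (nu n \x mu)%E.-integrable ([set: n.-tuple T] `*` pos) (fun z => (F z.1 z.2)%:E).
  apply: (integrable_prod_dom _ _ _ ie ng) => //.
    apply: measurable_funM; first exact: (measurable_fun_fst measurableT mc1).
    apply: measurable_funM; last exact: (measurable_fun_snd mpos (integrable_meas gi)).
    apply: measurableT_comp => //; apply: measurableT_comp => //.
    apply: measurable_funM.
      exact: (measurable_fun_snd mpos (g := id)).
    exact: (measurable_fun_fst measurableT (@measurable_dotsq R n)).
  move=> t u _ /pos_lt0 u0; rewrite /F /c1 !normrM.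
  rewrite (ger0_norm (expR_ge0 (- (eps * _)))) ler_pM ?mulr_ge0//.
    by rewrite ler_piMl ?expR_ge0// cos_max.
  by rewrite ler_piMl// ger0_norm ?expR_ge0// e2_le1.
rewrite /Teps.
have -> : Rn_integral (fun t => cos (dot w0 t) * (C t * expR (- (eps * dot t t)))) =
    \int[nu n]_t \int[mu]_(u in pos) F t u.
  apply: eq_Rintegral => t _ /=; rewrite CE /F RintegralZl// /c1 /e2.
  by rewrite -mulrA [X in _ = _ * X]mulrC.
rewrite (Rintegral_Fubini measurableT mpos iF).
have -> : \int[mu]_(u in pos) \int[nu n]_t F t u =
    \int[mu]_(u in pos) ((2 * pi) ^+ n * (g u * heat (u + eps) w0)).
  apply: eq_Rintegral => u; rewrite inE => /pos_lt0 u0.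
  have ue0 : 0 < u + eps by rewrite addr_gt0.
  rewrite -(heat_fourier _ ue0) mulrCA mulVKf ?gt_eqF ?twopi_gt0//.
  rewrite -RintegralZl//.
    apply: eq_Rintegral => t _ /=; rewrite /F /c1 /e2 mulrDl opprD expRD.
    by ring.
  apply: (integrable_le _ _ _ (integrable_gauss n ue0)) => //.
    apply: measurable_funM => //; exact: integrable_meas (integrable_gauss n ue0).
  by move=> t _ /=; rewrite normrM (ger0_norm (expR_ge0 _)) ler_piMl ?expR_ge0// cos_max.
by rewrite RintegralZl ?mulKf ?gt_eqF ?twopi_gt0//; exact/integrable_heat_mix/ltW.
Qed.

Lemma Teps_cvg_mix :
  Teps k.+1%:R^-1 @[k --> \oo] --> \int[mu]_(u in pos) (g u * heat u w0).
Proof.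
have -> : (fun k => Teps k.+1%:R^-1) =
    (fun k => \int[mu]_(u in pos) (g u * heat (u + k.+1%:R^-1) w0)).
  by apply/funext => k; rewrite Teps_heat// invr_gt0.
have [K K0 HK] := heat_bnd w00.
have [] := @Rdominated_cvg _ _ _ mu pos (fun k u => g u * heat (u + k.+1%:R^-1) w0)
  (fun u => g u * heat u w0) (fun u => K * `|g u|) mpos _ _ _ _ => //.
- move=> k; apply: (integrable_meas (m := mu)); apply: integrable_heat_mix.
  by rewrite invr_ge0.
- move=> u /pos_lt0 u0; apply: cvgM; first exact: cvg_cst.
  have h : (u + k.+1%:R^-1 : R) @[k --> \oo] --> u + 0.
    by apply: cvgD; [exact: cvg_cst|exact: cvg_harmonic].
  rewrite addr0 in h.
  exact: (cvg_comp (fun k : nat => u + k.+1%:R^-1) (fun v => heat v w0) h (cont_heat u0)).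
- exact: integrable_scale.
- move=> k u /pos_lt0 u0; rewrite (normrM (g u)) (ger0_norm (heat_ge0 _ _)) mulrC.
  by apply: ler_wpM2r => //; apply: HK; rewrite ltr_pwDl.
Qed.

Lemma fourier_integral_mix : Rn_integrable C -> fourier_integral C S ->
  S w0 = \int[mu]_(u in pos) (g u * heat u w0).
Proof.
move=> iC /(_ w0 w00)[-> _]; apply/esym; apply: (cvg_unique _ Teps_cvg_mix) => //.
apply: cvgM; first exact: cvg_cst.
have mC := integrable_meas iC.
have mcos : measurable_fun setT (fun t : n.-tuple T => cos (dot w0 (row_of_tuple t))).
  exact: (measurableT_comp (continuous_measurable_fun (@continuous_cos R)) (measurable_dotl w0)).
have [] := @Rdominated_cvg _ _ _ (nu n) setT
  (fun k t => cos (dot w0 (row_of_tuple t)) * (C (row_of_tuple t) *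
     expR (- (k.+1%:R^-1 * dot (row_of_tuple t) (row_of_tuple t)))))
  (fun t => cos (dot w0 (row_of_tuple t)) * C (row_of_tuple t))
  (fun t => `|C (row_of_tuple t)|) measurableT _ _ _ _ => //.
- move=> k; apply: measurable_funM => //; apply: measurable_funM => //.
  by apply: (integrable_meas (m := nu n)); apply: integrable_gauss; rewrite invr_gt0.
- move=> t _; apply: cvgM; first exact: cvg_cst.
  set q := dot (row_of_tuple t) (row_of_tuple t).
  have h : (- (k.+1%:R^-1 * q) : R) @[k --> \oo] --> - (0 * q).
    by apply: cvgN; apply: cvgM; [exact: cvg_harmonic|exact: cvg_cst].
  rewrite mul0r oppr0 in h.
  have := cvg_comp _ (@expR R) h (@continuous_expR R (0 : R)); rewrite expR0 => h'.
  have h2 : (C (row_of_tuple t) * expR (- (k.+1%:R^-1 * q)) : R) @[k --> \oo] -->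
      C (row_of_tuple t) * 1 by apply: cvgM; [exact: cvg_cst|exact: h'].
  rewrite mulr1 in h2; exact: h2.
- exact: integrable_norm.
- move=> k t _; rewrite !normrM (ger0_norm (expR_ge0 _)).
  rewrite (@le_trans _ _ (1 * (`|C (row_of_tuple t)| * 1)))//; last by rewrite mulr1 mul1r.
  rewrite ler_pM ?mulr_ge0 ?expR_ge0 ?cos_max// ler_wpM2l//.
  by rewrite expR_le1 oppr_le0 mulr_ge0 ?dotxx_ge0// invr_ge0.
Qed.

(** The test function is the heat kernel centered at w0. On the side of C it becomes cos(w0.t)
    e^(-eps |t|^2), which gives the regularized integral; on the side of S it is an approximate
    identity. *)
Lemma generalized_fourier_mix : {for w0, continuous S} -> generalized_fourier C S ->
  S w0 = \int[mu]_(u in pos) (g u * heat u w0).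
Proof.
move=> cS gS.
have sch u : 0 < u -> schwartz (fun w : 'rV[R]_n => heat u (w - w0)).
  move=> u0; have c0 : 0 < (4 * u)^-1 by rewrite invr_gt0 mulr_gt0.
  have := gauss_schwartz w0 c0 (((2 * pi) ^+ n)^-1 * Num.sqrt (pi / u) ^+ n).
  congr schwartz; apply/funext => w.
  by rewrite /heat -mulrA (mulrC _^-1 (dot _ _)).
have iS u : 0 < u -> Rn_integrable (fun w => S w * heat u (w - w0)).
  by move=> u0; have [] := gS _ (sch u u0).
have := heat_approximate_identity cS iS.
move/cvg_unique; apply => //.
rewrite (_ : (fun k => _) = (fun k => Teps k.+1%:R^-1)); first exact: Teps_cvg_mix.
apply/funext => k; have e0 : 0 < k.+1%:R^-1 :> R by rewrite invr_gt0.
have [_ -> _] := gS _ (sch _ e0); congr (_ * _).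
apply: eq_Rintegral => t _ /=.
have [_ + _] := heat_dual (row_of_tuple t) w0 e0.
rewrite /cos_transform => ->.
by rewrite (dotC w0) mulrCA.
Qed.

(** Writing the heat kernel as a Fourier integral over t and exchanging the integrals, the integral
    over w becomes the inverse transform of S at t, that is C(t). The term with sin(w0.t) drops out
    because the sine transform of S is 0. *)
Lemma inverse_fourier_mix : {for w0, continuous S} -> inverse_fourier C S ->
  S w0 = \int[mu]_(u in pos) (g u * heat u w0).
Proof.
move=> cS [iS CS].
have mS := integrable_meas iS.
have iSh u : 0 < u -> Rn_integrable (fun w => S w * heat u (w - w0)).
  move=> u0.
  pose A : R := ((2 * pi) ^+ n)^-1 * Num.sqrt (pi / u) ^+ n.
  have A0 : 0 <= A.
    by rewrite /A mulr_ge0 ?invr_ge0 ?exprn_ge0 ?sqrtr_ge0// mulr_ge0// pi_ge0.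
  apply: (integrable_le _ _ _ (integrable_scale A _ (integrable_norm iS))) => //.
    apply: measurable_funM => //.
    have [ih _ _] := heat_dual 0 w0 u0; exact: integrable_meas ih.
  move=> t _; rewrite (normrM (S _)) (ger0_norm (heat_ge0 _ _)) mulrC.
  apply: ler_wpM2r => //; rewrite /heat mulrA -/A ler_piMr//.
  by rewrite expR_le1 oppr_le0 divr_ge0 ?dotxx_ge0// mulr_ge0// ltW.
have := heat_approximate_identity cS iSh.
move/cvg_unique; apply => //.
rewrite (_ : (fun k => _) = (fun k => Teps k.+1%:R^-1)); first exact: Teps_cvg_mix.
apply/funext => k; have e0 : 0 < k.+1%:R^-1 :> R by rewrite invr_gt0.
move: (k.+1%:R^-1) e0 => eps e0.
pose G (t : n.-tuple T) := expR (- (eps * dot (row_of_tuple t) (row_of_tuple t))).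
have iG : (nu n).-integrable setT (EFin \o G) by exact: integrable_gauss.
pose F (w t : n.-tuple T) := S (row_of_tuple w) * (cos (dot (row_of_tuple w - w0) (row_of_tuple t)) * G t).
have msnd (f : n.-tuple T -> R) : measurable_fun setT f ->
    measurable_fun [set: n.-tuple T * n.-tuple T] (fun z => f z.2).
  by move=> mf; apply: measurableT_comp.
have mfst (f : n.-tuple T -> R) : measurable_fun setT f ->
    measurable_fun [set: n.-tuple T * n.-tuple T] (fun z => f z.1).
  by move=> mf; apply: measurableT_comp.
have mdot : measurable_fun [set: n.-tuple T * n.-tuple T]
    (fun z => dot (row_of_tuple z.1 - w0) (row_of_tuple z.2)).
  apply: measurable_dot => i.
    apply: (mfst (fun w => (row_of_tuple w - w0) 0 i)).
    under eq_fun do rewrite !mxE.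
    by apply: measurable_funB => //; exact: measurable_tnth.
  apply: (msnd (fun w => (row_of_tuple w) 0 i)); exact: measurable_coord.
have mF : measurable_fun ([set: n.-tuple T] `*` [set: n.-tuple T]) (fun z => F z.1 z.2).
  rewrite setXTT; apply: measurable_funM; first exact: (mfst (S \o @row_of_tuple R n)).
  apply: measurable_funM; last by apply: msnd; exact: integrable_meas iG.
  exact: (measurableT_comp (continuous_measurable_fun (@continuous_cos R)) mdot).
have iF : (nu n \x nu n)%E.-integrable ([set: n.-tuple T] `*` [set: n.-tuple T]) (fun z => (F z.1 z.2)%:E).
  apply: (integrable_prod_dom measurableT measurableT mF (integrable_norm iS) iG).
  move=> w t _ _; rewrite /F !normrM ler_wpM2l//.
  by rewrite (ger0_norm (expR_ge0 _)) ler_piMl ?expR_ge0// cos_max.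
have FF := Rintegral_Fubini measurableT measurableT iF.
transitivity (((2 * pi) ^+ n)^-1 * \int[nu n]_w \int[nu n]_t F w t).
  transitivity (\int[nu n]_w (((2 * pi) ^+ n)^-1 * \int[nu n]_t F w t)); last first.
    exact: (RintegralZl _ measurableT (integrable_Rintegral1 measurableT measurableT iF)).
  apply: eq_Rintegral => w _.
  have -> : \int[nu n]_t F w t = S (row_of_tuple w) *
      Rn_integral (fun t => cos (dot (row_of_tuple w - w0) t) * expR (- (eps * dot t t))).
    apply: (RintegralZl (S (row_of_tuple w)) measurableT _).
    have mc : measurable_fun [set: n.-tuple T]
        (fun t => cos (dot (row_of_tuple w - w0) (row_of_tuple t)) * G t).
      apply: measurable_funM; last exact: integrable_meas iG.
      exact: (measurableT_comp (continuous_measurable_fun (@continuous_cos R)) (measurable_dotl _)).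
    have bc t : [set: n.-tuple T] t ->
        `|cos (dot (row_of_tuple w - w0) (row_of_tuple t)) * G t| <= G t.
      by move=> _; apply: normr_cosM_le; exact: expR_ge0.
    exact: (integrable_le measurableT mc bc iG).
  by rewrite -(heat_fourier (row_of_tuple w - w0) e0) mulrCA.
rewrite FF; congr (_ * _); apply: eq_Rintegral => t _ /=.
have iSr (r : R -> R) : continuous r -> (forall x, `|r x| <= 1) ->
    (nu n).-integrable setT (EFin \o (fun w => r (dot (row_of_tuple t) (row_of_tuple w)) * S (row_of_tuple w))).
  move=> cr r1; apply: (integrable_le measurableT _ _ (integrable_norm iS)).
    apply: measurable_funM; last exact: mS.
    exact: (measurableT_comp (continuous_measurable_fun cr) (measurable_dotl _)).
  by move=> w _; rewrite (normrM (r _)) ler_piMl.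
have i1 := iSr cos (@continuous_cos R) (@cos_max R).
have i2 := iSr sin (@continuous_sin R) (@sin_max R).
have [Ct St] := CS (row_of_tuple t).
transitivity (G t * (cos (dot w0 (row_of_tuple t)) * cos_transform S (row_of_tuple t) +
    sin (dot w0 (row_of_tuple t)) * sin_transform S (row_of_tuple t))).
  set a := dot w0 (row_of_tuple t).
  have j1 := integrable_scale (cos a) measurableT i1.
  have j2 := integrable_scale (sin a) measurableT i2.
  have Z1 := RintegralZl (cos a) measurableT i1.
  have Z2 := RintegralZl (sin a) measurableT i2.
  have D := RintegralD measurableT j1 j2.
  have Z := RintegralZl (G t) measurableT (integrable_add measurableT j1 j2).
  refine (etrans _ (etrans Z (congr1 (fun z => G t * z) (etrans D (f_equal2 +%R Z1 Z2))))).
  by apply: eq_Rintegral => w _; rewrite /F dotBl cosB (dotC (row_of_tuple w)) /a; ring.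
rewrite -St -Ct mulr0 addr0 /G.
by rewrite mulrC -mulrA.
Qed.

Theorem spectral_density_mix : spectral_density C S ->
  S w0 = \int[mu]_(u in pos) (g u * heat u w0).
Proof.
case=> [[iC fS]|[_ cS gS]|[cS iS]].
- exact: fourier_integral_mix.
- by apply: generalized_fourier_mix => //; exact: cS.
- by apply: inverse_fourier_mix => //; exact: cS.
Qed.

End spectral_mixture.

(** * A Stieltjes representation of (1 + x^g)^(-s) *)

Section polar.
Context {R : realType}.
Implicit Types (y eta s r k : R).

(** Squared modulus and argument of 1 + y e^(2 i eta), read off from its factorization e^(i eta) ((1
    + y) cos eta + i (y - 1) sin eta). With the half angle the second factor has positive real part,
    so [atan] gives a smooth argument and no branch has to be chosen. *)
Definition psqr y eta : R := (1 + y) ^+ 2 * cos eta ^+ 2 + (y - 1) ^+ 2 * sin eta ^+ 2.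
Definition parg y eta : R := eta + atan ((y - 1) / (y + 1) * tan eta).

(* [(1 + y e^(2 i eta))^(-s)], for [y >= 0] and [|eta| < pi/2], is
   [pcos s y eta - i psin s y eta]. *)
Definition pcos s y eta : R := psqr y eta `^ (- (s / 2)) * cos (s * parg y eta).
Definition psin s y eta : R := psqr y eta `^ (- (s / 2)) * sin (s * parg y eta).

Lemma sin2E eta : sin (2 * eta) = 2 * sin eta * cos eta.
Proof. by rewrite mulr_natl sin_mulr2n -mulr_natl; ring. Qed.

Lemma cos2E eta : cos (2 * eta) = cos eta ^+ 2 - sin eta ^+ 2.
Proof. by rewrite mulr_natl cos_mulr2n -mulr_natl sin2cos2; ring. Qed.

Lemma psqr_ge y eta : 0 <= y -> (cos eta * (1 + y)) ^+ 2 <= psqr y eta.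
Proof.
move=> y0; rewrite /psqr exprMn mulrC lerDl mulr_ge0 ?sqr_ge0//.
Qed.

Lemma psqr_gt0 y eta : 0 <= y -> 0 < cos eta -> 0 < psqr y eta.
Proof.
move=> y0 c0; apply: lt_le_trans (psqr_ge eta y0).
by rewrite exprn_gt0// mulr_gt0// ltr_pwDl.
Qed.

Lemma psqr0 eta : psqr 0 eta = 1.
Proof. by rewrite /psqr addr0 sub0r sqrrN expr1n !mul1r cos2Dsin2. Qed.

Lemma parg0 eta : - (pi / 2) < eta < pi / 2 -> parg 0 eta = 0.
Proof.
move=> h; rewrite /parg sub0r add0r divr1 mulN1r atanN tanK ?subrr//.
Qed.

Lemma psqr_eta0 y : psqr y 0 = (1 + y) ^+ 2.
Proof. by rewrite /psqr cos0 sin0 expr1n mulr1 expr0n mulr0 addr0. Qed.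

Lemma parg_eta0 y : parg y 0 = 0.
Proof. by rewrite /parg tan0 mulr0 atan0 addr0. Qed.

Lemma pcos_eta0 s y : 0 <= y -> pcos s y 0 = (1 + y) `^ (- s).
Proof.
move=> y0; rewrite /pcos psqr_eta0 parg_eta0 mulr0 cos0 mulr1.
rewrite -(powR_mulrn 2 (addr_ge0 ler01 y0)) -powRrM mulrN mulrC divfK//.
Qed.

Lemma psin_eta0 s y : psin s y 0 = 0.
Proof. by rewrite /psin parg_eta0 mulr0 sin0 mulr0. Qed.

Section pos.
Variables (y eta : R).
Hypotheses (y0 : 0 <= y) (c0 : 0 < cos eta).

Let M := psqr y eta.
Let M0 : 0 < M. Proof. exact: psqr_gt0. Qed.
Let cn : cos eta != 0. Proof. by rewrite gt_eqF. Qed.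
Let y1 : y + 1 != 0. Proof. by rewrite gt_eqF// ltr_pwDr. Qed.

Let t := (y - 1) / (y + 1) * tan eta.

Let tE : 1 + t ^+ 2 = M / ((1 + y) * cos eta) ^+ 2.
Proof.
by rewrite /t /M /psqr /tan; field; rewrite cn [1 + y]addrC y1.
Qed.

Let cos_at : cos (atan t) = (1 + y) * cos eta / Num.sqrt M.
Proof.
rewrite cos_atan tE sqrtrM ?(ltW M0)// sqrtrV ?exprn_ge0//; last first.
  by rewrite mulr_ge0 ?ltW// ltr_pwDl.
rewrite sqrtr_sqr ger0_norm ?invfM ?invrK 1?mulrC//.
by rewrite mulr_ge0 ?ltW// ltr_pwDl.
Qed.

Let sin_at : sin (atan t) = (y - 1) * sin eta / Num.sqrt M.
Proof.
have ca : cos (atan t) != 0.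
  by rewrite cos_at mulf_neq0 ?mulf_neq0 ?invr_eq0 ?gt_eqF ?sqrtr_gt0// ltr_pwDl.
have : tan (atan t) * cos (atan t) = sin (atan t) by rewrite /tan mulfVK.
rewrite atanK => <-; rewrite cos_at /t /tan; field.
by rewrite cn y1 gt_eqF// sqrtr_gt0.
Qed.

Lemma cos_parg : Num.sqrt M * cos (parg y eta) = 1 + y * cos (2 * eta).
Proof.
have sM : Num.sqrt M != 0 by rewrite gt_eqF// sqrtr_gt0.
rewrite /parg -/t cosD cos_at sin_at cos2E.
rewrite (_ : Num.sqrt M * _ = (1 + y) * cos eta ^+ 2 - (y - 1) * sin eta ^+ 2); last by field.
by rewrite sin2cos2; ring.
Qed.

Lemma sin_parg : Num.sqrt M * sin (parg y eta) = y * sin (2 * eta).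
Proof.
have sM : Num.sqrt M != 0 by rewrite gt_eqF// sqrtr_gt0.
rewrite /parg -/t sinD cos_at sin_at sin2E.
by field.
Qed.

Lemma der_parg_eta : is_derive eta 1 (parg y) (1 + (y ^+ 2 - 1) / M).
Proof.
rewrite /parg; dereq => //; rewrite -/t tE.
have := gt_eqF M0 => /negbT M0'.
by field; rewrite cn y1 M0'.
Qed.

Lemma der_parg_y : is_derive y 1 (parg ^~ eta) (sin (2 * eta) / M).
Proof.
rewrite /parg; dereq => //; rewrite -/t tE sin2E /tan.
have := gt_eqF M0 => /negbT M0'.
by field; rewrite cn y1 M0'.
Qed.

Lemma der_psqr_eta : is_derive eta 1 (psqr y) (- (4 * y * sin (2 * eta))).
Proof.
by rewrite /psqr; dereq => //=; rewrite sin2E !expr1; ring.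
Qed.

Lemma der_psqr_y : is_derive y 1 (psqr ^~ eta) (2 * (y + cos (2 * eta))).
Proof.
rewrite /psqr; dereq => //=; rewrite cos2E !expr1.
by rewrite sin2cos2; ring.
Qed.

Let powM s : M `^ (- (s / 2) - 1) = M `^ (- (s / 2)) / M.
Proof. by rewrite -powR_mulD// powR_inv1// ltW. Qed.

(** [pA + i pB] is y e^(2 i eta) / (1 + y e^(2 i eta)). Both d/d eta and y d/dy multiply (1 + y e^(2
    i eta))^(-s) by a constant times this quotient, which is the source of the polar Cauchy-Riemann
    equations. *)
Let pA := (y ^+ 2 + y * cos (2 * eta)) / M.
Let pB := y * sin (2 * eta) / M.

Let pAE : 1 + (y ^+ 2 - 1) / M = 2 * pA.
Proof.
have := gt_eqF M0 => /negbT M0'; rewrite /pA.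
apply: (mulIf M0'); rewrite mulrDl mul1r mulfVK// -mulrA mulfVK//.
rewrite /M /psqr cos2E sin2cos2; ring.
Qed.

Lemma der_pcos_eta s :
  is_derive eta 1 (pcos s y) (2 * s * (pB * pcos s y eta - pA * psin s y eta)).
Proof.
rewrite /pcos; notypeclasses refine (@der_eq _ _ _ _ _ _ _).
  der; [exact: M0|exact: der_psqr_eta|exact: der_parg_eta].
cbv beta; rewrite -/M powM pAE /pB /psin /pcos -/M.
by field; rewrite gt_eqF.
Qed.

Lemma der_psin_eta s :
  is_derive eta 1 (psin s y) (2 * s * (pB * psin s y eta + pA * pcos s y eta)).
Proof.
rewrite /psin; notypeclasses refine (@der_eq _ _ _ _ _ _ _).
  der; [exact: M0|exact: der_psqr_eta|exact: der_parg_eta].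
cbv beta; rewrite -/M powM pAE /pB /psin /pcos -/M.
by field; rewrite gt_eqF.
Qed.

Lemma der_pcos_y s : y * (- s * ((y + cos (2 * eta)) / M * pcos s y eta +
    sin (2 * eta) / M * psin s y eta)) = - s * (pA * pcos s y eta + pB * psin s y eta)
  /\ is_derive y 1 (fun y => pcos s y eta) (- s * ((y + cos (2 * eta)) / M * pcos s y eta +
    sin (2 * eta) / M * psin s y eta)).
Proof.
split; first by rewrite /pA /pB; ring.
rewrite /pcos; notypeclasses refine (@der_eq _ _ _ _ _ _ _).
  der; [exact: M0|exact: der_psqr_y|exact: der_parg_y].
cbv beta; rewrite -/M powM /psin /pcos -/M.
by field; rewrite gt_eqF.
Qed.

Lemma der_psin_y s : y * (- s * ((y + cos (2 * eta)) / M * psin s y eta -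
    sin (2 * eta) / M * pcos s y eta)) = - s * (pA * psin s y eta - pB * pcos s y eta)
  /\ is_derive y 1 (fun y => psin s y eta) (- s * ((y + cos (2 * eta)) / M * psin s y eta -
    sin (2 * eta) / M * pcos s y eta)).
Proof.
split; first by rewrite /pA /pB; ring.
rewrite /psin; notypeclasses refine (@der_eq _ _ _ _ _ _ _).
  der; [exact: M0|exact: der_psqr_y|exact: der_parg_y].
cbv beta; rewrite -/M powM /psin /pcos -/M.
by field; rewrite gt_eqF.
Qed.

Lemma psqr_powR_bnd s : 0 <= s -> M `^ (- (s / 2)) <= (cos eta * (1 + y)) `^ (- s).
Proof.
move=> s0; have cy0 : 0 < cos eta * (1 + y) by rewrite mulr_gt0// ltr_pwDl.
rewrite !powRN lef_pV2 ?posrE ?powR_gt0//.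
have -> : (cos eta * (1 + y)) `^ s = ((cos eta * (1 + y)) ^+ 2) `^ (s / 2).
  by rewrite -powR_mulrn ?(ltW cy0)// -powRrM; congr (_ `^ _); field.
apply: ge0_ler_powR; rewrite ?nnegrE ?sqr_ge0 ?(ltW M0) ?divr_ge0//.
exact: psqr_ge.
Qed.

Lemma pcos_bnd s : 0 <= s -> `|pcos s y eta| <= (cos eta * (1 + y)) `^ (- s).
Proof.
move=> s0; apply: le_trans (psqr_powR_bnd s0).
by rewrite normrM (ger0_norm (powR_ge0 _ _)) ler_piMr ?powR_ge0// cos_max.
Qed.

Lemma psin_bnd s : 0 <= s -> `|psin s y eta| <= (cos eta * (1 + y)) `^ (- s).
Proof.
move=> s0; apply: le_trans (psqr_powR_bnd s0).
by rewrite normrM (ger0_norm (powR_ge0 _ _)) ler_piMr ?powR_ge0// sin_max.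
Qed.

(* With [q = e^(2 i eta)], [- pshift s k] is the imaginary part of
   [q^k (1 + y q)^(-s)]: this family is stable under [d/dy] and contains
   [psin s = pshift s 0]. *)
Definition pshift s (k : nat) y eta : R :=
  psqr y eta `^ (- (s / 2)) * sin (s * parg y eta - 2 * k%:R * eta).

Lemma der_pshift s (k : nat) :
  is_derive y 1 (fun y => pshift s k y eta) (- s * pshift (s + 1) k.+1 y eta).
Proof.
rewrite /pshift; notypeclasses refine (@der_eq _ _ _ _ _ _ _).
  der; [exact: M0|exact: der_psqr_y|exact: der_parg_y].
cbv beta; rewrite -/M powM.
(* The phase increases by [parg y eta - 2 * eta], an argument of (1 + y q) / q = y + q^(-1), whose
   cosine and sine are known. *)
have -> : (s + 1) * parg y eta - 2 * k.+1%:R * eta =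
    (s * parg y eta - 2 * k%:R * eta) + (parg y eta - 2 * eta).
  by rewrite -natr1; ring.
set u := s * parg y eta - _.
have sM : Num.sqrt M != 0 by rewrite gt_eqF// sqrtr_gt0.
have c1 : cos (parg y eta - 2 * eta) = (y + cos (2 * eta)) / Num.sqrt M.
  apply: (mulfI sM); rewrite cosB mulrDr !mulrA cos_parg sin_parg [RHS]mulrAC divff// mul1r.
  have := cos2Dsin2 (2 * eta); set c := cos _; set z := sin _ => cz.
  by transitivity (c + y * (c ^+ 2 + z ^+ 2)); [ring|rewrite cz; ring].
have s1 : sin (parg y eta - 2 * eta) = - sin (2 * eta) / Num.sqrt M.
  apply: (mulfI sM); rewrite sinB mulrBr !mulrA cos_parg sin_parg [RHS]mulrAC divff// mul1r.
  by ring.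
rewrite (sinD u) c1 s1.
have -> : M `^ (- ((s + 1) / 2)) = M `^ (- (s / 2)) / Num.sqrt M.
  rewrite -powR12_sqrt ?(ltW M0)// -powRN powR_mulD//; congr (_ `^ _); by field.
have iM : M^-1 = Num.sqrt M ^- 2 by rewrite sqr_sqrtr// ltW.
by rewrite !iM; field.
Qed.

End pos.
End polar.

(** * Rotation of the ray of integration *)

Section rotation.
Context {R : realType}.
Notation mu := (@lebesgue_measure R).
Implicit Types (r th a b : R).
(** The range |th| < T extends beyond 0 and pi so that the derivatives there are two-sided; with T
    <= 2 pi the pole z = x is met, for 0 <= th < T, at th = 0 only. *)
Variables (N1 N2 s1 s2 : R -> R -> R) (x T : R) (B : R -> R).
Hypotheses (x0 : 0 < x) (piT : pi < T) (T2 : T <= 2 * pi).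
Hypothesis dth1 : forall r th, 0 < r -> - T < th < T -> is_derive th 1 (N1 r) (s1 r th).
Hypothesis dth2 : forall r th, 0 < r -> - T < th < T -> is_derive th 1 (N2 r) (s2 r th).
Hypothesis dr1 : forall r th, 0 < r -> - T < th < T ->
  is_derive r 1 (N1 ^~ th) (s2 r th / r).
Hypothesis dr2 : forall r th, 0 < r -> - T < th < T ->
  is_derive r 1 (N2 ^~ th) (- s1 r th / r).
Hypothesis cs1 : forall r th, 0 < r -> - T < th < T -> {for r, continuous (s1 ^~ th)}.
Hypothesis cs2 : forall r th, 0 < r -> - T < th < T -> {for r, continuous (s2 ^~ th)}.
Hypothesis bnd : forall a b, 0 < a -> exists2 K : R, 0 <= K &
  forall r th, a <= r <= b -> - T < th < T ->
  [/\ `|N1 r th| <= K, `|N2 r th| <= K, `|s1 r th| <= K & `|s2 r th| <= K].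
Hypotheses (N1x0 : N1 x 0 = 0) (N2r0 : forall r, 0 < r -> N2 r 0 = 0).
Hypothesis NB : forall r th, 0 < r -> 0 <= th <= pi ->
  `|N1 r th| <= B r /\ `|N2 r th| <= B r.
Hypothesis B0 : k.+2%:R^-1 * B k.+2%:R^-1 @[k --> \oo] --> 0.
Hypothesis Boo : B k.+2%:R @[k --> \oo] --> 0.

Let T0 : 0 < T. Proof. by apply: lt_trans piT; exact: pi_gt0. Qed.

(* [N1 + i N2] is a holomorphic function [N] at [z = r e^(i th)], for which
   [dr1] and [dr2] are the polar Cauchy-Riemann equations, and
   [U + i r v = N(z) z / (z - x)]. Hence [int_a^b v dr] has [th]-derivative
   [U b - U a]; it tends to 0 with [th], as [N x = 0] cancels the pole, and
   at [th = pi] it is [int_a^b N2 / (r + x) dr]. *)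
Let Dn r th := (r - x * cos th) ^+ 2 + (x * sin th) ^+ 2.
Let v r th := (N2 r th * (r - x * cos th) - N1 r th * (x * sin th)) / Dn r th.
Let U r th := r * (N1 r th * (r - x * cos th) + N2 r th * (x * sin th)) / Dn r th.
(** The common value of dv/dth and dU/dr: the Cauchy-Riemann equation for N(z) z / (z - x), with the
    factor r removed. *)
Let w r th := (s2 r th * (r - x * cos th) + N2 r th * (x * sin th)
    - s1 r th * (x * sin th) - N1 r th * (x * cos th)) / Dn r th
  - (N2 r th * (r - x * cos th) - N1 r th * (x * sin th)) * (2 * r * (x * sin th)) / Dn r th ^+ 2.

Let DnE r th : Dn r th = (r - x) ^+ 2 + 2 * r * x * (1 - cos th).
Proof. by rewrite /Dn exprMn sin2cos2; ring. Qed.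

Let cos_lt1 th : 0 < th < T -> cos th < 1.
Proof.
move=> /andP[th0 thT].
have -> : th = (th / 2) *+ 2 by rewrite -mulr_natl; field.
rewrite cos_mulr2n -mulr_natl cos2sin2.
have : 0 < sin (th / 2).
  apply: sin_gt0_pi; rewrite divr_gt0//= ltr_pdivrMr// mulrC.
  exact: lt_le_trans T2.
by move=> /(exprn_gt0 2); lra.
Qed.

Let Dn_gt0 r th : 0 < r -> 0 < th < T -> 0 < Dn r th.
Proof.
move=> r0 /cos_lt1 c1; rewrite DnE ltr_wpDl ?sqr_ge0//.
by rewrite !mulr_gt0// subr_gt0.
Qed.

Let inT th : 0 < th < T -> - T < th < T.
Proof. by move=> /andP[th0 ->]; rewrite andbT (lt_trans _ th0)// oppr_lt0. Qed.

Let dv r th : 0 < r -> - T < th < T -> Dn r th != 0 -> is_derive th 1 (v r) (w r th).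
Proof.
move=> r0 hth D0.
rewrite /v /w /Dn; notypeclasses refine (@der_eq _ _ _ _ _ _ _).
  der; [exact: dth2|exact: dth1|exact: D0].
by cbv beta; rewrite /= !expr1; field.
Qed.

Let dU r th : 0 < r -> - T < th < T -> Dn r th != 0 -> is_derive r 1 (U ^~ th) (w r th).
Proof.
move=> r0 hth D0.
have D0' : (r - x * cos th) ^+ 2 + (x * sin th) ^+ 2 != 0 by [].
rewrite /U /w /Dn; notypeclasses refine (@der_eq _ _ _ _ _ _ _).
  der; [exact: dr1|exact: dr2|exact: D0].
by cbv beta; rewrite /= !expr1; field; rewrite D0' gt_eqF.
Qed.

Let cw r th : 0 < r -> - T < th < T -> Dn r th != 0 -> {for r, continuous (w ^~ th)}.
Proof.
move=> r0 hth D0.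
have cDn : {for r, continuous (Dn ^~ th)} by rewrite /Dn; dercont.
have cN1 := der_cont (dr1 r0 hth). have cN2 := der_cont (dr2 r0 hth).
have c1 := cs1 r0 hth. have c2 := cs2 r0 hth.
have cp : {for r, continuous (fun r => r - x * cos th)} by dercont.
have cq : {for r, continuous (fun r : R => 2 * r * (x * sin th))} by dercont.
rewrite /w; apply: continuousB; apply: continuousM.
- apply: continuousB; last by apply: continuousM => //; exact: cvg_cst.
  apply: continuousB; last by apply: continuousM => //; exact: cvg_cst.
  by apply: continuousD; apply: continuousM => //; exact: cvg_cst.
- exact: (cvgV D0 cDn).
- apply: continuousM => //; apply: continuousB; apply: continuousM => //; exact: cvg_cst.
- have cD2 : {for r, continuous (fun r => Dn r th ^+ 2)} by rewrite /Dn; dercont.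
  by apply: (cvgV _ cD2); rewrite expf_neq0.
Qed.

Let cv r th : 0 < r -> - T < th < T -> Dn r th != 0 -> {for r, continuous (v ^~ th)}.
Proof.
move=> r0 hth D0.
have cDn : {for r, continuous (Dn ^~ th)} by rewrite /Dn; dercont.
have cN1 := der_cont (dr1 r0 hth). have cN2 := der_cont (dr2 r0 hth).
have cp : {for r, continuous (fun r => r - x * cos th)} by dercont.
rewrite /v; apply: continuousM; last exact: (cvgV D0 cDn).
by apply: continuousB; apply: continuousM => //; exact: cvg_cst.
Qed.

Let integrable_cc (f : R -> R) a b : (forall r, a <= r <= b -> {for r, continuous f}) ->
  mu.-integrable `[a, b] (EFin \o f).
Proof.
move=> cf; apply: continuous_compact_integrable; first exact: segment_compact.
by apply: cont_within => r; rewrite /= in_itv/=; exact: cf.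
Qed.

Let pos_ab r a b : 0 < a -> a <= r <= b -> 0 < r.
Proof. by move=> a0 /andP[ar _]; exact: lt_le_trans ar. Qed.

Let w_bnd a b th0 : 0 < a -> 0 < th0 < T -> exists u1 u2 K,
  [/\ u1 < th0 < u2, 0 < u1, u2 < T, 0 <= K & forall r th, a <= r <= b -> u1 < th < u2 ->
    `|w r th| <= K].
Proof.
move=> a0 hth0; have c1 := cos_lt1 hth0.
pose m0 := (1 - cos th0) / 2; have m00 : 0 < m0 by rewrite divr_gt0// subr_gt0.
have /cvgrPdist_lt/(_ _ m00)/nbhs_ballP[e e0 He] := @continuous_cos R th0.
pose e1 := Num.min e (Num.min (th0 / 2) ((T - th0) / 2)).
move: (hth0) => /andP[th00 th0T].
have e10 : 0 < e1 by rewrite !lt_min e0 !divr_gt0// subr_gt0.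
have e1e : e1 <= e by rewrite ge_min lexx.
have e1t : e1 <= th0 / 2 by rewrite !ge_min lexx orbT.
have e1T : e1 <= (T - th0) / 2 by rewrite !ge_min lexx !orbT.
have [K K0 HK] := @bnd a b a0.
(* On the window around th0 chosen below, 1 - cos th stays above m0, half its value at th0; thus m
   bounds |z - x|^2 from below there. *)
pose m := 2 * a * x * m0; have mm : 0 < m by exact: mulr_gt0 (mulr_gt0 (mulr_gt0 (ltr0Sn R 1) a0) x0) m00.
pose L := `|b| + x; have L0 : 0 <= L by rewrite addr_ge0// ltW.
exists (th0 - e1), (th0 + e1), ((K * L + K * x + K * x + K * x) / m + (K * L + K * x) * (2 * L * x) / m ^+ 2).
have KL : 0 <= K * L by exact: mulr_ge0. have Kx : 0 <= K * x by rewrite mulr_ge0// ltW.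
have x0' := ltW x0.
split; [by apply/andP; split; lra|lra|lra| |].
  by rewrite addr_ge0// !mulr_ge0 ?invr_ge0 ?exprn_ge0// ?addr_ge0// ltW.
move=> r th hr hth; have r0 := pos_ab a0 hr.
have hT : 0 < th < T by move: hth => /andP[h1 h2]; apply/andP; split; lra.
have [n1 n2 n3 n4] := HK r th hr (inT hT).
have Dm : m <= Dn r th.
  rewrite DnE (@le_trans _ _ (2 * r * x * (1 - cos th)))//; last by rewrite lerDr sqr_ge0.
  rewrite /m ler_pM ?mulr_ge0 ?(ltW a0) ?(ltW m00)//.
    by rewrite ler_wpM2r// ler_wpM2l//; case/andP: hr.
  have : ball th0 e th.
    rewrite /ball/= ltr_norml; move: hth => /andP[h1 h2]; apply/andP; split; lra.
  by move/He => /=; rewrite ltr_norml /m0 => /andP[h1 h2]; lra.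
have Di : (Dn r th)^-1 <= m^-1 by rewrite lef_pV2 ?posrE// (lt_le_trans mm).
have D0 : 0 <= (Dn r th)^-1 by rewrite invr_ge0 (le_trans _ Dm)// ltW.
have rL : `|r - x * cos th| <= L.
  rewrite (le_trans (ler_normB _ _))// lerD//.
    rewrite (ger0_norm (ltW r0)); move: hr => /andP[_ h]; exact: le_trans (ler_norm _).
  by rewrite normrM (gtr0_norm x0) ler_piMr// cos_max.
have xs : `|x * sin th| <= x by rewrite normrM (gtr0_norm x0) ler_piMr// sin_max.
have xc : `|x * cos th| <= x by rewrite normrM (gtr0_norm x0) ler_piMr// cos_max.
have rr : `|2 * r| <= 2 * L.
  rewrite normrM (gtr0_norm (ltr0n R 2))// ler_wpM2l// (gtr0_norm r0) (@le_trans _ _ `|b|)//.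
    by move: hr => /andP[_ h]; exact: le_trans (ler_norm _).
  by rewrite lerDl.
have mM (p q P Q : R) : `|p| <= P -> `|q| <= Q -> `|p * q| <= P * Q.
  by move=> h1 h2; rewrite normrM ler_pM.
have mD (p q P Q : R) : `|p| <= P -> `|q| <= Q -> `|p + q| <= P + Q.
  by move=> h1 h2; rewrite (le_trans (ler_normD _ _))// lerD.
have mB (p q P Q : R) : `|p| <= P -> `|q| <= Q -> `|p - q| <= P + Q.
  by move=> h1 h2; rewrite (le_trans (ler_normB _ _))// lerD.
rewrite /w; apply: (mB _ _ _ _); apply: (mM _ _ _ _).
- apply: (mB _ _ _ _); last exact: (mM _ _ _ _).
  apply: (mB _ _ _ _); last exact: (mM _ _ _ _).
  by apply: (mD _ _ _ _); exact: (mM _ _ _ _).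
- by rewrite ger0_norm.
- apply: (mM _ _ _ _); first by apply: (mB _ _ _ _); exact: (mM _ _ _ _).
  exact: (mM _ _ _ _).
- by rewrite -!exprVn ger0_norm ?exprn_ge0// lerXn2r// nnegrE// invr_ge0 ltW.
Qed.

Let J a b th := \int[mu]_(r in `[a, b]) v r th.

Let dJ a b th : 0 < a -> a < b -> 0 < th < T -> is_derive th 1 (J a b) (U b th - U a th).
Proof.
move=> a0 ab hth; have [u1 [u2 [K [hu u10 u2T K0 HK]]]] := @w_bnd a b th a0 hth.
have Iu : [set` `]u1, u2[] th by rewrite /= in_itv.
have uT t : u1 < t < u2 -> 0 < t < T.
  by move=> /andP[h1 h2]; rewrite (lt_trans u10 h1) (lt_trans h2 u2T).
have iv t : u1 < t < u2 -> mu.-integrable `[a, b] (EFin \o (fun r => v r t)).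
  move=> ht; apply: integrable_cc => r hr; have r0 := pos_ab a0 hr.
  by apply: cv => //; [exact/inT/uT|rewrite gt_eqF// Dn_gt0//; exact: uT].
have dvr r t : a <= r <= b -> u1 < t < u2 -> is_derive t 1 (v r) (w r t).
  move=> hr ht; have r0 := pos_ab a0 hr.
  by apply: dv => //; [exact/inT/uT|rewrite gt_eqF// Dn_gt0//; exact: uT].
have pE t r : a <= r <= b -> u1 < t < u2 -> partial1of2 (fun t r => v r t) t r = w r t.
  by move=> hr ht; rewrite partial1of2E; have [_] := dvr r t hr ht.
have FTCw : \int[mu]_(r in `[a, b]) w r th = U b th - U a th.
  rewrite -[RHS]/(fine (U b th - U a th)%:E); congr fine.
  apply: (@FTC_cc _ (U ^~ th)) => // r hr; have r0 := pos_ab a0 hr.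
    by apply: dU => //; [exact: inT|rewrite gt_eqF// Dn_gt0].
  by apply: cw => //; [exact: inT|rewrite gt_eqF// Dn_gt0].
have h1 : forall t, [set` `]u1, u2[] t -> mu.-integrable `[a, b] (EFin \o (fun r => v r t)).
  by move=> t; rewrite /= in_itv/=; exact: iv.
have h2 : forall t r, [set` `]u1, u2[] t -> `[a, b]%classic r -> derivable (fun t => v r t) t 1.
  by move=> t r; rewrite /= !in_itv/= => ht hr; have [] := dvr r t hr ht.
have h3 : mu.-integrable `[a, b] (EFin \o (fun=> K)).
  by apply: integrable_cc => r _; exact: cvg_cst.
have h4 : forall t r, [set` `]u1, u2[] t -> `[a, b]%classic r ->
    `|partial1of2 (fun t r => v r t) t r| <= K.
  by move=> t r; rewrite /= !in_itv/= => ht hr; rewrite pE// HK.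
apply: DeriveDef.
  exact: (@derivable_under_integral _ _ _ mu (fun t r => v r t) `[a, b]%classic
    (measurable_itv _) th u1 u2 Iu h1 h2 (fun=> K)).
rewrite -derive1E (@differentiation_under_integral _ _ _ mu (fun t r => v r t) `[a, b]%classic
    (measurable_itv _) th u1 u2 Iu h1 h2 (fun=> K))// -FTCw.
apply: eq_Rintegral => r; rewrite inE/= in_itv/= => hr.
by rewrite pE.
Qed.

Let q r th := Num.sqrt (Dn r th).

Let Dn_ge0 r th : 0 <= Dn r th.
Proof. by rewrite addr_ge0// sqr_ge0. Qed.

Let le_q (p : R) r th : p ^+ 2 <= Dn r th -> `|p| <= q r th.
Proof. by move=> h; rewrite /q -sqrtr_sqr ler_wsqrtr. Qed.

Let pq r th : `|r - x * cos th| <= q r th.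
Proof. by apply: le_q; rewrite lerDl sqr_ge0. Qed.

Let sq r th : `|x * sin th| <= q r th.
Proof. by apply: le_q; rewrite lerDr sqr_ge0. Qed.

Let rq r th : 0 < r -> `|r - x| <= q r th.
Proof.
move=> r0; apply: le_q; rewrite DnE lerDl !mulr_ge0// ?(ltW r0) ?(ltW x0)//.
Qed.

Let lip (f df : R -> R) a b K : (forall t, a <= t <= b -> is_derive t 1 f (df t)) ->
  (forall t, a <= t <= b -> `|df t| <= K) ->
  forall s t, a <= s <= b -> a <= t <= b -> `|f s - f t| <= K * `|s - t|.
Proof.
move=> hd hK; have main s t : s <= t -> a <= s <= b -> a <= t <= b -> `|f s - f t| <= K * `|s - t|.
  move=> st /andP[as_ sb] /andP[at_ tb].
  have [||c] := @MVT_segment _ f df s t st.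
  - move=> y; rewrite in_itv/= => /andP[sy yt]; apply: hd.
    by apply/andP; split; [exact: le_trans as_ (ltW sy)|exact: le_trans (ltW yt) tb].
  - apply: cont_within => y; rewrite /= in_itv/= => /andP[sy yt]; apply: der_cont (hd _ _).
    by apply/andP; split; [exact: le_trans as_ sy|exact: le_trans yt tb].
  - rewrite in_itv/= => /andP[sc ct] e; rewrite distrC e normrM (distrC s) ler_wpM2r//.
    by apply: hK; apply/andP; split; [exact: le_trans as_ sc|exact: le_trans ct tb].
move=> s t hs ht; have [st|ts] := leP s t; first exact: main.
by rewrite distrC (distrC s); apply: main => //; exact: ltW.
Qed.

(** As N vanishes at x, the quotient N(z) / (z - x) stays bounded near the pole: N is O(t + |r -
    x|), and t and |r - x| are both O(|z - x|). Dominated convergence with a constant then applies,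
    since [v r 0 = 0] for r <> x. *)
Let J_small a b : 0 < a -> a < b -> exists t : nat -> R,
  (forall j, 0 < t j < pi) /\ J a b (t j) @[j --> \oo] --> 0.
Proof.
move=> a0 ab.
have half0 : 0 < 1 / 2 :> R by lra.
have /cvgrPdist_lt/(_ _ half0)/nbhs_ballP[d /= d0 Hd] := @continuous_cos R 0.
pose e := Num.min d 1.
have e0 : 0 < e by rewrite lt_min d0 ltr01.
have ed : e <= d by rewrite ge_min lexx.
have e1 : e <= 1 by rewrite ge_min lexx orbT.
have cosh t : 0 <= t < e -> 1 / 2 <= cos t.
  move=> /andP[t0 te]; have : ball 0 d t.
    by rewrite /ball/= sub0r normrN ger0_norm// (lt_le_trans te).
  by move/Hd => /=; rewrite cos0 ltr_norml => /andP[h1 h2]; lra.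
have sinh t : 0 <= t < e -> t / 2 <= sin t.
  move=> /andP[t0 te].
  have [|c] := @MVT_segment _ (@sin R) (@cos R) 0 t t0.
  - by apply: cont_within => y _; exact: continuous_sin.
  rewrite in_itv/= => /andP[c0' ct]; rewrite sin0 !subr0 => ->.
  rewrite mulrC ler_wpM2r//.
  by have := cosh c; rewrite c0' (le_lt_trans ct te) => /(_ isT); lra.
(* The interval is enlarged to contain x, so that the mean value theorem can compare [N1 r 0] with
   [N1 x 0 = 0]. *)
pose a' := Num.min a x; pose b' := Num.max b x.
have a'0 : 0 < a' by rewrite lt_min a0 x0.
have [K K0 HK] := @bnd a' b' a'0.
have xin : a' <= x <= b' by rewrite ge_min le_max !lexx !orbT.
have rin r : a <= r <= b -> a' <= r <= b'.
  move=> /andP[ar rb]; rewrite ge_min le_max ar/= rb//.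
have tT t : 0 <= t < e -> - T < t < T.
  move=> /andP[t0 te]; rewrite (lt_le_trans _ t0) ?oppr_lt0//=.
  by rewrite (lt_trans te)// (le_lt_trans e1)// (lt_trans _ piT)// (lt_le_trans _ (pi_ge2 R))// ltr1n.
have N2b r t : a <= r <= b -> 0 <= t < e -> `|N2 r t| <= K * t.
  move=> hr ht; have r0 := pos_ab a0 hr.
  have t0 : 0 <= t by case/andP: ht.
  rewrite -[N2 r t]subr0 -(N2r0 r0) -[X in _ * X](ger0_norm t0) -[X in _ * `|X|]subr0.
  apply: (@lip (N2 r) (s2 r) 0 t K).
  - move=> z /andP[z0 zt]; apply: dth2 => //; apply: tT; rewrite z0/=.
    by case/andP: ht => _; exact: le_lt_trans.
  - move=> z /andP[z0 zt]; have [] := HK r z (rin r hr) _ => //; apply: tT; rewrite z0/=.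
    by case/andP: ht => _; exact: le_lt_trans.
  - by rewrite t0 lexx.
  - by rewrite lexx t0.
have N1b r t : a <= r <= b -> 0 <= t < e -> `|N1 r t| <= K * t + K / a' * `|r - x|.
  move=> hr ht; have r0 := pos_ab a0 hr.
  have t0 : 0 <= t by case/andP: ht.
  have -> : N1 r t = (N1 r t - N1 r 0) + (N1 r 0 - N1 x 0) by rewrite N1x0; ring.
  rewrite (le_trans (ler_normD _ _))// lerD//.
    rewrite -[X in _ * X](ger0_norm t0) -[X in _ * `|X|]subr0.
    apply: (@lip (N1 r) (s1 r) 0 t K).
    - move=> z /andP[z0 zt]; apply: dth1 => //; apply: tT; rewrite z0/=.
      by case/andP: ht => _; exact: le_lt_trans.
    - move=> z /andP[z0 zt]; have [] := HK r z (rin r hr) _ => //; apply: tT; rewrite z0/=.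
      by case/andP: ht => _; exact: le_lt_trans.
    - by rewrite t0 lexx.
    - by rewrite lexx t0.
  have z0 : - T < 0 < T by rewrite oppr_lt0 T0.
  apply: (@lip (N1 ^~ 0) (fun z => s2 z 0 / z) a' b' (K / a')) => //.
  - by move=> z /andP[az _]; apply: dr1 => //; exact: lt_le_trans az.
  - move=> z hz; have [_ _ _ h] := HK z 0 hz z0; have /andP[az _] := hz.
    have zz : 0 < z by exact: lt_le_trans az.
    by rewrite normrM normfV (gtr0_norm zz) ler_pM ?invr_ge0 ?(ltW zz)// lef_pV2 ?posrE.
  - exact: rin.
(* From |z - x|^2 >= 4 r x sin(t/2)^2 with r >= a' and sin(t/2) >= t/4, one gets |z - x|^2 >= (a' x
   / 4) t^2. *)
pose kap := (Num.sqrt (a' * x / 4))^-1.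
have ax0 : 0 < a' * x / 4 by rewrite divr_gt0// mulr_gt0.
have tq r t : a <= r <= b -> 0 <= t < e -> t <= kap * q r t.
  move=> hr ht; have t0 : 0 <= t by case/andP: ht.
  rewrite /kap mulrC ler_pdivlMr ?sqrtr_gt0// -{1}(ger0_norm t0) -sqrtr_sqr -sqrtrM ?sqr_ge0//.
  rewrite /q ler_wsqrtr// DnE (@le_trans _ _ (2 * r * x * (1 - cos t)))//; last by rewrite lerDr sqr_ge0.
  have t2 : 0 <= t / 2 < e.
    apply/andP; split; first by rewrite divr_ge0.
    by case/andP: ht => _; apply: le_lt_trans; lra.
  have -> : 1 - cos t = 2 * sin (t / 2) ^+ 2.
    have := cos2E (t / 2); rewrite cos2sin2 (_ : 2 * (t / 2) = t); last by field.
    by move=> ->; ring.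
  have st : (t / 4) ^+ 2 <= sin (t / 2) ^+ 2.
    have h := sinh _ t2; rewrite lerXn2r ?nnegrE ?divr_ge0//; last by lra.
    by apply: le_trans h; rewrite !divr_ge0.
  have ar : a' <= r by case/andP: (rin r hr).
  have -> : t ^+ 2 * (a' * x / 4) = 2 * a' * x * (2 * (t / 4) ^+ 2) by field.
  have x0' := ltW x0; have a0' := ltW a'0.
  by rewrite ler_pM ?mulr_ge0 ?sqr_ge0// ?ler_wpM2r// ler_wpM2l.
pose C := K * kap + (K * kap + K / a').
have Ka : 0 <= K / a' by rewrite divr_ge0// ltW.
have vb r t : a <= r <= b -> 0 < t < e -> `|v r t| <= C.
  move=> hr /andP[t0 te]; have r0 := pos_ab a0 hr.
  have ht : 0 <= t < e by rewrite ltW.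
  have tT' : 0 < t < T by rewrite t0/=; case/andP: (tT t ht).
  have D0 := Dn_gt0 r0 tT'.
  have qq : q r t * q r t = Dn r t by rewrite -expr2 sqr_sqrtr.
  rewrite /v normrM normfV (gtr0_norm D0) ler_pdivrMr// -qq.
  have n2 : `|N2 r t| <= K * kap * q r t.
    by rewrite (le_trans (N2b r t hr ht))// -mulrA ler_wpM2l// tq.
  have n1 : `|N1 r t| <= (K * kap + K / a') * q r t.
    rewrite (le_trans (N1b r t hr ht))// mulrDl lerD//.
      by rewrite -mulrA ler_wpM2l// tq.
    by rewrite ler_wpM2l// rq.
  rewrite (le_trans (ler_normB _ _))// /C mulrDl lerD// normrM mulrA ler_pM//.
pose t j := e * j.+2%:R^-1.
have tj j : 0 < t j < e.
  by rewrite /t mulr_gt0 ?invr_gt0//= -[ltRHS]mulr1 ltr_pM2l// invf_lt1// ltr1n.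
exists t; split.
  move=> j; have /andP[-> te] := tj j; rewrite (lt_trans te)// (le_lt_trans e1)//.
  by rewrite (lt_le_trans _ (pi_ge2 R))// ltr1n.
(* At r = x the kernel is singular in the limit th = 0; removing this point does not change the
   integral. *)
pose D' := `[a, b]%classic `\ x : set R.
have mD' : measurable (D' : set (measurableTypeR R)).
  by apply: measurableD => //; exact: measurable_itv.
have mv th : 0 < th < T -> measurable_fun (`[a, b]%classic : set R) (v ^~ th).
  move=> hth; apply: (integrable_meas (m := mu)); apply: integrable_cc => r hr.
  have r0 := pos_ab a0 hr.
  by apply: cv => //; [exact: inT|rewrite gt_eqF// Dn_gt0].
have tjT j : 0 < t j < T.
  have /andP[t0 te] := tj j; rewrite t0/=.
  by have := tT (t j); rewrite (ltW t0) te => /(_ isT)/andP[].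
have mvD j : measurable_fun D' (v ^~ (t j)).
  by apply: measurable_funS (mv _ (tjT j)) => // r [].
have JD j : J a b (t j) = \int[mu]_(r in D') v r (t j).
  congr fine; apply/esym; apply: integral_setD1 => //.
  by apply/measurable_EFinP; exact: mvD.
have [] := @Rdominated_cvg _ _ _ mu D' (fun j r => v r (t j)) (fun=> 0) (fun=> C) mD' _ _ _ _ => //.
- move=> r [/=]; rewrite in_itv/= => hr rx; have r0 := pos_ab a0 hr.
  have z0 : - T < 0 < T by rewrite oppr_lt0 T0.
  have D0 : Dn r 0 != 0.
    rewrite DnE cos0 subrr mulr0 addr0 expf_neq0// subr_eq0.
    by apply/eqP => e'; apply: rx; rewrite /= e'.
  have c := der_cont (dv r0 z0 D0).
  have v00 : v r 0 = 0 by rewrite /v N2r0// sin0 mulr0 mulr0 mul0r subrr mul0r.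
  rewrite -v00; apply: (cvg_comp t (v r)); last exact: c.
  have h : t j @[j --> \oo] --> e * 0.
    by apply: cvgM; [exact: cvg_cst|exact: cvg_k2inv].
  by rewrite mulr0 in h.
- have iC : mu.-integrable `[a, b] (EFin \o (fun=> C)).
    by apply: integrable_cc => r _; exact: cvg_cst.
  by apply: integrableS iC => // r [].
- by move=> j r [/=]; rewrite in_itv/= => hr _; exact: vb.
move=> _; rewrite Rintegral_cst// mul0r.
by under [in X in _ -> X]eq_fun do rewrite JD.
Qed.

Let U_bnd r th : 0 < r -> 0 < th <= pi -> r != x -> `|U r th| <= 2 * r * B r / `|r - x|.
Proof.
move=> r0 /andP[t0 tpi] rx.
have tT : 0 < th < T by rewrite t0 (le_lt_trans tpi).
have D0 := Dn_gt0 r0 tT.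
have q0 : 0 < q r th by rewrite sqrtr_gt0.
have qq : q r th * q r th = Dn r th by rewrite -expr2 sqr_sqrtr.
have [n1 n2] : `|N1 r th| <= B r /\ `|N2 r th| <= B r by apply: NB => //; rewrite (ltW t0).
have rx0 : 0 < `|r - x| by rewrite normr_gt0 subr_eq0.
have B0' : 0 <= B r by apply: le_trans n1.
rewrite /U normrM normfV (gtr0_norm D0) normrM (gtr0_norm r0).
apply: (@le_trans _ _ (r * (2 * B r * q r th) / Dn r th)).
  rewrite ler_wpM2r ?invr_ge0 ?(ltW D0)// ler_wpM2l ?(ltW r0)//.
  rewrite (le_trans (ler_normD _ _))// (_ : 2 * _ * _ = B r * q r th + B r * q r th); last by ring.
  by rewrite lerD// normrM ler_pM.
rewrite -qq.
have -> : r * (2 * B r * q r th) / (q r th * q r th) = 2 * r * B r / q r th.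
  by field; rewrite gt_eqF.
rewrite ler_wpM2l ?mulr_ge0 ?(ltW r0)// lef_pV2 ?posrE//; exact: rq.
Qed.

Lemma rotation_limit :
  \int[mu]_(r in kitv k) (N2 r pi / (r + x)) @[k --> \oo] --> 0.
Proof.
have JE k : \int[mu]_(r in kitv k) (N2 r pi / (r + x)) = J k.+2%:R^-1 k.+2%:R pi.
  apply: eq_Rintegral => r; rewrite inE => /kitvP r0.
  rewrite /v /Dn cospi sinpi !mulr0 subr0 expr0n addr0 mulrN1 opprK; field.
  by rewrite gt_eqF// addr_gt0.
under eq_fun do rewrite JE.
(* The angle varies by at most pi. The constants come from b / (b - x) <= 2 for b >= 2 x and from 1
   / (x - a) <= 2 / x for a <= x / 2, inserted in [U_bnd]. *)
pose E k : R := pi * (4 * B k.+2%:R + 4 / x * (k.+2%:R^-1 * B k.+2%:R^-1)).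
have cE : E k @[k --> \oo] --> pi * (4 * 0 + 4 / x * 0).
  apply: cvgM; first exact: cvg_cst.
  by apply: cvgD; (apply: cvgM; first exact: cvg_cst).
rewrite !mulr0 addr0 mulr0 in cE.
apply: norm_cvg0; apply: (@squeeze_cvgr _ _ _ _ (cst 0) _ _ _ _ _ cE); last exact: cvg_cst.
near=> k; rewrite /= normr_ge0/=.
have : k.+2%:R^-1 <= x / 2.
  near: k; have /cvgrPdist_le/(_ (x / 2)) := @cvg_k2inv R; rewrite divr_gt0// => /(_ isT).
  by apply: filterS => k; rewrite sub0r normrN ger0_norm.
have : 2 * x <= k.+2%:R.
  apply: (@le_trans _ _ k%:R); last by rewrite ler_nat -addn2 leq_addr.
  near: k; exact: nbhs_infty_ger.
have := @kitv_lt R k.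
have : 0 < k.+2%:R^-1 :> R by rewrite invr_gt0.
rewrite /E; set a := (k.+2%:R^-1 : R); move: a => a; set b := (k.+2%:R : R); move: b => b a0 ab bx ax.
have b0 : 0 < b by exact: lt_trans ab.
have Ub th : 0 < th <= pi -> `|U b th| <= 4 * B b.
  move=> hth; have bx' : x < b by apply: lt_le_trans bx; rewrite mulr_natl mulr2n ltrDl.
  have B0' : 0 <= B b.
    have [h _] : `|N1 b th| <= B b /\ `|N2 b th| <= B b.
      by apply: NB => //; case/andP: hth => /ltW ->.
    exact: le_trans h.
  rewrite (le_trans (U_bnd b0 hth _))// ?gt_eqF// (gtr0_norm (x := b - x)) ?subr_gt0//.
  rewrite ler_pdivrMr ?subr_gt0//; have := ler_wpM2r B0' bx; lra.
have Ua th : 0 < th <= pi -> `|U a th| <= 4 / x * (a * B a).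
  move=> hth; have bx' : a < x by lra.
  have B0' : 0 <= B a.
    have [h _] : `|N1 a th| <= B a /\ `|N2 a th| <= B a.
      by apply: NB => //; case/andP: hth => /ltW ->.
    exact: le_trans h.
  rewrite (le_trans (U_bnd a0 hth _))// ?lt_eqF// (ltr0_norm (x := a - x)) ?subr_lt0// opprB.
  rewrite ler_pdivrMr ?subr_gt0//.
  have aB : 0 <= a * B a by rewrite mulr_ge0// ltW.
  rewrite (_ : 2 * a * B a = 2 * (a * B a)); last by ring.
  rewrite mulrAC ler_wpM2r// mulrAC ler_pdivlMr//; lra.
apply/ler_addgt0Pr => e e0.
have [t [ht ct]] := J_small a0 ab.
move/cvgrPdist_le : ct => /(_ e e0)[j _ /(_ j (leqnn j))]; rewrite sub0r normrN => Jt.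
have /andP[t0 tpi] := ht j.
(* The mean value theorem starts at t_j > 0, since at angle 0 the kernel has its pole; the value at
   t_j is below e. *)
have [||c] := @MVT_segment _ (J a b) (fun th => U b th - U a th) (t j) pi (ltW tpi).
- move=> y; rewrite in_itv/= => /andP[ty yp]; apply: dJ => //.
  by rewrite (lt_trans t0 ty) (lt_trans yp piT).
- apply: cont_within => y; rewrite /= in_itv/= => /andP[ty yp].
  apply: der_cont (@dJ a b y a0 ab _); rewrite (lt_le_trans t0 ty) (le_lt_trans yp piT)//.
rewrite in_itv/= => /andP[tc cp] Je.
have -> : J a b pi = (J a b pi - J a b (t j)) + J a b (t j) by rewrite subrK.
rewrite (le_trans (ler_normD _ _))// lerD// Je normrM mulrC.
have hc : 0 < c <= pi by rewrite (lt_le_trans t0 tc).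
rewrite ler_pM//.
  by rewrite gtr0_norm ?subr_gt0// lerBlDr lerDl ltW.
by rewrite (le_trans (ler_normB _ _))// lerD// ?Ub ?Ua.
Unshelve. all: end_near. Qed.

End rotation.

(** * The jump across the cut and its Stieltjes transform *)

Section stieltjes.
Context {R : realType}.
Notation mu := (@lebesgue_measure R).
Notation pos := (`]0%R, +oo[%classic : set R).
Implicit Types (r th a b : R).
Variables (g s : R).
Hypotheses (g0 : 0 < g) (g1 : g < 1) (s0 : 0 < s).

(** Because g < 1, this T satisfies both pi < T and g T < pi. The second inequality makes [c0]
    positive, a lower bound for the cosine of the half angle g th / 2 and thus for |1 + z^g| on the
    whole sector. *)
Let T := 2 * pi / (1 + g).
Let c0 := cos (g / 2 * T).

Let piT : pi < T.
Proof.
by rewrite /T ltr_pdivlMr ?addr_gt0// mulrC ltr_pM2r ?pi_gt0// -natr1 addrC ltrD2r.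
Qed.

Let T2 : T <= 2 * pi.
Proof.
rewrite /T ler_pdivrMr ?addr_gt0// ler_peMr//; last by rewrite lerDl ltW.
by rewrite mulr_ge0// pi_ge0.
Qed.

Let gT : 0 < g / 2 * T < pi / 2.
Proof.
have p0 := @pi_gt0 R.
have T0 : 0 < T by exact: lt_trans piT.
have h : g * T < pi.
  by rewrite /T mulrA ltr_pdivrMr ?addr_gt0//; move: g0 g1 p0; nra.
have h' : 0 < g * T by rewrite mulr_gt0.
by apply/andP; split; move: h h'; lra.
Qed.

Let c00 : 0 < c0.
Proof.
have /andP[a b] := gT; apply: cos_gt0_pihalf; rewrite b andbT.
by apply: lt_trans a; rewrite oppr_lt0 divr_gt0// pi_gt0.
Qed.

Let cos_ge th : - T < th < T -> c0 <= cos (g / 2 * th).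
Proof.
move=> hT; have hn : `|th| < T by rewrite ltr_norml.
have g20 : 0 < g / 2 by rewrite divr_gt0.
have -> : cos (g / 2 * th) = cos (g / 2 * `|th|).
  by case: (ger0P th) => // _; rewrite mulrN cosN.
have /andP[a b] := gT; have p0 := @pi_gt0 R.
have h1 : g / 2 * `|th| < g / 2 * T by rewrite ltr_pM2l.
have h0 : 0 <= g / 2 * `|th| by rewrite mulr_ge0// ltW.
rewrite /c0 leNgt; apply/negP; rewrite ltr_cos ?in_itv/=.
- by move=> /(lt_trans h1); rewrite ltxx.
- by apply/andP; split; lra.
- by apply/andP; split; lra.
Qed.

Let inT th : 0 <= th <= pi -> - T < th < T.
Proof.
move=> /andP[t0 tp]; rewrite (le_lt_trans tp piT) andbT (lt_le_trans _ t0)// oppr_lt0.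
by rewrite (lt_trans _ piT)// pi_gt0.
Qed.

Let cos_gt0_T th : - T < th < T -> 0 < cos (g / 2 * th).
Proof. by move=> /cos_ge; exact: lt_le_trans. Qed.

Let le_c0 (y c : R) : 0 <= y -> c0 <= c -> (c * (1 + y)) `^ (- s) <= c0 `^ (- s) * (1 + y) `^ (- s).
Proof.
move=> y0 cc; have y1 : 0 < 1 + y by rewrite ltr_pwDl.
rewrite -powRM ?(ltW c00) ?(ltW y1)//.
rewrite !powRN lef_pV2 ?posrE ?powR_gt0// ?mulr_gt0// ?(lt_le_trans c00)//.
rewrite ge0_ler_powR ?(ltW s0) ?nnegrE ?mulr_ge0 ?(ltW c00) ?(ltW y1) ?(le_trans (ltW c00) cc)//.
by rewrite ler_wpM2r// ltW.
Qed.

(* [-Im (1 + z^g)^(-s)] on the upper side of the cut, at [z = - r + i 0] *)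
Definition jump r := psin s (r `^ g) (g / 2 * pi).

Let jump_bnd r : `|jump r| <= c0 `^ (- s) * (1 + r `^ g) `^ (- s).
Proof.
have hp : - T < pi < T by apply: inT; rewrite pi_ge0 lexx.
apply: le_trans (psin_bnd (powR_ge0 _ _) (cos_gt0_T hp) (ltW s0)) _.
by apply: le_c0; [exact: powR_ge0|exact: cos_ge].
Qed.

Lemma cont_jump r : 0 < r -> {for r, continuous jump}.
Proof.
move=> r0; have hp : - T < pi < T by apply: inT; rewrite pi_ge0 lexx.
have cs := der_cont (der_psin_y (powR_ge0 r g) (cos_gt0_T hp) s).2.
rewrite /jump; apply: (@continuous_comp _ _ _ (fun r => r `^ g) (fun y => psin s y (g / 2 * pi))).
  by dercont.
exact: cs.
Qed.

Lemma jump_le : exists2 K : R, 0 <= K & forall r, 0 < r ->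
  `|jump r| <= K /\ `|jump r| <= K * r `^ (- (g * s)).
Proof.
have P0 : 0 <= c0 `^ (- s) by exact: powR_ge0.
exists (c0 `^ (- s)) => // r r0.
have y0 : 0 < r `^ g by rewrite powR_gt0.
split; apply: le_trans (jump_bnd r) _.
  rewrite ler_piMr// powRN invf_le1 ?powR_gt0 ?ltr_pwDl ?(ltW y0)//.
  have -> : 1 = 1 `^ s :> R by rewrite powR1.
  by rewrite ge0_ler_powR ?(ltW s0) ?nnegrE ?addr_ge0 ?(ltW y0)// powR1 lerDl ltW.
rewrite ler_wpM2l// -mulrN powRrM !powRN lef_pV2 ?posrE ?powR_gt0// ?addr_gt0//.
by rewrite ge0_ler_powR ?(ltW s0) ?nnegrE ?addr_ge0 ?(ltW y0)// lerDr.
Qed.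

Section fixed_point.
Variable x : R.
Hypothesis x0 : 0 < x.

(** Chosen so that N(z) = (1 + z^g)^(-s) - A z^(-1/2), with real and imaginary parts [N1] and [N2],
    vanishes at z = x. The exponent - 1/2 keeps z N(z) small at 0 and N(z) small at infinity. *)
Let A := (1 + x `^ g) `^ (- s) * x `^ 2^-1.

Let A0 : 0 <= A. Proof. by rewrite mulr_ge0 ?powR_ge0. Qed.

Let N1 r th := pcos s (r `^ g) (g / 2 * th) - A * r `^ (- 2^-1) * cos (th / 2).
Let N2 r th := - psin s (r `^ g) (g / 2 * th) + A * r `^ (- 2^-1) * sin (th / 2).
Let pA y th := (y ^+ 2 + y * cos (2 * (g / 2 * th))) / psqr y (g / 2 * th).
Let pB y th := y * sin (2 * (g / 2 * th)) / psqr y (g / 2 * th).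
Let s1 r th := s * g * (pB (r `^ g) th * pcos s (r `^ g) (g / 2 * th) -
    pA (r `^ g) th * psin s (r `^ g) (g / 2 * th)) + A * r `^ (- 2^-1) * (sin (th / 2) / 2).
Let s2 r th := - (s * g * (pB (r `^ g) th * psin s (r `^ g) (g / 2 * th) +
    pA (r `^ g) th * pcos s (r `^ g) (g / 2 * th))) + A * r `^ (- 2^-1) * (cos (th / 2) / 2).
(** A bound for N at all angles up to pi: O(r^(-1/2)) at 0 and tending to 0 at infinity, so that
    neither end of the ray contributes in the limit. *)
Let B r := c0 `^ (- s) * (1 + r `^ g) `^ (- s) + A * r `^ (- 2^-1).

Let dth1 r th : 0 < r -> - T < th < T -> is_derive th 1 (N1 r) (s1 r th).
Proof.
move=> r0 hT; have d := der_pcos_eta (powR_ge0 r g) (cos_gt0_T hT) s.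
have dg : is_derive th 1 (fun th : R => g / 2 * th) (g / 2) by dereq; rewrite mulr1 mulr0 addr0.
have d1 := @der_comp _ (pcos s (r `^ g)) _ _ _ _ d dg.
rewrite /N1; notypeclasses refine (@der_eq _ _ _ _ _ _ _).
  by der; exact: d1.
by rewrite /s1 /pA /pB; cbv beta; field; rewrite gt_eqF// psqr_gt0 ?powR_ge0// cos_gt0_T.
Qed.

Let dth2 r th : 0 < r -> - T < th < T -> is_derive th 1 (N2 r) (s2 r th).
Proof.
move=> r0 hT; have d := der_psin_eta (powR_ge0 r g) (cos_gt0_T hT) s.
have dg : is_derive th 1 (fun th : R => g / 2 * th) (g / 2) by dereq; rewrite mulr1 mulr0 addr0.
have d1 := @der_comp _ (psin s (r `^ g)) _ _ _ _ d dg.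
rewrite /N2; notypeclasses refine (@der_eq _ _ _ _ _ _ _).
  by der; exact: d1.
by rewrite /s2 /pA /pB; cbv beta; field; rewrite gt_eqF// psqr_gt0 ?powR_ge0// cos_gt0_T.
Qed.

Let powg r : 0 < r -> r `^ (g - 1) = r `^ g / r.
Proof. by move=> r0; rewrite -powR_mulD// powRN (powRr1 (ltW r0)). Qed.

Let powh r : 0 < r -> r `^ (- 2^-1 - 1) = r `^ (- 2^-1) / r.
Proof. by move=> r0; rewrite -powR_mulD// [r `^ (-1)]powRN (powRr1 (ltW r0)). Qed.

Let dr1 r th : 0 < r -> - T < th < T -> is_derive r 1 (N1 ^~ th) (s2 r th / r).
Proof.
move=> r0 hT; have [e d] := der_pcos_y (powR_ge0 r g) (cos_gt0_T hT) s.
set D := (X in is_derive _ _ _ X) in d; rewrite -/D in e.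
have d1 : is_derive r 1 (fun r : R => pcos s (r `^ g) (g / 2 * th)) (D * (g * (r `^ g / r))).
  apply: (@der_comp _ (fun y => pcos s y (g / 2 * th)) (fun r => r `^ g) _ _ _ d).
  by dereq => //; rewrite mulr1 powg.
rewrite /N1; notypeclasses refine (@der_eq _ _ _ _ _ _ _).
  by der; [exact: d1|].
rewrite powh// /s2 -!/(pA _ _) -!/(pB _ _) in e *.
have -> : D * (g * (r `^ g / r)) = g * (r `^ g * D) / r by ring.
by rewrite e; field; rewrite gt_eqF.
Qed.

Let dr2 r th : 0 < r -> - T < th < T -> is_derive r 1 (N2 ^~ th) (- s1 r th / r).
Proof.
move=> r0 hT; have [e d] := der_psin_y (powR_ge0 r g) (cos_gt0_T hT) s.
set D := (X in is_derive _ _ _ X) in d; rewrite -/D in e.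
have d1 : is_derive r 1 (fun r : R => psin s (r `^ g) (g / 2 * th)) (D * (g * (r `^ g / r))).
  apply: (@der_comp _ (fun y => psin s y (g / 2 * th)) (fun r => r `^ g) _ _ _ d).
  by dereq => //; rewrite mulr1 powg.
rewrite /N2; notypeclasses refine (@der_eq _ _ _ _ _ _ _).
  by der; [exact: d1|].
rewrite powh// /s1 -!/(pA _ _) -!/(pB _ _) in e *.
have -> : D * (g * (r `^ g / r)) = g * (r `^ g * D) / r by ring.
by rewrite e; field; rewrite gt_eqF.
Qed.

Let cpow r (F : R -> R) : 0 < r -> {for r `^ g, continuous F} ->
  {for r, continuous (fun r => F (r `^ g))}.
Proof.
move=> r0 cF; apply: continuous_comp; last exact: cF.
by dercont.
Qed.

Let cpAB y th : 0 <= y -> - T < th < T -> {for y, continuous (pA ^~ th)} /\ {for y, continuous (pB ^~ th)}.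
Proof.
move=> y0 hT; have M0 := psqr_gt0 y0 (cos_gt0_T hT).
have cM := der_cont (der_psqr_y y (g / 2 * th)).
have ciM : {for y, continuous (fun y => (psqr y (g / 2 * th))^-1)} by exact: cvgV (lt0r_neq0 M0) cM.
by split; apply: continuousM ciM; dercont.
Qed.

Let cs12 r th : 0 < r -> - T < th < T ->
  {for r, continuous (s1 ^~ th)} /\ {for r, continuous (s2 ^~ th)}.
Proof.
move=> r0 hT; have y0 := powR_ge0 r g.
have [/(cpow r0) cA /(cpow r0) cB] := cpAB y0 hT.
have cc := cpow r0 (der_cont (der_pcos_y y0 (cos_gt0_T hT) s).2).
have cs := cpow r0 (der_cont (der_psin_y y0 (cos_gt0_T hT) s).2).
split.
  apply: continuousD; last by dercont.
  apply: continuousM; first exact: cvg_cst.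
  by apply: continuousB; apply: continuousM.
apply: continuousD; last by dercont.
apply: continuousN; apply: continuousM; first exact: cvg_cst.
by apply: continuousD; apply: continuousM.
Qed.

Let bnd a b : 0 < a -> exists2 K : R, 0 <= K &
  forall r th, a <= r <= b -> - T < th < T ->
  [/\ `|N1 r th| <= K, `|N2 r th| <= K, `|s1 r th| <= K & `|s2 r th| <= K].
Proof.
move=> a0; pose P := c0 `^ (- s); pose Q := c0 ^- 2; pose H := A * a `^ (- 2^-1).
have P0 : 0 <= P by exact: powR_ge0.
have Q0 : 0 <= Q by rewrite invr_ge0 sqr_ge0.
have H0 : 0 <= H by rewrite mulr_ge0 ?powR_ge0.
have sg0 : 0 <= s * g by rewrite mulr_ge0// ltW.
have K0 : 0 <= s * g * (Q * P + Q * P) by rewrite mulr_ge0// addr_ge0// mulr_ge0.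
exists (P + s * g * (Q * P + Q * P) + H); first by rewrite !addr_ge0.
move=> r th /andP[ar _] hT; have r0 : 0 < r by exact: lt_le_trans ar.
have y0 := powR_ge0 r g; have ct := cos_gt0_T hT; have cge := cos_ge hT.
have y1 : (1 + r `^ g) `^ (- s) <= 1.
  rewrite powRN invf_le1 ?powR_gt0 ?ltr_pwDl//.
  have -> : 1 = 1 `^ s :> R by rewrite powR1.
  by rewrite ge0_ler_powR ?(ltW s0) ?nnegrE ?addr_ge0// powR1 lerDl.
have P1 : (cos (g / 2 * th) * (1 + r `^ g)) `^ (- s) <= P.
  by apply: le_trans (le_c0 y0 cge) _; rewrite ler_piMr.
have bc := le_trans (pcos_bnd y0 ct (ltW s0)) P1.
have bs := le_trans (psin_bnd y0 ct (ltW s0)) P1.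
have hr t : `|t| <= 1 -> `|A * r `^ (- 2^-1) * t| <= H.
  move=> t1; rewrite normrM -[H]mulr1 ler_pM// ger0_norm ?mulr_ge0 ?powR_ge0//.
  rewrite ler_wpM2l// !powRN lef_pV2 ?posrE ?powR_gt0//.
  by rewrite ge0_ler_powR ?nnegrE ?(ltW a0) ?(ltW r0)// invr_ge0.
have half (t : R) : `|t| <= 1 -> `|t / 2| <= 1.
  by move=> t1; rewrite normrM (ger0_norm (_ : 0 <= 2^-1)) ?invr_ge0// ler_pdivrMr// (le_trans t1)// mul1r ler1n.
have M0 := psqr_gt0 y0 ct.
have yM : (r `^ g) ^+ 2 + r `^ g <= Q * psqr (r `^ g) (g / 2 * th).
  have := psqr_ge (g / 2 * th) y0; rewrite exprMn => hM.
  have c2 : c0 ^+ 2 <= cos (g / 2 * th) ^+ 2 by rewrite ler_pXn2r ?nnegrE ?(ltW c00) ?(ltW ct).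
  have : c0 ^+ 2 * (1 + r `^ g) ^+ 2 <= psqr (r `^ g) (g / 2 * th).
    by apply: le_trans hM; rewrite ler_wpM2r ?sqr_ge0.
  rewrite mulrC -ler_pdivlMr ?exprn_gt0// => h.
  rewrite mulrC; apply: le_trans h; nra.
have bA : `|pA (r `^ g) th| <= Q.
  rewrite normrM normfV (gtr0_norm M0) ler_pdivrMr// (le_trans _ yM)//.
  rewrite (le_trans (ler_normD _ _))// lerD//; first by rewrite ger0_norm ?sqr_ge0.
  by rewrite normrM (ger0_norm y0) ler_piMr// cos_max.
have bB : `|pB (r `^ g) th| <= Q.
  rewrite normrM normfV (gtr0_norm M0) ler_pdivrMr// (le_trans _ yM)//.
  rewrite -[leLHS]add0r lerD ?sqr_ge0//.
  by rewrite normrM (ger0_norm y0) ler_piMr// sin_max.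
have hs (p q u v t : R) : `|p| <= Q -> `|q| <= Q -> `|u| <= P -> `|v| <= P -> `|t| <= H ->
    `|s * g * (p * u - q * v) + t| <= P + s * g * (Q * P + Q * P) + H.
  move=> hp hq hu hv ht; rewrite (le_trans (ler_normD _ _))// lerD//.
  rewrite -[leLHS]add0r lerD// normrM (ger0_norm sg0) ler_wpM2l//.
  by rewrite (le_trans (ler_normB _ _))// lerD// normrM ler_pM.
have hN (p t : R) : `|p| <= P -> `|t| <= H -> `|p + t| <= P + s * g * (Q * P + Q * P) + H.
  move=> hp ht; rewrite (le_trans (ler_normD _ _))// lerD// (le_trans hp)//.
  by rewrite lerDl.
split.
- by rewrite /N1 -mulrN; apply: hN => //; apply: hr; rewrite normrN cos_max.
- by rewrite /N2; apply: hN; [rewrite normrN|apply: hr; exact: sin_max].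
- by apply: hs => //; apply: hr; apply: half; exact: sin_max.
- rewrite /s2 -mulrN opprD.
  rewrite -[- (pB _ _ * _)]mulrN; apply: hs => //; first by rewrite normrN.
  by apply: hr; apply: half; exact: cos_max.
Qed.

Let NB r th : 0 < r -> 0 <= th <= pi -> `|N1 r th| <= B r /\ `|N2 r th| <= B r.
Proof.
move=> r0 ht; have hT := inT ht; have y0 := powR_ge0 r g.
have ct := cos_gt0_T hT; have cge := cos_ge hT.
have bc := le_trans (pcos_bnd y0 ct (ltW s0)) (le_c0 y0 cge).
have bs := le_trans (psin_bnd y0 ct (ltW s0)) (le_c0 y0 cge).
have hr t : `|t| <= 1 -> `|A * r `^ (- 2^-1) * t| <= A * r `^ (- 2^-1).
  by move=> t1; rewrite normrM ger0_norm ?mulr_ge0 ?powR_ge0// ler_piMr// mulr_ge0 ?powR_ge0.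
split; rewrite (le_trans (ler_normD _ _))// lerD// ?normrN//.
  exact: hr (cos_max _).
exact: hr (sin_max _).
Qed.

Let cvg_k2_powRN (p : R) : 0 < p -> (k.+2%:R : R) `^ (- p) @[k --> \oo] --> (0 : R).
Proof.
move=> p0; have := cvg_k2inv_powR p0; apply: cvg_trans; apply: near_eq_cvg.
by apply: nearW => k; rewrite -powR_inv1// -powRrM mulN1r.
Qed.

Let B0 : k.+2%:R^-1 * B k.+2%:R^-1 @[k --> \oo] --> (0 : R).
Proof.
have P0 : 0 <= c0 `^ (- s) by exact: powR_ge0.
apply: (@cvg_dom0 _ _ (fun k => c0 `^ (- s) * k.+2%:R^-1 + A * k.+2%:R^-1 `^ 2^-1)).
  move=> k; have r0 : 0 < k.+2%:R^-1 :> R by rewrite invr_gt0.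
  move: (k.+2%:R^-1) r0 => r r0; have y0 : 0 < r `^ g by rewrite powR_gt0.
  have y1 : (1 + r `^ g) `^ (- s) <= 1.
    rewrite powRN invf_le1 ?powR_gt0 ?ltr_pwDl ?(ltW y0)//.
    have -> : 1 = 1 `^ s :> R by rewrite powR1.
    by rewrite ge0_ler_powR ?(ltW s0) ?nnegrE ?addr_ge0 ?(ltW y0)// powR1 lerDl ltW.
  have Br : 0 <= B r by rewrite /B addr_ge0// mulr_ge0 ?powR_ge0.
  rewrite ger0_norm ?mulr_ge0 ?(ltW r0)// /B mulrDr lerD//.
    by rewrite mulrC ler_wpM2r ?(ltW r0)// ler_piMr.
  rewrite mulrCA ler_wpM2l// -[X in X * _](powRr1 (ltW r0)) powR_mulD//.
  by rewrite (_ : 1 - 2^-1 = 2^-1)//; field.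
have c : c0 `^ (- s) * k.+2%:R^-1 + A * k.+2%:R^-1 `^ 2^-1 @[k --> \oo] --> c0 `^ (- s) * 0 + A * (0 : R).
  apply: cvgD; (apply: cvgM; first exact: cvg_cst); first exact: cvg_k2inv.
  by apply: cvg_k2inv_powR; rewrite invr_gt0.
by rewrite !mulr0 addr0 in c.
Qed.

Let Boo : B k.+2%:R @[k --> \oo] --> (0 : R).
Proof.
have P0 : 0 <= c0 `^ (- s) by exact: powR_ge0.
apply: (@cvg_dom0 _ _ (fun k => c0 `^ (- s) * k.+2%:R `^ (- (g * s)) + A * k.+2%:R `^ (- 2^-1))).
  move=> k; have r0 : 0 < k.+2%:R :> R by [].
  move: (k.+2%:R) r0 => r r0; have y0 : 0 < r `^ g by rewrite powR_gt0.
  have Br : 0 <= B r by rewrite /B addr_ge0// mulr_ge0 ?powR_ge0.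
  rewrite ger0_norm// /B lerD// ler_wpM2l// -mulrN powRrM !powRN lef_pV2 ?posrE ?powR_gt0// ?addr_gt0//.
  by rewrite ge0_ler_powR ?(ltW s0) ?nnegrE ?addr_ge0 ?(ltW y0)// lerDr.
have c : c0 `^ (- s) * k.+2%:R `^ (- (g * s)) + A * k.+2%:R `^ (- 2^-1) @[k --> \oo] --> c0 `^ (- s) * 0 + A * (0 : R).
  apply: cvgD; (apply: cvgM; first exact: cvg_cst); apply: cvg_k2_powRN; first by rewrite mulr_gt0.
  by rewrite invr_gt0.
by rewrite !mulr0 addr0 in c.
Qed.

Let half_kernel : mu.-integrable pos (EFin \o (fun r => r `^ (- 2^-1) / (r + x))) /\
  \int[mu]_(r in pos) (r `^ (- 2^-1) / (r + x)) = pi * x `^ (- 2^-1).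
Proof.
pose F r := 2 * x `^ (- 2^-1) * atan (x `^ (- 2^-1) * r `^ 2^-1).
have xx : x `^ (- 2^-1) * x `^ (- 2^-1) = x^-1.
  by rewrite powR_mulD// (_ : - 2^-1 - 2^-1 = - 1) ?powR_inv1 ?(ltW x0)//; field.
have rr r : 0 < r -> r `^ 2^-1 * r `^ 2^-1 = r.
  by move=> r0; rewrite powR_mulD// (_ : 2^-1 + 2^-1 = 1) ?powRr1 ?(ltW r0)//; field.
have dF r : 0 < r -> is_derive r 1 F (r `^ (- 2^-1) / (r + x)).
  move=> r0; rewrite /F; dereq => //; rewrite (_ : 2^-1 - 1 = - 2^-1); last by field.
  have -> : (x `^ (- 2^-1) * r `^ 2^-1) ^+ 2 = x^-1 * r.
    by rewrite expr2 mulrACA xx rr.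
  transitivity (x `^ (- 2^-1) * x `^ (- 2^-1) * (1 + x^-1 * r)^-1 * r `^ (- 2^-1)).
    by field; rewrite !gt_eqF// addr_gt0.
  by rewrite xx; field; rewrite !gt_eqF// addr_gt0.
have cf r : 0 < r -> {for r, continuous (fun r => r `^ (- 2^-1) / (r + x))}.
  by move=> r0; dercont => //; rewrite gt_eqF// addr_gt0.
have fi : mu.-integrable pos (EFin \o (fun r => r `^ (- 2^-1) / (r + x))).
  apply: (integrable_pos_bnd dF cf (M := 2 * x `^ (- 2^-1) * pi)).
    by move=> r r0; rewrite divr_ge0 ?powR_ge0// addr_ge0 ?ltW.
  move=> r r0; rewrite normrM ger0_norm ?mulr_ge0 ?powR_ge0// ler_wpM2l ?mulr_ge0 ?powR_ge0//.
  have := @atan_ltpi2 R (x `^ (- 2^-1) * r `^ 2^-1).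
  have := @atan_gtNpi2 R (x `^ (- 2^-1) * r `^ 2^-1).
  by have := @pi_gt0 R; rewrite ler_norml => ? ? ?; apply/andP; split; lra.
split => //.
have -> : pi * x `^ (- 2^-1) = 2 * x `^ (- 2^-1) * (pi / 2) - 2 * x `^ (- 2^-1) * 0 by field.
apply: (FTC_pos dF cf fi).
  apply: cvgM; first exact: cvg_cst.
  rewrite -[X in _ --> X](@atan0 R).
  apply: continuous_cvg; first exact: continuous_atan.
  rewrite -[X in _ --> X](mulr0 (x `^ (- 2^-1))); apply: cvgM; first exact: cvg_cst.
  by apply: cvg_k2inv_powR; rewrite invr_gt0.
apply: cvgM; first exact: cvg_cst.
apply: cvg_comp (@cvgy_atan R).
apply/cvgryPge => a; near=> k.
rewrite powRN ler_pdivlMl ?powR_gt0//.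
apply: (@le_trans _ _ (((x `^ 2^-1 * a) ^+ 2) `^ 2^-1)).
  by rewrite (powR12_sqrt (sqr_ge0 _)) sqrtr_sqr ler_norm.
rewrite ge0_ler_powR ?nnegrE ?sqr_ge0 ?invr_ge0//.
apply: (@le_trans _ _ k%:R); last by rewrite ler_nat -addn2 leq_addr.
near: k; exact: nbhs_infty_ger.
Unshelve. all: end_near. Qed.

(** At angle pi, [N2] is A r^(-1/2) - jump(r). Its integral against 1 / (r + x) is 0 by the
    rotation, so the transform of the jump equals that of A r^(-1/2), which is pi A x^(-1/2). *)
Lemma jump_stieltjes :
  mu.-integrable pos (EFin \o (fun r => jump r / (r + x))) /\
  \int[mu]_(r in pos) (jump r / (r + x)) = pi * (1 + x `^ g) `^ (- s).
Proof.
have [hi hE] := half_kernel.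
have [K K0 HK] := jump_le.
have mj : measurable_fun pos (fun r => jump r / (r + x)).
  apply: measurable_pos_cont => r r0; apply: continuousM; first exact: cont_jump.
  by dercont; rewrite gt_eqF// addr_gt0.
have ji : mu.-integrable pos (EFin \o (fun r => jump r / (r + x))).
  apply: (@integrable_pos_dom _ 1 (g * s) (K * (1 + x^-1))) => //; first by rewrite mulr_gt0.
    move=> r r0 _; have [h _] := HK r r0.
    rewrite subrr powRr0 mulr1 normrM ler_pM// ger0_norm ?invr_ge0 ?addr_ge0 ?(ltW r0) ?(ltW x0)//.
    apply: (@le_trans _ _ x^-1); last by rewrite lerDr.
    by rewrite lef_pV2 ?posrE ?addr_gt0// lerDr ltW.
  move=> r r1; have r0 : 0 < r by exact: lt_le_trans r1.
  have [_ h] := HK r r0.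
  rewrite -powR_mulD// (powR_inv1 (ltW r0)) mulrA normrM ler_pM//.
    by rewrite (le_trans h)// ler_wpM2r ?powR_ge0// ler_peMr// lerDl invr_ge0 ltW.
  by rewrite ger0_norm ?invr_ge0 ?addr_ge0 ?(ltW x0) ?(ltW r0)// lef_pV2 ?posrE ?addr_gt0// lerDl ltW.
split => //.
have N2E r : N2 r pi / (r + x) = A * (r `^ (- 2^-1) / (r + x)) - jump r / (r + x).
  by rewrite /N2 sin_pihalf /jump mulr1 -mulrA; ring.
have mpos : measurable (pos : set (measurableTypeR R)) by exact: measurable_itv.
have hAi := integrable_scale A mpos hi.
have Ni : mu.-integrable pos (EFin \o (fun r => N2 r pi / (r + x))).
  apply: (integrable_eqf mpos _ (integrable_sub mpos hAi ji)) => r _.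
  by rewrite N2E.
have L1 : \int[mu]_(r in kitv k) (N2 r pi / (r + x)) @[k --> \oo] -->
    \int[mu]_(r in pos) (N2 r pi / (r + x)).
  apply: cvg_Rintegral_sets => //; [exact: measurable_kitv|exact: kitv_pos|].
  by move=> r /pos_lt0; exact: kitv_near.
have N1x0 : N1 x 0 = 0.
  by rewrite /N1 mulr0 pcos_eta0 ?powR_ge0// mul0r cos0 mulr1 /A -mulrA powR_mulD// subrr powRr0 mulr1 subrr.
have N2r0 r : 0 < r -> N2 r 0 = 0.
  by move=> _; rewrite /N2 mulr0 psin_eta0 mul0r sin0 mulr0 oppr0 addr0.
have L2 := rotation_limit x0 piT T2 dth1 dth2 dr1 dr2
  (fun r th hr hT => (cs12 hr hT).1) (fun r th hr hT => (cs12 hr hT).2) bnd N1x0 N2r0 NB B0 Boo.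
have E0 := cvg_unique (@Rhausdorff R) L1 L2.
have E1 : \int[mu]_(r in pos) (N2 r pi / (r + x)) =
    A * (pi * x `^ (- 2^-1)) - \int[mu]_(r in pos) (jump r / (r + x)).
  rewrite -hE -(RintegralZl A mpos hi) -(RintegralB mpos hAi ji).
  by apply: eq_Rintegral => r _; exact: N2E.
rewrite -(subr0_eq (etrans (esym E1) (E0 _))).
by rewrite /A mulrCA -mulrA powR_mulD// subrr powRr0 mulr1.
Qed.

End fixed_point.
End stieltjes.

(** * The case alpha < 2 *)

Section taylor.
Context {R : realType}.
Implicit Types (y t : R) (D : nat -> R -> R).

Lemma der_taylor_poly m (a : nat -> R) y :
  is_derive y 1 (fun y => \sum_(j < m.+1) a j / j`!%:R * y ^+ j)
    (\sum_(j < m) a j.+1 / j`!%:R * y ^+ j).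
Proof.
elim: m => [|m IH].
  rewrite big_ord0; under eq_fun do rewrite big_ord_recr big_ord0/= expr0.
  exact: der_cst.
under eq_fun do rewrite big_ord_recr/=.
notypeclasses refine (@der_eq _ _ _ _ _ _ _).
  by der; exact: IH.
rewrite [RHS]big_ord_recr/=; congr (_ + _).
rewrite factS natrM; field.
by rewrite nat1r !pnatr_eq0 -lt0n fact_gt0.
Qed.

(** Induction on m, passing to the shifted family [D j.+1]: each use of the mean value theorem
    contributes one factor y, and monotonicity of [W] moves the bound from the intermediate point to
    y. *)
Lemma taylor_bound m D (W : R -> R) :
  (forall j y, 0 <= y -> is_derive y 1 (D j) (D j.+1 y)) ->
  (forall y, 0 <= y -> `|D m y| <= W y) ->
  (forall t y, 0 <= t -> t <= y -> W t <= W y) ->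
  forall y, 0 <= y -> `|D 0%N y - \sum_(j < m) D j 0 / j`!%:R * y ^+ j| <= W y * y ^+ m.
Proof.
elim: m D => [|m IH] D dD DW Wm y y0.
  by rewrite big_ord0 subr0 expr0 mulr1 DW.
have {}IH := IH (fun j => D j.+1) (fun j => dD j.+1) DW Wm.
pose F t := D 0%N t - \sum_(j < m.+1) D j 0 / j`!%:R * t ^+ j.
pose f t := D 1%N t - \sum_(j < m) D j.+1 0 / j`!%:R * t ^+ j.
have F0 : F 0 = 0.
  rewrite /F big_ord_recl big1 => [|i _]; last by rewrite expr0n/= mulr0.
  by rewrite expr0 fact0 divr1 mulr1 addr0 subrr.
have dF t : 0 <= t -> is_derive t 1 F (f t).
  by move=> t0; rewrite /F /f; der; [exact: (dD 0%N)|exact: (der_taylor_poly m (fun j => D j 0))].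
rewrite -/(F y); have [->|yn] := eqVneq y 0; first by rewrite F0 normr0 expr0n mulr0.
have y1 : 0 < y by rewrite lt_def yn.
have [||c] := @MVT _ F f 0 y y1.
- by move=> c; rewrite in_itv/= => /andP[c0 _]; apply: dF; exact: ltW.
- by apply: cont_within => t; rewrite /= in_itv/= => /andP[t0 _]; exact: der_cont (dF t t0).
rewrite in_itv/= => /andP[c0 cy]; rewrite F0 !subr0 => ->.
rewrite normrM (ger0_norm y0) exprSr mulrA ler_wpM2r//.
apply: le_trans (IH c (ltW c0)) _.
have Wc : 0 <= W c by apply: le_trans (DW c (ltW c0)).
apply: ler_pM => //; first by rewrite exprn_ge0 ?ltW.
  exact: Wm (ltW c0) (ltW cy).
by apply: lerXn2r; rewrite ?nnegrE ?(ltW c0) ?(ltW cy).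
Qed.

End taylor.

Section jump_expansion.
Context {R : realType}.
Implicit Types y r : R.
Variables (g s : R).
Hypotheses (g0 : 0 < g) (g1 : g < 1) (s0 : 0 < s).

(** The coefficient of r^(g j) in the negative imaginary part of the binomial series of (1 + r^g
    e^(i pi g))^(-s). It is 0 for [j = 0]. *)
Definition jump_coef j : R :=
  (-1) ^+ j * (\prod_(i < j) (s + i%:R)) * - sin (j%:R * (pi * g)) / j`!%:R.

(** A Taylor expansion in y = r^g at the fixed half angle g pi / 2. There |1 + y q| >= cos eta for
    all y >= 0, so the m-th derivative is bounded on the whole half-line and the remainder estimate
    holds for every r > 0. *)
Lemma jump_expansion m : exists2 K : R, 0 <= K & forall r, 0 < r ->
  `|jump g s r - \sum_(j < m) jump_coef j * r `^ (g * j%:R)| <= K * r `^ (g * m%:R).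
Proof.
pose eta : R := g / 2 * pi.
have p0 := @pi_gt0 R.
have e0 : 0 < eta by rewrite mulr_gt0// divr_gt0.
have e1 : eta < pi / 2 by rewrite /eta; have : g * pi < pi by [rewrite gtr_pMl]; lra.
have c0 : 0 < cos eta by apply: cos_gt0_pihalf; rewrite e1 andbT; lra.
pose D (j : nat) (y : R) : R := (-1) ^+ j * (\prod_(i < j) (s + i%:R)) * pshift (s + j%:R) j y eta.
have dD j y : 0 <= y -> is_derive y 1 (D j) (D j.+1 y).
  move=> y0; have d := der_pshift y0 c0 (s + j%:R) j.
  rewrite /D; notypeclasses refine (@der_eq _ _ _ _ _ _ _).
    by der; exact: d.
  rewrite big_ord_recr/= exprS -natr1 addrA; ring.
have sj j : 0 <= s + j%:R by rewrite addr_ge0// ltW.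
have P0 j : 0 <= \prod_(i < j) (s + i%:R) by rewrite prodr_ge0.
pose K := (\prod_(i < m) (s + i%:R)) * cos eta `^ (- (s + m%:R)).
have K0 : 0 <= K by rewrite mulr_ge0 ?powR_ge0.
exists K => // r r0.
have DK y : 0 <= y -> `|D m y| <= K.
  move=> y0; rewrite /D -mulrA normrM normrX normrN1 expr1n mul1r normrM (ger0_norm (P0 m)).
  rewrite ler_wpM2l// normrM (ger0_norm (powR_ge0 _ _)).
  apply: (@le_trans _ _ (psqr y eta `^ (- ((s + m%:R) / 2)))).
    by rewrite ler_piMr ?powR_ge0// sin_max.
  apply: le_trans (psqr_powR_bnd y0 c0 (sj m)) _.
  rewrite !powRN lef_pV2 ?posrE ?powR_gt0// ?mulr_gt0 ?ltr_pwDl//.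
  rewrite ge0_ler_powR ?nnegrE ?mulr_ge0 ?addr_ge0 ?(ltW c0) ?(ltW s0)//.
  by rewrite ler_peMr ?(ltW c0)// lerDl.
have := taylor_bound dD DK (fun _ _ _ _ => lexx K) (powR_ge0 r g).
have pw j : (r `^ g) ^+ j = r `^ (g * j%:R) by rewrite -powR_mulrn ?powR_ge0// -powRrM.
rewrite pw; congr (`|_ - _| <= _).
  by rewrite /D expr0 big_ord0 !mul1r addr0 /pshift /jump /psin mulr0 mul0r subr0.
apply: eq_bigr => j _; rewrite pw; congr (_ * _).
rewrite /jump_coef /D /pshift psqr0 powR1 mul1r parg0 ?e1 ?andbT; last by rewrite (lt_trans _ e0)// oppr_lt0 divr_gt0.
rewrite mulr0 sub0r sinN; congr (_ * - sin _ / _).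
by rewrite /eta; field.
Qed.

End jump_expansion.

Section fubini_swap.
Context d1 d2 (T1 : measurableType d1) (T2 : measurableType d2) (R : realType).
Variables (m1 : {sigma_finite_measure set T1 -> \bar R})
  (m2 : {sigma_finite_measure set T2 -> \bar R}).
Variables (D1 : set T1) (D2 : set T2).
Hypotheses (mD1 : measurable D1) (mD2 : measurable D2).

Lemma integrable_prod_swap (f : T1 -> T2 -> R) :
  (m1 \x m2)%E.-integrable (D1 `*` D2) (fun z => (f z.1 z.2)%:E) ->
  (m2 \x m1)%E.-integrable (D2 `*` D1) (fun z => (f z.2 z.1)%:E).
Proof.
move=> intD; pose F : T1 * T2 -> \bar R := (fun z => (f z.1 z.2)%:E) \_ (D1 `*` D2).
have intF : (m1 \x m2)%E.-integrable setT F.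
  by have := intD; rewrite integrable_mkcond//; exact: measurableX.
have mF : measurable_fun [set: T1 * T2] F by exact: measurable_int intF.
pose G (z : T2 * T1) := F (z.2, z.1).
have mG : measurable_fun [set: T2 * T1] G.
  by apply: measurableT_comp => //; exact: measurable_swap.
have iG : (m2 \x m1)%E.-integrable setT G.
  by apply/(integrable21ltyP _ _ mG)/(integrable12ltyP _ _ mF).
rewrite integrable_mkcond//; last exact: measurableX.
apply: eq_integrable iG => // -[y x] _.
by rewrite /G /F /patch !in_setX andbC.
Qed.

End fubini_swap.

(** * The covariance as a mixture of Gaussians, alpha < 2 *)

Section jump_mixture.
Context {R : realType}.
Notation mu := (@lebesgue_measure R).
Notation pos := (`]0%R, +oo[%classic : set R).
Implicit Types r u x : R.
Variables (g s : R).
Hypotheses (g0 : 0 < g) (g1 : g < 1) (s0 : 0 < s).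
Let h := jump g s.

Let mpos : measurable (pos : set (measurableTypeR R)). Proof. exact: measurable_itv. Qed.

Lemma Rintegral_expRN r : 0 < r ->
  mu.-integrable pos (EFin \o (fun u => expR (- (r * u)))) /\
  \int[mu]_(u in pos) expR (- (r * u)) = r^-1.
Proof.
move=> r0.
have i : mu.-integrable pos (EFin \o (fun u => expR (- (r * u)))).
  apply: (integrable_eqf mpos _ (integrable_gammaM ltr01 r0)) => u _.
  by rewrite subrr powRr0 mul1r.
split=> //; rewrite (_ : r^-1 = 0 - - (1 / r)); last by rewrite sub0r opprK mul1r.
apply: (@FTC_pos _ (fun u => - (expR (- (r * u)) / r))) => //.
- by move=> u u0; dereq; field; rewrite gt_eqF.
- by move=> u u0; dercont.
- apply: cvgN; apply: cvgM; last exact: cvg_cst.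
  rewrite -[X in _ --> X]expR0; apply: continuous_cvg; first exact: continuous_expR.
  rewrite -oppr0; apply: cvgN; rewrite -(mulr0 r); apply: cvgM; first exact: cvg_cst.
  exact: cvg_k2inv.
- have c : r ^- 2 * k.+2%:R^-1 @[k --> \oo] --> (0 : R).
    by rewrite -(mulr0 (r ^- 2)); apply: cvgM; [exact: cvg_cst|exact: cvg_k2inv].
  apply: (@cvg_dom0 _ _ (fun k => r ^- 2 * k.+2%:R^-1)) => // k.
  rewrite normrN normrM !ger0_norm ?expR_ge0 ?invr_ge0 ?(ltW r0)//.
  have k0 : 0 < k.+2%:R :> R by []; move: (k.+2%:R) k0 => y y0.
  rewrite (_ : r ^- 2 * _ = (r * y)^-1 / r); last by field; rewrite !gt_eqF.
  rewrite ler_wpM2r ?invr_ge0 ?(ltW r0)// expRN lef_pV2 ?posrE ?expR_gt0 ?mulr_gt0//.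
  by rewrite (le_trans _ (expR_ge1Dx _))// lerDr.
Qed.

(** The expansion with [m = 1] has only the coefficient of index 0, which is 0, so h = O(r^g). Thus
    h(r) / r is integrable at 0, which admits x = 0 below and makes the mixing density
    integrable. *)
Let hgbnd : exists2 K : R, 0 <= K & forall r, 0 < r ->
  `|h r| <= K * r `^ g /\ `|h r| <= K * r `^ (- (g * s)).
Proof.
have [K1 K10 H1] := jump_expansion g0 g1 s0 1.
have [K2 K20 H2] := jump_le g0 g1 s0.
exists (K1 + K2); first exact: addr_ge0.
move=> r r0; have := H1 r r0; have [_ h2] := H2 r r0.
rewrite big_ord_recl big_ord0 addr0 /jump_coef expr0 big_ord0 mul0r sin0 oppr0 !mulr0 !mul0r subr0 mulr1 => h1.
split; [apply: le_trans h1 _|apply: le_trans h2 _];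
  by rewrite ler_wpM2r ?powR_ge0// ?lerDl ?lerDr.
Qed.

Let mh : measurable_fun pos h.
Proof. by apply: measurable_pos_cont => r r0; exact: cont_jump. Qed.

Let ihx x : 0 <= x -> mu.-integrable pos (EFin \o (fun r => h r / (r + x))).
Proof.
move=> x0; have [K K0 HK] := hgbnd.
have rx r : 0 < r -> `|h r / (r + x)| <= `|h r| * r `^ (-1).
  move=> r0; have rx0 : 0 < r + x by rewrite ltr_pwDl.
  rewrite normrM ler_wpM2l// ger0_norm ?invr_ge0 ?(ltW rx0)// powR_inv1 ?(ltW r0)//.
  by rewrite lef_pV2 ?posrE// lerDl.
apply: (@integrable_pos_dom _ g (g * s) K) => //; first exact: mulr_gt0.
- apply: measurable_pos_cont => r r0; apply: continuousM; first exact: cont_jump.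
  by dercont; rewrite gt_eqF// ltr_pwDl.
- move=> r r0 _; apply: le_trans (rx r r0) _.
  by rewrite -powR_mulD// mulrA ler_wpM2r ?powR_ge0//; have [] := HK r r0.
- move=> r r1; have r0 : 0 < r by exact: lt_le_trans r1.
  apply: le_trans (rx r r0) _.
  by rewrite -powR_mulD// mulrA ler_wpM2r ?powR_ge0//; have [] := HK r r0.
Qed.

(** The value x = 0, needed for the covariance at t = 0, is the limit along x = 1 / (k + 2),
    dominated by |h(r) / r|. *)
Let stieltjes x : 0 <= x -> \int[mu]_(r in pos) (h r / (r + x)) = pi * (1 + x `^ g) `^ (- s).
Proof.
rewrite le_eqVlt => /predU1P[<-|x0]; last by have [] := jump_stieltjes g0 g1 s0 x0.
have i0 := integrable_norm (ihx (lexx 0)).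
have k0 k : 0 <= k.+2%:R^-1 :> R by rewrite invr_ge0.
have m k : measurable_fun pos (fun r => h r / (r + k.+2%:R^-1)).
  exact: integrable_meas (ihx (k0 k)).
have p r : pos r -> h r / (r + k.+2%:R^-1) @[k --> \oo] --> h r / (r + 0).
  move=> /pos_lt0 r0; apply: cvgM; first exact: cvg_cst.
  apply: cvgV; first by rewrite addr0 gt_eqF.
  by apply: cvgD; [exact: cvg_cst|exact: cvg_k2inv].
have b k r : pos r -> `|h r / (r + k.+2%:R^-1)| <= `|h r / (r + 0)|.
  move=> /pos_lt0 r0; rewrite !(normrM (h r)) ler_wpM2l// addr0.
  have r1 : 0 < r + k.+2%:R^-1 by rewrite ltr_pwDl.
  by rewrite !ger0_norm ?invr_ge0 ?(ltW r0) ?(ltW r1)// lef_pV2 ?posrE// lerDl.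
have [_ c1] := Rdominated_cvg mpos m p i0 b.
have c2 : pi * (1 + k.+2%:R^-1 `^ g) `^ (- s) @[k --> \oo] --> pi * (1 + 0) `^ (- s).
  apply: cvgM; first exact: cvg_cst.
  have c0 : {for 0, continuous (fun y : R => (1 + y) `^ (- s))}.
    by dercont => //; rewrite addr0.
  exact: (cvg_comp _ _ (cvg_k2inv_powR g0) c0).
rewrite powR0 ?gt_eqF//.
have E k : \int[mu]_(r in pos) (h r / (r + k.+2%:R^-1)) = pi * (1 + k.+2%:R^-1 `^ g) `^ (- s).
  by have [] := @jump_stieltjes R g s g0 g1 s0 k.+2%:R^-1 _; rewrite ?invr_gt0.
move: c1; under eq_fun do rewrite E; move=> c1.
exact: (cvg_unique (@Rhausdorff R) c1 c2).
Qed.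

Lemma integrable_jump_exp u : 0 < u -> mu.-integrable pos (EFin \o (fun r => expR (- (r * u)) * h r)).
Proof.
move=> u0; have [K K0 HK] := hgbnd.
have g10 : 0 < g + 1 by rewrite addr_gt0.
apply: (integrable_le mpos _ _ (integrable_scale K mpos (integrable_gammaM g10 u0))).
  apply: measurable_funM; last exact: mh.
  by apply: measurable_pos_cont => r r0; dercont.
move=> r /pos_lt0 r0; rewrite (normrM (expR _)) (ger0_norm (expR_ge0 _)) addrK mulrA (mulrC r u).
by rewrite [leRHS]mulrC ler_wpM2l ?expR_ge0//; have [] := HK r r0.
Qed.

Let F x r u := expR (- ((r + x) * u)) * h r.

Let iF x : 0 <= x -> (mu \x mu)%E.-integrable (pos `*` pos) (fun z => (F x z.1 z.2)%:E).
Proof.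
move=> x0; apply: (integrable_prod_iterated mpos mpos).
  apply: measurable_funM; last exact: (measurable_fun_fst mpos mh).
  apply: measurableT_comp => //; apply: measurable_funN; apply: measurable_funM.
    by apply: measurable_funD => //; apply: (measurable_fun_fst mpos (g := id)).
  exact: (measurable_fun_snd mpos (g := id)).
have -> : (\int[mu]_(r in pos) \int[mu]_(u in pos) `|F x r u|%:E =
    \int[mu]_(r in pos) (`|h r / (r + x)|)%:E)%E; last first.
  by have /integrableP[_] := ihx x0.
apply: eq_integral => r; rewrite inE => /pos_lt0 r0; have rx0 : 0 < r + x by rewrite ltr_pwDl.
have [i1 i2] := Rintegral_expRN rx0.
transitivity (\int[mu]_(u in pos) (`|h r| * expR (- ((r + x) * u)))%:E)%E.
  by apply: eq_integral => u _; rewrite /F (normrM (expR _)) (ger0_norm (expR_ge0 _)) mulrC.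
rewrite (normrM (h r)) (ger0_norm (_ : 0 <= (r + x)^-1)) ?invr_ge0 ?(ltW rx0)// -i2.
rewrite -(RintegralZl _ mpos i1) /Rintegral fineK//.
exact: (integrable_fin_num mpos (integrable_scale `|h r| mpos i1)).
Qed.

Let G x u r := F x r u.

Let iG x : 0 <= x -> (mu \x mu)%E.-integrable (pos `*` pos) (fun z => (G x z.1 z.2)%:E).
Proof. by move=> x0; exact: (integrable_prod_swap mpos mpos (iF x0)). Qed.

Definition mix_density u := pi^-1 * \int[mu]_(r in pos) (expR (- (r * u)) * h r).

Lemma integrable_mix_density : mu.-integrable pos (EFin \o mix_density).
Proof.
apply: (integrable_scale _ mpos).
apply: (integrable_eqf mpos _ (integrable_Rintegral1 mpos mpos (iG (lexx 0)))) => u _.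
by apply: eq_Rintegral => r _; rewrite /G /F addr0.
Qed.

Lemma mix_density_laplace x : 0 <= x ->
  \int[mu]_(u in pos) (expR (- (u * x)) * mix_density u) = (1 + x `^ g) `^ (- s).
Proof.
move=> x0.
have p0 : pi != 0 :> R by rewrite gt_eqF// pi_gt0.
have iFx := iG x0.
transitivity (pi^-1 * \int[mu]_(u in pos) \int[mu]_(r in pos) G x u r).
  rewrite -(RintegralZl _ mpos (integrable_Rintegral1 mpos mpos iFx)).
  apply: eq_Rintegral => u; rewrite inE => /pos_lt0 u0.
  rewrite /mix_density mulrCA; congr (_ * _).
  rewrite -(RintegralZl _ mpos (integrable_jump_exp u0)); apply: eq_Rintegral => r _.
  by rewrite /G /F mulrA -expRD mulrDl opprD addrC (mulrC x).
rewrite (Rintegral_Fubini mpos mpos iFx).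
rewrite -[RHS](mulKf p0) -stieltjes//; congr (_ * _).
apply: eq_Rintegral => r; rewrite inE => /pos_lt0 r0.
have rx0 : 0 < r + x by rewrite ltr_pwDl.
have [i1 i2] := Rintegral_expRN rx0.
rewrite -i2 -(RintegralZl _ mpos i1).
by apply: eq_Rintegral => u _; rewrite /G /F mulrC.
Qed.

End jump_mixture.

(** * Power moments of the heat kernel in u *)

Section heat_moment.
Context {R : realType}.
Notation mu := (@lebesgue_measure R).
Notation pos := (`]0%R, +oo[%classic : set R).
Implicit Types r u x p : R.

Let mpos : measurable (pos : set (measurableTypeR R)). Proof. exact: measurable_itv. Qed.

Lemma enorm_gt0 n (w : 'rV[R]_n) : w != 0 -> 0 < enorm w.
Proof. by move=> w0; rewrite /enorm sqrtr_gt0 dotxx_gt0. Qed.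

Lemma dot_powR n (w : 'rV[R]_n) p : dot w w `^ p = enorm w `^ (2 * p).
Proof. by rewrite -enorm_sqr -powR_mulrn ?sqrtr_ge0// -powRrM. Qed.

Lemma heatE n (w : 'rV[R]_n) u : 0 < u -> heat u w =
  ((2 * pi) ^+ n)^-1 * pi `^ (n%:R / 2) * (u `^ (- (n%:R / 2)) * expR (- (dot w w / 4 / u))).
Proof.
move=> u0; rewrite /heat sqrt_expn ?divr_ge0 ?pi_ge0 ?(ltW u0)//.
rewrite powRM ?pi_ge0 ?invr_ge0 ?(ltW u0)// -(powR_inv1 (ltW u0)) -powRrM mulN1r.
rewrite -!mulrA; congr (_ * (_ * (_ * expR (- _)))).
by rewrite powR_inv1 ?(ltW u0)// invfM.
Qed.

(** In the variable 1 / u this is a Gamma integral of exponent p + n/2 and rate |w|^2 / 4. *)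
Lemma heat_moment n (w : 'rV[R]_n) p : w != 0 -> 0 < p + n%:R / 2 ->
  mu.-integrable pos (EFin \o (fun u => heat u w * u `^ (- p - 1))) /\
  \int[mu]_(u in pos) (heat u w * u `^ (- p - 1)) =
  pi `^ (- (n%:R / 2)) * 4 `^ p * enorm w `^ (- (2 * p) - n%:R) * euler_gamma (p + n%:R / 2).
Proof.
move=> w0 pn; have d0 := dotxx_gt0 w0.
have d40 : 0 < dot w w / 4 by rewrite divr_gt0.
pose c : R := ((2 * pi) ^+ n)^-1 * pi `^ (n%:R / 2).
pose f u := u `^ (- (p + n%:R / 2) - 1) * expR (- (dot w w / 4 / u)).
have E u : pos u -> c * f u = heat u w * u `^ (- p - 1).
  move=> /pos_lt0 u0; rewrite heatE// -/c -[RHS]mulrA; congr (c * _).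
  rewrite mulrAC powR_mulD//; congr (_ `^ _ * _); ring.
have fi := integrable_gammaV pn d40.
split; first exact: integrable_eqf mpos E (integrable_scale c mpos fi).
transitivity (c * \int[mu]_(u in pos) f u).
  rewrite -(RintegralZl _ mpos fi); apply: eq_Rintegral => u; rewrite inE => /E.
  by move=> ->.
rewrite (Rintegral_gammaV pn d40) mulrA; congr (_ * _).
have p0 := @pi_gt0 R.
rewrite powRM ?invr_ge0 ?(ltW d0)// dot_powR.
rewrite -[4^-1]powR_inv1// -powRrM mulN1r opprK -(powR_mulD p (n%:R / 2) (_ : 0 < 4))//.
have -> : 4 `^ (n%:R / 2) = 2 ^+ n :> R.
  rewrite (_ : 4 = 2 `^ 2); last by rewrite powR_mulrn// -natrX.
  by rewrite -powRrM mulrCA divff// mulr1 powR_mulrn.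
rewrite /c exprMn [pi `^ (- _)]powRN.
have -> : pi ^+ n = pi `^ (n%:R / 2) * pi `^ (n%:R / 2) :> R.
  by rewrite powR_mulD// -splitr powR_mulrn// ltW.
have -> : 2 * - (p + n%:R / 2) = - (2 * p) - n%:R :> R by field.
have := powR_gt0 (n%:R / 2) p0; set y := pi `^ _ => y0.
by field; rewrite gt_eqF//= expf_neq0.
Qed.

End heat_moment.

(** * Expansion of the mixing density *)

Section watson.
Context {R : realType}.
Notation mu := (@lebesgue_measure R).
Notation pos := (`]0%R, +oo[%classic : set R).
Implicit Types r u x : R.
Variables (g s : R).
Hypotheses (g0 : 0 < g) (g1 : g < 1) (s0 : 0 < s).

Let mpos : measurable (pos : set (measurableTypeR R)). Proof. exact: measurable_itv. Qed.

Let gj j : 0 < g * j%:R + 1. Proof. by rewrite ltr_wpDl// mulr_ge0// ltW. Qed.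

(** Watson's lemma without splitting the integral: as the remainder of the jump is bounded for all r
    > 0, integrating it against e^(-r u) gives a remainder valid for all u > 0. *)
Lemma mix_density_expansion m : exists2 K : R, 0 <= K & forall u, 0 < u ->
  `|mix_density g s u - \sum_(j < m) pi^-1 * jump_coef g s j * euler_gamma (g * j%:R + 1) * u `^ (- (g * j%:R) - 1)|
  <= K * u `^ (- (g * m%:R) - 1).
Proof.
have p0 := @pi_gt0 R.
have [K K0 HK] := jump_expansion g0 g1 s0 m.
exists (pi^-1 * (K * euler_gamma (g * m%:R + 1))).
  by rewrite mulr_ge0 ?invr_ge0 ?(ltW p0)// mulr_ge0// ltW// euler_gamma_gt0.
move=> u u0.
pose e j r := r `^ (g * j%:R) * expR (- (u * r)).
have ie j : mu.-integrable pos (EFin \o e j).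
  have := integrable_gammaM (gj j) u0; apply: integrable_eqf => // r _.
  by rewrite addrK.
have ee j : \int[mu]_(r in pos) e j r = u `^ (- (g * j%:R) - 1) * euler_gamma (g * j%:R + 1).
  rewrite -opprD -(Rintegral_gammaM (gj j) u0); apply: eq_Rintegral => r _; by rewrite addrK.
have ih := integrable_jump_exp g0 g1 s0 u0.
have [iS Es] := Rintegral_sum (index_iota 0 m) mpos
  (fun j => integrable_scale (jump_coef g s j) mpos (ie j)).
have D : \int[mu]_(r in pos) (expR (- (r * u)) * jump g s r -
    \sum_(j <- index_iota 0 m) jump_coef g s j * e j r) =
    \int[mu]_(r in pos) (expR (- (r * u)) * jump g s r) -
    \sum_(j <- index_iota 0 m) jump_coef g s j * euler_gamma (g * j%:R + 1) * u `^ (- (g * j%:R) - 1).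
  rewrite (RintegralB mpos ih iS) Es; congr (_ - _); apply: eq_bigr => j _.
  by rewrite (RintegralZl _ mpos (ie j)) ee -mulrA; congr (_ * _); rewrite mulrC.
rewrite -(big_mkord xpredT (fun j => pi^-1 * jump_coef g s j * euler_gamma (g * j%:R + 1) * u `^ (- (g * j%:R) - 1))).
have -> : \sum_(0 <= j < m) pi^-1 * jump_coef g s j * euler_gamma (g * j%:R + 1) * u `^ (- (g * j%:R) - 1) =
    pi^-1 * \sum_(0 <= j < m) jump_coef g s j * euler_gamma (g * j%:R + 1) * u `^ (- (g * j%:R) - 1).
  by rewrite mulr_sumr; apply: eq_bigr => j _; rewrite !mulrA.
rewrite /mix_density -mulrBr normrM ger0_norm ?invr_ge0 ?(ltW p0)// -mulrA.
rewrite ler_wpM2l ?invr_ge0 ?(ltW p0)// -D.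
have -> : K * euler_gamma (g * m%:R + 1) * u `^ (- (g * m%:R) - 1) = \int[mu]_(r in pos) (K * e m r).
  by rewrite (RintegralZl _ mpos (ie m)) ee -mulrA; congr (_ * _); rewrite mulrC.
apply: (le_normr_Rintegral_dom mpos _ _ (integrable_scale K mpos (ie m))).
  exact: integrable_meas (integrable_sub mpos ih iS).
move=> r /pos_lt0 r0; rewrite /e mulrA [leRHS]mulrC big_mkord.
have -> : expR (- (r * u)) * jump g s r - \sum_(j < m) jump_coef g s j * (r `^ (g * j%:R) * expR (- (u * r))) =
    expR (- (u * r)) * (jump g s r - \sum_(j < m) jump_coef g s j * r `^ (g * j%:R)).
  rewrite mulrBr mulr_sumr (mulrC r u); congr (_ - _); apply: eq_bigr => j _; ring.
by rewrite (normrM (expR _)) (ger0_norm (expR_ge0 _)) ler_wpM2l ?expR_ge0// HK.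
Qed.

End watson.

(** * The asymptotic series for alpha < 2 *)

Section cauchy_lt2.
Context {R : realType}.
Notation mu := (@lebesgue_measure R).
Notation pos := (`]0%R, +oo[%classic : set R).
Variables (n : nat) (alpha beta : R) (S : 'rV[R]_n -> R).
Hypotheses (n_gt0 : (0 < n)%N) (alpha_gt0 : 0 < alpha) (alpha_lt2 : alpha < 2)
  (beta_gt0 : 0 < beta)
  (S_density : spectral_density (cauchy_covariance alpha beta) S).

Let g := alpha / 2.
Let g0 : 0 < g. Proof. by rewrite divr_gt0. Qed.
Let g1 : g < 1. Proof. by rewrite ltr_pdivrMr// mul1r. Qed.
Let mpos : measurable (pos : set (measurableTypeR R)). Proof. exact: measurable_itv. Qed.

Let S_mix w : w != 0 -> S w = \int[mu]_(u in pos) (mix_density g beta u * heat u w).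
Proof.
move=> w0; apply: (spectral_density_mix (integrable_mix_density g0 g1 beta_gt0) _ w0 S_density).
move=> t; rewrite (mix_density_laplace g0 g1 beta_gt0 (dotxx_ge0 t)) dot_powR /cauchy_covariance.
by rewrite /g mulrC divfK.
Qed.

Let term (w : 'rV[R]_n) (j : nat) := 1 / (pi `^ (n.+2%:R / 2)) * (1 / Gamma beta) *
  ((-1) ^+ j.-1 * 2 `^ (alpha * j%:R) / j`!%:R
                * Gamma (beta + j%:R)
                * Gamma ((alpha * j%:R + n%:R) / 2)
                * Gamma ((alpha * j%:R + 2) / 2)
                * sin (pi * alpha * j%:R / 2)
                * enorm w `^ (- (alpha * j%:R) - n%:R)) : R.

Let gjn j : 0 < g * j%:R + n%:R / 2.
Proof. by rewrite ltr_wpDl ?divr_gt0 ?ltr0n// mulr_ge0// ltW. Qed.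

(** Gamma((alpha j + 2) / 2) comes from the Laplace transform of r^(g j), Gamma((alpha j + n) / 2)
    and 4^(g j) = 2^(alpha j) from the moment of the heat kernel, Gamma(beta + j) / Gamma(beta) from
    the binomial coefficient. The minus sign of the sine in [jump_coef] turns (-1)^j into
    (-1)^(j-1). *)
Let coefE (w : 'rV[R]_n) j : (0 < j)%N -> term w j =
  pi^-1 * jump_coef g beta j * euler_gamma (g * j%:R + 1) *
  (pi `^ (- (n%:R / 2)) * 4 `^ (g * j%:R) * enorm w `^ (- (2 * (g * j%:R)) - n%:R)
   * euler_gamma (g * j%:R + n%:R / 2)).
Proof.
move=> j0; rewrite /term /jump_coef.
have p0 := @pi_gt0 R.
have b0 := euler_gamma_gt0 beta_gt0.
have ag : alpha = 2 * g by rewrite /g mulrC divfK.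
have h0 : 0 < beta + j%:R by rewrite ltr_pwDl.
have aj : 0 <= alpha * j%:R by rewrite mulr_ge0// ltW.
have h1 : 0 < (alpha * j%:R + n%:R) / 2 by rewrite divr_gt0// ltr_wpDl ?ltr0n.
have h2 : 0 < (alpha * j%:R + 2) / 2 by rewrite divr_gt0// ltr_wpDl.
rewrite (GammaE beta_gt0) (GammaE h0) (GammaE h1) (GammaE h2).
rewrite euler_gamma_prod//.
have -> : (alpha * j%:R + n%:R) / 2 = g * j%:R + n%:R / 2 by rewrite ag; field.
have -> : (alpha * j%:R + 2) / 2 = g * j%:R + 1 by rewrite ag; field.
have -> : pi * alpha * j%:R / 2 = j%:R * (pi * g) by rewrite ag; field.
have -> : 2 `^ (alpha * j%:R) = 4 `^ (g * j%:R) :> R.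
  rewrite (_ : 4 = 2 `^ 2); last by rewrite powR_mulrn// -natrX.
  by rewrite -powRrM ag mulrA.
have -> : - (alpha * j%:R) = - (2 * (g * j%:R)) by rewrite ag mulrA.
have -> : pi `^ (n.+2%:R / 2) = pi * pi `^ (n%:R / 2) :> R.
  rewrite -{2}(powRr1 (ltW p0)) powR_mulD//; congr (_ `^ _).
  by rewrite -addn2 natrD; field.
rewrite [pi `^ (- _)]powRN.
have y0 := powR_gt0 (n%:R / 2) p0.
have -> : (-1) ^+ j = - (-1) ^+ j.-1 :> R by rewrite -{1}(prednK j0) exprS mulN1r.
have f0 : j`!%:R != 0 :> R by rewrite pnatr_eq0 -lt0n fact_gt0.
have pn : pi != 0 :> R by rewrite gt_eqF.
move: (pi `^ (n%:R / 2)) y0 => P y0; move: pn; clear p0; move: (pi : R) => q pn.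
by field; rewrite f0 pn !gt_eqF.
Qed.

Lemma cauchy_lt2_expansion m : bigO_at_infinity
  (fun w => S w - \sum_(1 <= j < m.+1) term w j) (- (alpha * m.+1%:R) - n%:R).
Proof.
have [K K0 HK] := mix_density_expansion g0 g1 beta_gt0 m.+1.
pose c := pi `^ (- (n%:R / 2)) * 4 `^ (g * m.+1%:R) * euler_gamma (g * m.+1%:R + n%:R / 2) : R.
(* The threshold 1 serves to exclude w = 0; the estimate below applies to any w <> 0. *)
exists (K * c), 1 => w w1.
have w0 : w != 0.
  by apply: contraTneq w1 => ->; rewrite /enorm (eqP (_ : dot 0 0 == 0)) ?dotxx_eq0// sqrtr0 ler10.
pose a j := pi^-1 * jump_coef g beta j * euler_gamma (g * j%:R + 1).
have ih j := (heat_moment w0 (gjn j)).1.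
have eh j := (heat_moment w0 (gjn j)).2.
have sumE : \sum_(1 <= j < m.+1) term w j =
    \sum_(j <- index_iota 0 m.+1) a j * \int[mu]_(u in pos) (heat u w * u `^ (- (g * j%:R) - 1)).
  (* The term of index 0, present in the expansion of the density, vanishes because sin 0 = 0. *)
  rewrite [RHS]big_ltn// {1}/a /jump_coef mul0r sin0 oppr0 mulr0 !mul0r mulr0 !mul0r add0r.
  by apply: eq_big_nat => j /andP[j0 _]; rewrite coefE// eh.
have [iS Es] := Rintegral_sum (index_iota 0 m.+1) mpos
  (fun j => integrable_scale (a j) mpos (ih j)).
have i1 : mu.-integrable pos (EFin \o (fun u => mix_density g beta u * heat u w)).
  have := integrable_heat_mix (integrable_mix_density g0 g1 beta_gt0) w0 (lexx 0).
  by apply: integrable_eqf => // u _; rewrite addr0.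
have -> : S w - \sum_(1 <= j < m.+1) term w j = \int[mu]_(u in pos)
    (mix_density g beta u * heat u w -
     \sum_(j <- index_iota 0 m.+1) a j * (heat u w * u `^ (- (g * j%:R) - 1))).
  rewrite (RintegralB mpos i1 iS) Es -S_mix// sumE; congr (_ - _); apply: eq_bigr => j _.
  by rewrite (RintegralZl _ mpos (ih j)).
have -> : K * c * enorm w `^ (- (alpha * m.+1%:R) - n%:R) =
    \int[mu]_(u in pos) (K * (heat u w * u `^ (- (g * m.+1%:R) - 1))).
  rewrite (RintegralZl _ mpos (ih _)) eh /c /g.
  have -> : - (2 * (alpha / 2 * m.+1%:R)) = - (alpha * m.+1%:R) by field.
  ring.
apply: (le_normr_Rintegral_dom mpos _ _ (integrable_scale K mpos (ih _))).
  exact: integrable_meas (integrable_sub mpos i1 iS).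
move=> u /pos_lt0 u0; rewrite big_mkord.
have -> : mix_density g beta u * heat u w - \sum_(j < m.+1) a j * (heat u w * u `^ (- (g * j%:R) - 1)) =
    heat u w * (mix_density g beta u - \sum_(j < m.+1) a j * u `^ (- (g * j%:R) - 1)).
  by rewrite mulrBr mulr_sumr mulrC; congr (_ - _); apply: eq_bigr => j _; rewrite mulrCA.
rewrite (normrM (heat u w)) (ger0_norm (heat_ge0 _ _)) mulrCA ler_wpM2l ?heat_ge0//.
exact: HK.
Qed.

End cauchy_lt2.

(** * The case alpha = 2 *)

Section bessel.
Context {R : realType}.
Notation mu := (@lebesgue_measure R).
Notation pos := (`]0%R, +oo[%classic : set R).
Implicit Types a c d p s t u z : R.

Let mpos : measurable (pos : set (measurableTypeR R)). Proof. exact: measurable_itv. Qed.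

(* For [c = 1] and [d = z ^+ 2 / 4] the integral of [gig a c d] is
   [2 (2 / z)^a K_a(z)], with [K] the modified Bessel function. *)
Definition gig a c d u : R := u `^ (- a - 1) * expR (- (c * u + d / u)).

Lemma gig_ge0 a c d u : 0 <= gig a c d u.
Proof. by rewrite mulr_ge0 ?powR_ge0 ?expR_ge0. Qed.

Lemma cont_gig a c d u : 0 < u -> {for u, continuous (gig a c d)}.
Proof. by move=> u0; rewrite /gig; dercont => //; rewrite gt_eqF. Qed.

Lemma integrable_gig a c d : 0 < c -> 0 < d -> mu.-integrable pos (EFin \o gig a c d).
Proof.
move=> c0 d0; have m : measurable_fun pos (gig a c d).
  by apply: measurable_pos_cont; exact: cont_gig.
have [a1|a1] := leP 0 (a + 1).
  have [K K0 HK] := powR_expRN_bndM a1 d0.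
  apply: (integrable_le mpos m _ (integrable_scale K mpos (Rintegral_expRN c0).1)).
  move=> u /pos_lt0 u0; rewrite ger0_norm ?gig_ge0// /gig opprD expRD mulrCA mulrC.
  rewrite ler_wpM2r ?expR_ge0//.
  have := HK u^-1; rewrite invr_gt0 => /(_ u0).
  by rewrite -powR_inv1 ?(ltW u0)// -powRrM mulN1r opprD powR_inv1 ?(ltW u0).
have a0 : 0 < - a by lra.
apply: (integrable_le mpos m _ (integrable_gammaM a0 c0)) => u /pos_lt0 u0.
rewrite ger0_norm ?gig_ge0// /gig ler_wpM2l ?powR_ge0// ler_expR lerN2 lerDl.
by rewrite divr_ge0 ?ltW.
Qed.

(** The substitution u -> d / (c u), made of an inversion and a scaling, exchanges the two terms of
    the exponent; for the Bessel function this is K_(-a) = K_a. *)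
Lemma gig_reflect a c d : 0 < c -> 0 < d ->
  \int[mu]_(u in pos) gig a c d u = (c / d) `^ a * \int[mu]_(u in pos) gig (- a) c d u.
Proof.
move=> c0 d0; have cd : 0 < c / d by rewrite divr_gt0.
have E1 : \int[mu]_(u in pos) gig a c d u = \int[mu]_(u in pos) gig (- a) d c u.
  transitivity (\int[mu]_(x in pos) (gig a c d x^-1 * x ^- 2)).
    by congr fine; apply: ge0_subst_inv => [y y0|y _]; [exact: cont_gig|exact: gig_ge0].
  apply: eq_Rintegral => x; rewrite inE => /pos_lt0 x0.
  rewrite /gig invrK mulrAC [c / x + _]addrC opprK; congr (_ * _).
  rewrite -powR_inv1 ?(ltW x0)// -powRrM mulN1r opprD !opprK.
  have -> : x ^- 2 = x `^ (- 2) by rewrite powRN powR_mulrn ?ltW.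
  by rewrite powR_mulD//; congr (_ `^ _); ring.
rewrite E1; transitivity (\int[mu]_(x in pos) (gig (- a) d c (c / d * x) * (c / d))).
  apply: (@Rsubst_incr _ (fun t => c / d * t) (fun=> c / d) (gig (- a) d c) pos).
  - by move=> x x0; dereq; rewrite mulr0 addr0 mulr1.
  - by move=> x x0; exact: cvg_cst.
  - by [].
  - exact: measurable_itv.
  - by move=> x x0; apply/pos_lt0; rewrite mulr_gt0.
  - move=> y /pos_lt0 y0; exists (y / (c / d)); first by rewrite divr_gt0.
    by rewrite mulrCA divff ?mulr1// gt_eqF.
  - by move=> y /pos_lt0 y0; exact: cont_gig.
  - by move=> y _; exact: gig_ge0.
rewrite -(RintegralZl _ mpos (integrable_gig (- a) c0 d0)).
apply: eq_Rintegral => x; rewrite inE => /pos_lt0 x0; rewrite /gig.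
rewrite powRM ?(ltW cd) ?(ltW x0)// opprK.
have -> : (c / d) `^ a = (c / d) `^ (a - 1) * (c / d).
  by rewrite -{3}(powRr1 (ltW cd)) powR_mulD// subrK.
have -> : d * (c / d * x) + c / (c / d * x) = c * x + d / x.
  by field; rewrite !gt_eqF.
ring.
Qed.

(** The increasing map u -> y = T u^(1/2) - (z / 2) u^(-1/2) sends the half-line onto the whole
    line, and T^2 u + z^2 / (4 u) = y^2 + z T. Hence the Gaussian integral over y is e^(z T) (T / 2
    J + z / 4 J'), where J' has u^(-3/2) in place of u^(-1/2); by reflection J' = (2 T / z) J, so
    the bracket is T J. *)
Lemma exp_mixture z T : 0 < z -> 0 < T ->
  \int[mu]_(u in pos) (u `^ (- 2^-1) * expR (- (T ^+ 2 * u + z ^+ 2 / 4 / u))) =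
  Num.sqrt pi * (expR (- (z * T)) / T).
Proof.
move=> z0 T0; have T20 : 0 < T ^+ 2 by rewrite exprn_gt0.
have z40 : 0 < z ^+ 2 / 4 by rewrite divr_gt0// exprn_gt0.
transitivity (\int[mu]_(u in pos) gig (- 2^-1) (T ^+ 2) (z ^+ 2 / 4) u).
  by apply: eq_Rintegral => u _; rewrite /gig; congr (_ `^ _ * _); field.
set J := Rintegral _ _ _.
have J2 : \int[mu]_(u in pos) gig 2^-1 (T ^+ 2) (z ^+ 2 / 4) u = 2 * T / z * J.
  rewrite gig_reflect//; congr (_ * _).
  have -> : T ^+ 2 / (z ^+ 2 / 4) = (2 * T / z) ^+ 2 by field; rewrite gt_eqF.
  by rewrite powR12_sqrt ?sqr_ge0// sqrtr_sqr ger0_norm// divr_ge0 ?mulr_ge0 ?(ltW T0) ?(ltW z0).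
have i1 := integrable_gig (- 2^-1) T20 z40.
have i2 := integrable_gig 2^-1 T20 z40.
have [_ G] := @gauss1_integral R 1 0 ltr01.
have E : expR (z * T) * (T / 2 * J + z / 4 * (2 * T / z * J)) = Num.sqrt pi.
  rewrite -J2 -[in RHS](divr1 pi) -G.
  rewrite -(RintegralZl _ mpos i1) -(RintegralZl _ mpos i2).
  have j1 := integrable_scale (T / 2) mpos i1; have j2 := integrable_scale (z / 4) mpos i2.
  rewrite -(RintegralD mpos j1 j2) -(RintegralZl _ mpos (integrable_add mpos j1 j2)).
  apply/esym.
  transitivity (\int[mu]_(u in pos) ((fun y => expR (- (1 * (y - 0) ^+ 2))) (T * u `^ 2^-1 - z / 2 * u `^ (- 2^-1))
     * (T / 2 * u `^ (- 2^-1) + z / 4 * u `^ (- 2^-1 - 1)))).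
    apply: Rsubst_incr.
    - move=> x x0; dereq => //; rewrite (_ : 2^-1 - 1 = - 2^-1); last by field.
      by field.
    - by move=> x x0; dercont.
    - by move=> x x0; rewrite addr_gt0// mulr_gt0 ?powR_gt0// divr_gt0.
    - exact: measurableT.
    - by [].
    (* The preimage of y is q^2, where q is the positive root of T q^2 - y q = z / 2. *)
    - move=> y _; pose q : R := (y + Num.sqrt (y ^+ 2 + 2 * T * z)) / (2 * T).
      have w0 : 0 < y ^+ 2 + 2 * T * z by rewrite ltr_wpDl ?sqr_ge0// !mulr_gt0.
      have yw : `|y| < Num.sqrt (y ^+ 2 + 2 * T * z).
        by rewrite -sqrtr_sqr ltr_sqrt// ltrDl !mulr_gt0.
      have q0 : 0 < q.
        rewrite /q divr_gt0 ?mulr_gt0// -ltrBlDl sub0r (le_lt_trans _ yw)//.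
        by rewrite -normrN ler_norm.
      have qE : T * q ^+ 2 - y * q = z / 2.
        have := sqr_sqrtr (ltW w0); rewrite /q; set r := Num.sqrt _ => r2.
        transitivity ((r ^+ 2 - y ^+ 2) / (4 * T)); first by field; rewrite gt_eqF.
        by rewrite r2; field; rewrite gt_eqF.
      have hq : (q ^+ 2) `^ 2^-1 = q.
        by rewrite powR12_sqrt ?sqr_ge0// sqrtr_sqr ger0_norm ?ltW.
      exists (q ^+ 2); first by rewrite exprn_gt0.
      by rewrite powRN hq -qE; field; rewrite gt_eqF.
    - by move=> y _; dercont.
    - by move=> y _; exact: expR_ge0.
  apply: eq_Rintegral => u; rewrite inE => /pos_lt0 u0.
  rewrite /gig mul1r subr0.
  have h1 : u `^ 2^-1 * u `^ 2^-1 = u.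
    by rewrite powR_mulD// (_ : 2^-1 + 2^-1 = 1) ?powRr1 ?(ltW u0)//; field.
  have h2 : u `^ 2^-1 * u `^ (- 2^-1) = 1 by rewrite powR_mulD// subrr powRr0.
  have h3 : u `^ (- 2^-1) * u `^ (- 2^-1) = u^-1.
    by rewrite powR_mulD// (_ : - 2^-1 - 2^-1 = - 1) ?powR_inv1 ?(ltW u0)//; field.
  have -> : (T * u `^ 2^-1 - z / 2 * u `^ (- 2^-1)) ^+ 2 = T ^+ 2 * u + z ^+ 2 / 4 / u - z * T.
    transitivity (T ^+ 2 * (u `^ 2^-1 * u `^ 2^-1) + z ^+ 2 / 4 * (u `^ (- 2^-1) * u `^ (- 2^-1))
      - z * T * (u `^ 2^-1 * u `^ (- 2^-1))); first by field.
    by rewrite h1 h2 h3 mulr1.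
  rewrite opprB expRD.
  have -> : - - 2^-1 - 1 = - 2^-1 :> R by field.
  ring.
have -> : J = Num.sqrt pi * (expR (- (z * T)) / T).
  rewrite -E expRN.
  have := expR_gt0 (z * T); set e := expR _ => e0.
  by field; rewrite !gt_eqF.
by [].
Qed.

Lemma exprD1_le N x : 0 <= x -> (1 + x) ^+ N <= 2 ^+ N * (1 + x ^+ N) :> R.
Proof.
move=> x0; have [x1|/ltW x1] := leP x 1.
  apply: (@le_trans _ _ (2 ^+ N)); last by rewrite ler_peMr ?exprn_ge0// lerDl exprn_ge0.
  by apply: lerXn2r; rewrite ?nnegrE ?addr_ge0//; lra.
apply: (@le_trans _ _ ((2 * x) ^+ N)).
  by apply: lerXn2r; rewrite ?nnegrE ?addr_ge0 ?mulr_ge0//; lra.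
by rewrite exprMn ler_wpM2l ?exprn_ge0// lerDr.
Qed.

Lemma integrable_exprD1_gamma q N : 0 < q ->
  mu.-integrable pos (EFin \o (fun s => s `^ (q - 1) * (1 + s) ^+ N * expR (- s))).
Proof.
move=> q0; have qN : 0 < q + N%:R by rewrite ltr_pwDl.
have j := integrable_scale (2 ^+ N) mpos
  (integrable_add mpos (integrable_gamma q0) (integrable_gamma qN)).
apply: (integrable_le mpos _ _ j).
  by apply: measurable_pos_cont => s s0; dercont.
move=> s /pos_lt0 s0.
have sN : 0 <= (1 + s) ^+ N by rewrite exprn_ge0// addr_ge0// ltW.
rewrite ger0_norm ?mulr_ge0 ?powR_ge0 ?expR_ge0//.
have -> : s `^ (q + N%:R - 1) = s `^ (q - 1) * s ^+ N.
  by rewrite -powR_mulrn ?(ltW s0)// powR_mulD// addrAC.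
have -> : 2 ^+ N * (s `^ (q - 1) * expR (- s) + s `^ (q - 1) * s ^+ N * expR (- s)) =
  s `^ (q - 1) * (2 ^+ N * (1 + s ^+ N)) * expR (- s) by ring.
by rewrite ler_wpM2r ?expR_ge0// ler_wpM2l ?powR_ge0// exprD1_le ?ltW.
Qed.

Section representation.
Variables (p z : R).
Hypotheses (p1 : 0 < p + 1) (z1 : 1 <= z).

Let z0 : 0 < z. Proof. exact: lt_le_trans z1. Qed.
(** This is (1 + s / z)^2 - 1, so that T^2 u = u + u F(s) for T = 1 + s / z; moreover s (1 + s / (2
    z)) = (z / 2) F(s). *)
Let F s := 2 * s / z + s ^+ 2 / z ^+ 2.
Let L s := s `^ p * (1 + s / (2 * z)) `^ p * expR (- s).

Let sz s : 0 < s -> 0 <= s / (2 * z) <= s.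
Proof.
move=> s0; rewrite divr_ge0 ?mulr_ge0 ?(ltW s0) ?(ltW z0)//=.
by rewrite ler_pdivrMr ?mulr_gt0// ler_peMr ?(ltW s0)//; move: z1; lra.
Qed.

Let cL s : 0 < s -> {for s, continuous L}.
Proof.
move=> s0; have /andP[s1 _] := sz s0.
by rewrite /L; dercont => //; rewrite ?ltr_pwDl// gt_eqF ?mulr_gt0.
Qed.

Lemma integrable_bessel_rep : mu.-integrable pos (EFin \o L).
Proof.
pose N := (Num.truncn `|p|).+1.
have pN : p <= N%:R by rewrite (le_trans (ler_norm _))// ltW// truncnS_gt.
apply: (integrable_le mpos _ _ (integrable_exprD1_gamma N p1)).
  by apply: measurable_pos_cont => s s0; exact: cL.
move=> s /pos_lt0 s0; have /andP[s1 s2] := sz s0.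
rewrite ger0_norm ?mulr_ge0 ?powR_ge0 ?expR_ge0// addrK.
rewrite ler_wpM2r ?expR_ge0// ler_wpM2l ?powR_ge0//.
apply: (@le_trans _ _ ((1 + s / (2 * z)) `^ N%:R)); first by rewrite ler_powR// lerDl.
rewrite powR_mulrn ?addr_ge0//.
by apply: lerXn2r; rewrite ?nnegrE ?addr_ge0 ?(ltW s0)// lerD2l.
Qed.

(** One double integral computed in two orders. Over u it is [exp_mixture], where the factor 1 + s /
    z cancels the denominator T. Over s the same factor is, up to a constant, the derivative of [F],
    so y = F(s) gives a Gamma integral that turns u^(-1/2) into u^(-p-3/2). *)
Let f s u := s `^ p * (1 + s / (2 * z)) `^ p * (1 + s / z) *
  (u `^ (- 2^-1) * expR (- ((1 + s / z) ^+ 2 * u + z ^+ 2 / 4 / u))).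

Let A s := s `^ p * (1 + s / (2 * z)) `^ p * (1 + s / z).

Let T0 s : 0 < s -> 0 < 1 + s / z. Proof. by move=> s0; rewrite addr_gt0// divr_gt0. Qed.

Let A0 s : 0 < s -> 0 <= A s.
Proof. by move=> s0; rewrite /A mulr_ge0 ?(ltW (T0 s0))// mulr_ge0 ?powR_ge0. Qed.

Let z240 : 0 < z ^+ 2 / 4. Proof. by rewrite divr_gt0// exprn_gt0. Qed.

Let fE s u : f s u = A s * gig (- 2^-1) ((1 + s / z) ^+ 2) (z ^+ 2 / 4) u.
Proof. by rewrite /f /gig -/(A s); congr (_ * (_ `^ _ * _)); field. Qed.

Let fi s : 0 < s -> mu.-integrable pos (EFin \o f s).
Proof.
move=> s0; have Ts : 0 < (1 + s / z) ^+ 2 by rewrite exprn_gt0// T0.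
have := integrable_scale (A s) mpos (integrable_gig (- 2^-1) Ts z240).
by apply: integrable_eqf => // u _; rewrite fE.
Qed.

Let f_int_u s : 0 < s -> \int[mu]_(u in pos) f s u = Num.sqrt pi * expR (- z) * L s.
Proof.
move=> s0; have Ts := T0 s0; have T2 : 0 < (1 + s / z) ^+ 2 by rewrite exprn_gt0.
have ig := integrable_gig (- 2^-1) T2 z240.
transitivity (A s * \int[mu]_(u in pos) gig (- 2^-1) ((1 + s / z) ^+ 2) (z ^+ 2 / 4) u).
  by rewrite -(RintegralZl _ mpos ig); apply: eq_Rintegral => u _; rewrite fE.
transitivity (A s * (Num.sqrt pi * (expR (- (z * (1 + s / z))) / (1 + s / z)))).
  rewrite -(exp_mixture z0 Ts); congr (_ * _); apply: eq_Rintegral => u _.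
  by rewrite /gig; congr (_ `^ _ * _); field.
have -> : - (z * (1 + s / z)) = - z - s by field; rewrite gt_eqF.
rewrite expRD /A /L; move: (_ `^ p) (_ `^ p) => a b; move: Ts; set T := 1 + s / z => Ts.
by field; rewrite gt_eqF.
Qed.

Let f_int_s u : 0 < u -> \int[mu]_(s in pos) f s u =
  (z / 2) `^ (p + 1) * euler_gamma (p + 1) * gig (p + 2^-1) 1 (z ^+ 2 / 4) u.
Proof.
move=> u0; have z20 : 0 < z / 2 by rewrite divr_gt0.
pose C := (z / 2) `^ (p + 1) * (u `^ (- 2^-1) * expR (- (1 * u + z ^+ 2 / 4 / u))).
have F0 x : 0 < x -> 0 < F x by move=> x0; rewrite /F addr_gt0// divr_gt0 ?mulr_gt0 ?exprn_gt0.
transitivity (\int[mu]_(s in pos) (C * (F s `^ (p + 1 - 1) * expR (- (u * F s))) * (2 / z * (1 + s / z)))).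
  apply: eq_Rintegral => s; rewrite inE => /pos_lt0 s0.
  have Ts := T0 s0; have /andP[s1 _] := sz s0.
  rewrite addrK /f /C.
  have -> : s `^ p * (1 + s / (2 * z)) `^ p = (z / 2) `^ p * F s `^ p.
    rewrite -!powRM ?(ltW s0) ?(ltW z20) ?(ltW (F0 _ s0)) ?addr_ge0//.
    by congr (_ `^ _); rewrite /F; field; rewrite gt_eqF.
  have -> : (1 + s / z) ^+ 2 * u + z ^+ 2 / 4 / u = (1 * u + z ^+ 2 / 4 / u) + u * F s.
    by rewrite /F; field; rewrite !gt_eqF.
  rewrite opprD expRD.
  have -> : (z / 2) `^ (p + 1) = (z / 2) `^ p * (z / 2).
    by rewrite -{3}(powRr1 (ltW z20)) powR_mulD.
  move: (_ `^ p) (F s `^ p) (u `^ _) (expR _) (expR _) => a b c d e.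
  by field; rewrite gt_eqF.
transitivity (\int[mu]_(y in pos) (C * (y `^ (p + 1 - 1) * expR (- (u * y))))).
  apply/esym; apply: (@Rsubst_incr _ F (fun s => 2 / z * (1 + s / z))
    (fun y => C * (y `^ (p + 1 - 1) * expR (- (u * y)))) pos).
  - by move=> x x0; rewrite /F; dereq; rewrite ?gt_eqF ?exprn_gt0//; field; rewrite gt_eqF.
  - by move=> x x0; dercont; rewrite gt_eqF.
  - by move=> x x0; rewrite mulr_gt0 ?divr_gt0// T0.
  - exact: mpos.
  - by move=> x x0; apply/pos_lt0; exact: F0.
  - move=> y /pos_lt0 y0; pose r := Num.sqrt (1 + y).
    have y1 : 0 < 1 + y by rewrite addr_gt0.
    have r1 : 1 < r by rewrite -[ltLHS]sqrtr1 ltr_sqrt// ltrDl.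
    have r2 : r ^+ 2 = 1 + y by rewrite sqr_sqrtr// ltW.
    exists (z * (r - 1)); first by rewrite mulr_gt0// subr_gt0.
    transitivity (r ^+ 2 - 1); last by rewrite r2; ring.
    by rewrite /F; field; rewrite gt_eqF.
  - move=> y /pos_lt0 y0; apply: continuousM; first exact: cvg_cst.
    exact: cont_gamma_fun.
  - by move=> y _; rewrite !mulr_ge0 ?powR_ge0 ?expR_ge0.
rewrite (RintegralZl _ mpos (integrable_gammaM p1 u0)) (Rintegral_gammaM p1 u0) /C /gig.
have -> : u `^ (- (p + 2^-1) - 1) = u `^ (- 2^-1) * u `^ (- (p + 1)).
  by rewrite powR_mulD//; congr (_ `^ _); ring.
ring.
Qed.

Let iff : (mu \x mu)%E.-integrable (pos `*` pos) (fun w => (f w.1 w.2)%:E).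
Proof.
apply: (integrable_prod_iterated mpos mpos).
  have mA : measurable_fun pos A.
    apply: measurable_pos_cont => s s0; have /andP[s1 _] := sz s0.
    by rewrite /A; dercont => //; rewrite ?ltr_pwDl// gt_eqF ?mulr_gt0.
  have mT : measurable_fun pos (fun s => (1 + s / z) ^+ 2).
    by apply: measurable_pos_cont => s s0; dercont; rewrite gt_eqF.
  have mu2 : measurable_fun pos (fun u => z ^+ 2 / 4 / u).
    by apply: measurable_pos_cont => u u0; dercont; rewrite gt_eqF.
  have mu1 : measurable_fun pos (fun u => u `^ (- 2^-1)).
    by apply: measurable_pos_cont => u u0; dercont.
  rewrite /f; apply: measurable_funM; first exact: (measurable_fun_fst mpos mA).
  apply: measurable_funM; first exact: (measurable_fun_snd mpos mu1).
  apply: measurableT_comp => //; apply: measurable_funN; apply: measurable_funD.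
    apply: measurable_funM; first exact: (measurable_fun_fst mpos mT).
    exact: (measurable_fun_snd mpos (g := id)).
  exact: (measurable_fun_snd mpos mu2).
have -> : (\int[mu]_(s in pos) \int[mu]_(u in pos) `|f s u|%:E =
    \int[mu]_(s in pos) (`|Num.sqrt pi * expR (- z) * L s|)%:E)%E; last first.
  by have /integrableP[_] := integrable_scale (Num.sqrt pi * expR (- z)) mpos integrable_bessel_rep.
apply: eq_integral => s; rewrite inE => /pos_lt0 s0.
have f0 u : 0 <= f s u by rewrite fE mulr_ge0 ?A0 ?gig_ge0.
rewrite -f_int_u// ger0_norm; last by apply: Rintegral_ge0 => u _; exact: f0.
rewrite /Rintegral fineK; last exact: (integrable_fin_num mpos (fi s0)).
by apply: eq_integral => u _; rewrite ger0_norm.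
Qed.

Lemma bessel_rep : \int[mu]_(u in pos) gig (p + 2^-1) 1 (z ^+ 2 / 4) u =
  Num.sqrt pi * expR (- z) * (2 / z) `^ (p + 1) / euler_gamma (p + 1) *
  \int[mu]_(s in pos) (s `^ p * (1 + s / (2 * z)) `^ p * expR (- s)).
Proof.
have z20 : 0 < z / 2 by rewrite divr_gt0.
have ig := integrable_gig (p + 2^-1) ltr01 z240.
have g0 := euler_gamma_gt0 p1.
have y0 := powR_gt0 (p + 1) z20.
have E : Num.sqrt pi * expR (- z) * \int[mu]_(s in pos) L s =
  (z / 2) `^ (p + 1) * euler_gamma (p + 1) * \int[mu]_(u in pos) gig (p + 2^-1) 1 (z ^+ 2 / 4) u.
  rewrite -(RintegralZl _ mpos integrable_bessel_rep) -(RintegralZl _ mpos ig).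
  transitivity (\int[mu]_(s in pos) \int[mu]_(u in pos) f s u).
    by apply: eq_Rintegral => s; rewrite inE => /pos_lt0 s0; rewrite f_int_u.
  rewrite (Rintegral_Fubini mpos mpos iff).
  by apply: eq_Rintegral => s; rewrite inE => /pos_lt0 s0; rewrite f_int_s.
have -> : 2 / z = (z / 2)^-1 by rewrite invf_div.
rewrite -(powR_inv1 (ltW z20)) -powRrM mulN1r powRN.
transitivity ((Num.sqrt pi * expR (- z) * \int[mu]_(s in pos) L s) / ((z / 2) `^ (p + 1) * euler_gamma (p + 1))).
  rewrite E; set I := Rintegral _ _ _; by field; rewrite !gt_eqF.
by rewrite /L; set I := Rintegral _ _ _; field; rewrite !gt_eqF.
Qed.

End representation.
End bessel.

(** * Asymptotic expansion of the Bessel function *)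

Section bessel_expansion.
Context {R : realType}.
Notation mu := (@lebesgue_measure R).
Notation pos := (`]0%R, +oo[%classic : set R).
Implicit Types p s u z nu x : R.

Let mpos : measurable (pos : set (measurableTypeR R)). Proof. exact: measurable_itv. Qed.

(** The product of the 2 j factors of [gamma_ratioE], paired symmetrically about the middle; each
    pair is even in [nu]. *)
Definition bessel_coef nu j : R :=
  \prod_(i < j) ((nu - 2^-1 - i%:R) * (nu + 2^-1 + i%:R)).

Lemma bessel_coefN nu j : bessel_coef (- nu) j = bessel_coef nu j.
Proof. by apply: eq_bigr => i _; ring. Qed.

Lemma gamma_ratio_bessel n beta j : gamma_ratio n beta j = bessel_coef (n%:R / 2 - beta) j.
Proof.
rewrite gamma_ratioE /bessel_coef -addnn big_split_ord/= big_split/=; congr (_ * _).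
  rewrite (reindex_inj rev_ord_inj)/=; apply: eq_bigr => i _.
  by rewrite natrB// -natr1; field.
by apply: eq_bigr => i _; rewrite natrD; field.
Qed.

(** For p > M the M-th derivative grows with x, so the remainder carries the increasing weight (1 +
    x)^N with N >= p, which e^(-s) absorbs later. *)
Lemma powR1D_expansion p M : exists N, exists2 K : R, 0 <= K & forall x, 0 <= x ->
  `|(1 + x) `^ p - \sum_(j < M) (\prod_(i < j) (p - i%:R)) / j`!%:R * x ^+ j| <= K * (1 + x) ^+ N * x ^+ M.
Proof.
pose D (j : nat) (x : R) : R := (\prod_(i < j) (p - i%:R)) * (1 + x) `^ (p - j%:R).
have dD j x : 0 <= x -> is_derive x 1 (D j) (D j.+1 x).
  move=> x0; rewrite /D; dereq; first by rewrite ltr_pwDl.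
  rewrite big_ord_recr/= (_ : p - j.+1%:R = p - j%:R - 1); last by rewrite -natr1; ring.
  ring.
pose N := (Num.truncn `|p|).+1.
have pN : p <= N%:R by rewrite (le_trans (ler_norm _))// ltW// truncnS_gt.
pose K := `|\prod_(i < M) (p - i%:R)|.
have K0 : 0 <= K by exact: normr_ge0.
exists N, K => // x x0.
have := @taylor_bound _ M D (fun x => K * (1 + x) ^+ N) dD _ _ x x0.
have D0 j : D j 0 = \prod_(i < j) (p - i%:R) by rewrite /D addr0 powR1 mulr1.
have -> : D 0%N x = (1 + x) `^ p by rewrite /D big_ord0 mul1r subr0.
under eq_bigr do rewrite D0.
apply.
- move=> y y0; rewrite normrM ler_wpM2l// ger0_norm ?powR_ge0//.
  rewrite -powR_mulrn ?addr_ge0// ler_powR ?lerDl//.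
  by rewrite lerBlDr (le_trans pN)// lerDl.
- move=> t y t0 ty; rewrite ler_wpM2l//; apply: lerXn2r; rewrite ?nnegrE ?addr_ge0 ?lerD2l//.
  exact: le_trans ty.
Qed.

Let bessel nu z := \int[mu]_(u in pos) gig nu 1 (z ^+ 2 / 4) u.
Let pre nu z : R := Num.sqrt pi * expR (- z) * (2 / z) `^ (nu + 2^-1).

Let bessel_expansion_nneg nu M : 0 <= nu -> exists2 K : R, 0 <= K & forall z, 1 <= z ->
  `|bessel nu z / pre nu z - \sum_(j < M) 1 / (2 * z) ^+ j * (bessel_coef nu j / j`!%:R)| <= K * z `^ (- M%:R).
Proof.
move=> nu0; pose p : R := nu - 2^-1.
(* Here nu >= 0 is used: s^p is integrable at 0 and [bessel_rep] applies. *)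
have p1 : 0 < p + 1 by rewrite /p; lra.
have G0 := euler_gamma_gt0 p1.
have [N [K K0 HK]] := powR1D_expansion p M.
have p1M : 0 < p + 1 + M%:R by rewrite ltr_pwDl.
have iN := integrable_exprD1_gamma N p1M.
(* With x = s / (2 z) and z >= 1 the remainder is at most K (1 + s)^N (s / z)^M; its integral
   against s^p e^(-s) is K H z^(-M). *)
pose H := \int[mu]_(s in pos) (s `^ (p + 1 + M%:R - 1) * (1 + s) ^+ N * expR (- s)).
have H0 : 0 <= H.
  apply: Rintegral_ge0 => s /pos_lt0 s0.
  by rewrite !mulr_ge0 ?powR_ge0 ?expR_ge0// exprn_ge0// addr_ge0// ltW.
exists (K * H / euler_gamma (p + 1)).
  by rewrite divr_ge0 ?(ltW G0)// mulr_ge0.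
move=> z z1; have z0 : 0 < z by exact: lt_le_trans z1.
pose L s := s `^ p * (1 + s / (2 * z)) `^ p * expR (- s).
have iL : mu.-integrable pos (EFin \o L) by exact: integrable_bessel_rep.
pose c j : R := (\prod_(i < j) (p - i%:R)) / j`!%:R / (2 * z) ^+ j.
pose e (j : nat) s := s `^ (p + 1 + j%:R - 1) * expR (- s).
have pj j : 0 < p + 1 + j%:R by rewrite ltr_pwDl.
have ie j : mu.-integrable pos (EFin \o e j) by exact: integrable_gamma.
have [iS Es] := Rintegral_sum (index_iota 0 M) mpos (fun j => integrable_scale (c j) mpos (ie j)).
have -> : bessel nu z / pre nu z = (\int[mu]_(s in pos) L s) / euler_gamma (p + 1).
  have := bessel_rep p1 z1; rewrite {1}/p subrK -/(bessel nu z) => ->.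
  have : 0 < pre nu z.
    by rewrite /pre !mulr_gt0 ?expR_gt0 ?sqrtr_gt0 ?pi_gt0 ?powR_gt0// divr_gt0.
  rewrite /pre (_ : nu + 2^-1 = p + 1); last by rewrite /p; field.
  rewrite -/(L _); move: (Num.sqrt pi * _ * _) => P P0.
  by field; rewrite !gt_eqF.
have -> : \sum_(j < M) 1 / (2 * z) ^+ j * (bessel_coef nu j / j`!%:R) =
    (\sum_(j <- index_iota 0 M) \int[mu]_(s in pos) (c j * e j s)) / euler_gamma (p + 1).
  rewrite big_mkord mulr_suml; apply: eq_bigr => j _.
  rewrite (RintegralZl _ mpos (ie j)) -[\int[mu]_(s in pos) e j s]/(euler_gamma (p + 1 + j%:R)).
  rewrite euler_gamma_prod// /c /bessel_coef big_split/=.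
  have -> : \prod_(i < j) (nu + 2^-1 + i%:R) = \prod_(i < j) (p + 1 + i%:R) :> R.
    by apply: eq_bigr => i _; rewrite /p; field.
  have f0 : j`!%:R != 0 :> R by rewrite pnatr_eq0 -lt0n fact_gt0.
  have z2 : (2 * z) ^+ j != 0 by rewrite expf_neq0// gt_eqF// mulr_gt0.
  rewrite -/p; move: (\prod_(_ < _) _) (\prod_(_ < _) _) ((2 * z) ^+ j) z2 => a b d d0.
  by field; rewrite d0 f0 gt_eqF.
rewrite -mulrBl normrM (ger0_norm (_ : 0 <= (euler_gamma (p + 1))^-1)) ?invr_ge0 ?(ltW G0)//.
rewrite mulrAC ler_wpM2r ?invr_ge0 ?(ltW G0)// -Es -(RintegralB mpos iL iS).
have -> : K * H * z `^ (- M%:R) = \int[mu]_(s in pos)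
    (K * z `^ (- M%:R) * (s `^ (p + 1 + M%:R - 1) * (1 + s) ^+ N * expR (- s))).
  by rewrite (RintegralZl _ mpos iN) -/H; ring.
apply: (le_normr_Rintegral_dom mpos _ _ (integrable_scale _ mpos iN)).
  exact: integrable_meas (integrable_sub mpos iL iS).
move=> s /pos_lt0 s0; rewrite big_mkord.
have x0 : 0 <= s / (2 * z) by rewrite divr_ge0 ?mulr_ge0 ?(ltW s0) ?(ltW z0).
have xs : s / (2 * z) <= s / z.
  by rewrite ler_wpM2l ?(ltW s0)// lef_pV2 ?posrE ?mulr_gt0//; lra.
have xs1 : s / z <= s by rewrite ler_pdivrMr// ler_peMr// ltW.
have ej j : e j s = s `^ p * s ^+ j * expR (- s).
  by rewrite /e -(powR_mulrn j (ltW s0)) powR_mulD//; congr (_ `^ _ * _); ring.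
have -> : L s - \sum_(j < M) c j * e j s = s `^ p * expR (- s) *
   ((1 + s / (2 * z)) `^ p - \sum_(j < M) (\prod_(i < j) (p - i%:R)) / j`!%:R * (s / (2 * z)) ^+ j).
  rewrite mulrBr mulr_sumr /L mulrAC; congr (_ - _); apply: eq_bigr => j _.
  by rewrite ej /c expr_div_n; ring.
have pe : 0 <= s `^ p * expR (- s) by rewrite mulr_ge0 ?powR_ge0 ?expR_ge0.
rewrite (normrM (s `^ p * expR (- s))) (ger0_norm pe).
have -> : s `^ (p + 1 + M%:R - 1) = s `^ p * s ^+ M.
  by rewrite -(powR_mulrn M (ltW s0)) powR_mulD//; congr (_ `^ _); ring.
have -> : K * z `^ (- M%:R) * (s `^ p * s ^+ M * (1 + s) ^+ N * expR (- s)) =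
    s `^ p * expR (- s) * (K * (1 + s) ^+ N * (s / z) ^+ M).
  by rewrite powRN powR_mulrn ?(ltW z0)// expr_div_n; ring.
rewrite ler_wpM2l//; apply: le_trans (HK _ x0) _.
rewrite -[leLHS]mulrA -[leRHS]mulrA ler_wpM2l//; apply: ler_pM.
- by rewrite exprn_ge0// addr_ge0.
- by rewrite exprn_ge0.
- by apply: lerXn2r; rewrite ?nnegrE ?addr_ge0 ?(ltW s0)// lerD2l (le_trans xs).
- by apply: lerXn2r => //; rewrite nnegrE divr_ge0 ?(ltW s0) ?(ltW z0).
Qed.

(** For nu < 0 the reflection u -> z^2 / (4 u) multiplies the integral by (2 / z)^(2 nu). This is
    exactly the quotient of the two prefactors, and the coefficients are even in nu. *)
Lemma bessel_expansion nu M : exists2 K : R, 0 <= K & forall z, 1 <= z ->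
  `|\int[mu]_(u in pos) gig nu 1 (z ^+ 2 / 4) u /
      (Num.sqrt pi * expR (- z) * (2 / z) `^ (nu + 2^-1)) -
    \sum_(j < M) 1 / (2 * z) ^+ j * (bessel_coef nu j / j`!%:R)| <= K * z `^ (- M%:R).
Proof.
have [nu0|nu0] := leP 0 nu; first exact: bessel_expansion_nneg.
have nu0' : 0 <= - nu by rewrite oppr_ge0 ltW.
have [K K0 HK] := bessel_expansion_nneg M nu0'.
exists K => // z z1; have z0 : 0 < z by exact: lt_le_trans z1.
have := HK z z1; rewrite /bessel /pre; under eq_bigr do rewrite bessel_coefN.
congr (`|_ - _| <= _).
have z240 : 0 < z ^+ 2 / 4 by rewrite divr_gt0// exprn_gt0.
have z20 : 0 < 2 / z by rewrite divr_gt0.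
rewrite (gig_reflect nu ltr01 z240).
have -> : 1 / (z ^+ 2 / 4) = (2 / z) `^ 2 by rewrite powR_mulrn ?(ltW z20)//; field; rewrite gt_eqF.
rewrite -powRrM.
have -> : (2 / z) `^ (nu + 2^-1) = (2 / z) `^ (2 * nu) * (2 / z) `^ (- nu + 2^-1).
  by rewrite powR_mulD//; congr (_ `^ _); ring.
have := powR_gt0 (2 * nu) z20; have := powR_gt0 (- nu + 2^-1) z20.
have := expR_gt0 (- z); have : 0 < Num.sqrt pi :> R by rewrite sqrtr_gt0 pi_gt0.
move: (Num.sqrt _) (expR _) (_ `^ _) (_ `^ _) => a b c d a0 b0 c0 d0.
by field; rewrite !gt_eqF.
Qed.

End bessel_expansion.

(** * The asymptotic series for alpha = 2 *)

Section cauchy_2.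
Context {R : realType}.
Notation mu := (@lebesgue_measure R).
Notation pos := (`]0%R, +oo[%classic : set R).
Variables (n : nat) (beta : R) (S : 'rV[R]_n -> R).
Hypotheses (beta_gt0 : 0 < beta)
  (S_density : spectral_density (cauchy_covariance 2 beta) S).

Let mpos : measurable (pos : set (measurableTypeR R)). Proof. exact: measurable_itv. Qed.
Let nu : R := n%:R / 2 - beta.
Let G0 : 0 < euler_gamma beta. Proof. exact: euler_gamma_gt0. Qed.
Let c : R := (euler_gamma beta)^-1 * (((2 * pi) ^+ n)^-1 * pi `^ (n%:R / 2)).

Let S_gig (w : 'rV[R]_n) : w != 0 ->
  S w = c * \int[mu]_(u in pos) gig nu 1 (enorm w ^+ 2 / 4) u.
Proof.
move=> w0; have d40 : 0 < enorm w ^+ 2 / 4 by rewrite divr_gt0// exprn_gt0// enorm_gt0.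
have ig := integrable_gig nu ltr01 d40.
have igam := integrable_gamma beta_gt0.
pose g u := (euler_gamma beta)^-1 * (u `^ (beta - 1) * expR (- u)).
have gi : mu.-integrable pos (EFin \o g) := integrable_scale _ mpos igam.
rewrite (spectral_density_mix gi _ w0 S_density).
  rewrite -(RintegralZl _ mpos ig); apply: eq_Rintegral => u; rewrite inE => /pos_lt0 u0.
  rewrite /g (heatE _ u0) /gig /c -enorm_sqr mul1r (opprD u) expRD.
  have -> : u `^ (- nu - 1) = u `^ (beta - 1) * u `^ (- (n%:R / 2)).
    by rewrite powR_mulD//; congr (_ `^ _); rewrite /nu; ring.
  ring.
move=> t; have d1 : 0 < 1 + dot t t by rewrite ltr_pwDl// dotxx_ge0.
transitivity ((euler_gamma beta)^-1 * \int[mu]_(u in pos) (u `^ (beta - 1) * expR (- ((1 + dot t t) * u)))).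
  rewrite (Rintegral_gammaM beta_gt0 d1) mulrCA mulVf ?gt_eqF// mulr1 /cauchy_covariance.
  by rewrite powR_mulrn ?sqrtr_ge0// enorm_sqr.
rewrite -(RintegralZl _ mpos (integrable_gammaM beta_gt0 d1)).
apply: eq_Rintegral => u _; rewrite /g mulrDl mul1r (opprD u) expRD (mulrC u).
ring.
Qed.

Let prefactorE (z : R) : 0 < z ->
  c * (Num.sqrt pi * expR (- z) * (2 / z) `^ (nu + 2^-1)) =
  z `^ (beta - n.+1%:R / 2)
    / (2 `^ ((n%:R - 1) / 2 + beta) * pi `^ ((n%:R - 1) / 2) * Gamma beta) * expR (- z).
Proof.
move=> z0; have p0 := @pi_gt0 R.
rewrite (GammaE beta_gt0) /c exprMn.
rewrite -(powR_mulrn n (ltW p0)) -(powR_mulrn n (_ : 0 <= 2))//.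
rewrite -powR12_sqrt ?(ltW p0)//.
rewrite powRM ?invr_ge0 ?(ltW z0)// -(powR_inv1 (ltW z0)) -powRrM mulN1r.
have -> : - (nu + 2^-1) = beta - n.+1%:R / 2 by rewrite /nu -natr1; field.
(* The powers in (2 pi)^n are split to meet those of the prefactor: n = 1/2 + n/2 + (n - 1)/2 for
   pi, and n = (nu + 1/2) + ((n - 1)/2 + beta) for 2. *)
have -> : pi `^ n%:R = pi `^ 2^-1 * pi `^ (n%:R / 2) * pi `^ ((n%:R - 1) / 2) :> R.
  by rewrite !powR_mulD//; congr (_ `^ _); field.
have -> : 2 `^ n%:R = 2 `^ (nu + 2^-1) * 2 `^ ((n%:R - 1) / 2 + beta) :> R.
  by rewrite powR_mulD//; congr (_ `^ _); rewrite /nu; field.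
have h1 := powR_gt0 2^-1 p0; have h2 := powR_gt0 (n%:R / 2) p0.
have h3 := powR_gt0 ((n%:R - 1) / 2) p0.
have h4 : 0 < 2 `^ (nu + 2^-1) :> R by rewrite powR_gt0.
have h5 : 0 < 2 `^ ((n%:R - 1) / 2 + beta) :> R by rewrite powR_gt0.
move: (pi `^ _) (pi `^ _) (pi `^ _) (2 `^ _) (2 `^ _) h1 h2 h3 h4 h5 => x1 x2 x3 x4 x5 h1 h2 h3 h4 h5.
by field; rewrite !gt_eqF.
Qed.

Lemma cauchy_2_expansion m : bigO_at_infinity
  (fun w => S w
       / (enorm w `^ (beta - n.+1%:R / 2)
          / (2 `^ ((n%:R - 1) / 2 + beta) * pi `^ ((n%:R - 1) / 2) * Gamma beta)
          * expR (- enorm w))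
     - \sum_(0 <= j < m.+1)
          (1 / (2 * enorm w) ^+ j * (gamma_ratio n beta j / j`!%:R)))
  (- m.+1%:R).
Proof.
have [K K0 HK] := bessel_expansion nu m.+1.
exists K, 1 => w w1; have z0 : 0 < enorm w by exact: lt_le_trans w1.
have w0 : w != 0 by rewrite -dotxx_eq0 -enorm_sqr expf_neq0// gt_eqF.
have := HK _ w1; rewrite big_mkord.
under [in X in _ -> X]eq_bigr do rewrite gamma_ratio_bessel.
rewrite -prefactorE// S_gig//; congr (`|_ - _| <= _).
have c0 : c != 0.
  by rewrite /c !mulf_neq0 ?invr_neq0 ?expf_neq0 ?mulf_neq0 ?gt_eqF ?powR_gt0 ?pi_gt0.
by rewrite -mulf_div divff// mul1r.
Qed.

End cauchy_2.

Theorem proposition3p2 (R : realType) (n : nat) (alpha beta : R)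
    (S : 'rV[R]_n -> R)
    (n_gt0 : (0 < n)%N) (alpha_gt0 : 0 < alpha) (alpha_le2 : alpha <= 2)
    (beta_gt0 : 0 < beta)
    (S_density : spectral_density (cauchy_covariance alpha beta) S) :
  (alpha < 2 ->
   forall m : nat, (1 <= m)%N ->
     bigO_at_infinity
       (fun w => S w
          - 1 / (pi `^ (n.+2%:R / 2)) * (1 / Gamma beta) *
            \sum_(1 <= j < m.+1)
               ((-1) ^+ j.-1 * 2 `^ (alpha * j%:R) / j`!%:R
                * Gamma (beta + j%:R)
                * Gamma ((alpha * j%:R + n%:R) / 2)
                * Gamma ((alpha * j%:R + 2) / 2)
                * sin (pi * alpha * j%:R / 2)
                * enorm w `^ (- (alpha * j%:R) - n%:R)))
       (- (alpha * m.+1%:R) - n%:R)) /\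
  (alpha = 2 ->
   forall m : nat,
     bigO_at_infinity
       (fun w => S w
            / (enorm w `^ (beta - n.+1%:R / 2)
               / (2 `^ ((n%:R - 1) / 2 + beta) * pi `^ ((n%:R - 1) / 2)
                  * Gamma beta)
               * expR (- enorm w))
          - \sum_(0 <= j < m.+1)
               (1 / (2 * enorm w) ^+ j * (gamma_ratio n beta j / j`!%:R)))
       (- m.+1%:R)).
Proof.
split=> [alpha2 m _|alpha2 m].
  under [X in bigO_at_infinity X]eq_fun do rewrite mulr_sumr.
  exact: cauchy_lt2_expansion.
by move: S_density; rewrite alpha2 => S_density2; exact: (cauchy_2_expansion beta_gt0 S_density2 m).
Qed.
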